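(* For $i=1,2$ let $H_i$ be an affine quasi-hereditary algebra over a field $\Bbbk$ with property $(\spadesuit)$ and finite index poset $\Pi_i$, let $\mathbf{C}_i=H_i\text{-}\mathtt{gmod}$, and denote by $\Delta_i(\pi)$ and $\bar\nabla_i(\pi)$ ($\pi\in\Pi_i$) the standard and proper costandard modules in $\mathbf{C}_i$. Assume that there are a graded exact functor $\Phi:\mathbf{C}_1\to\mathbf{C}_2$ and a bijection $\phi:\Pi_1\to\Pi_2$ preserving the partial orderings such that $$\Phi(\Delta_1(\pi))\cong\Delta_2(\phi(\pi)),\qquad \Phi(\bar\nabla_1(\pi))\cong\bar\nabla_2(\phi(\pi))\qquad\text{for all }\pi\in\Pi_1 .$$ Then $\Phi$ gives an equivalence of graded categories $\mathbf{C}_1\simeq\mathbf{C}_2$.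
   Context: Fix a field $\Bbbk$. Gradings are $\mathbb{Z}$-gradings. A graded vector space $V=\bigoplus_n V_n$ is Laurentian if $\dim V_n<\infty$ for all $n$ and $V_n=0$ for $n\ll0$. A graded $\Bbbk$-algebra is Laurentian if its underlying graded space is. Modules are graded, ideals and subalgebras homogeneous. A graded category is a $\Bbbk$-linear category with a self-equivalence $q$ (grading shift); a functor between graded categories is graded if it commutes with the grading shift functors. Let $H$ be a left Noetherian Laurentian $\Bbbk$-algebra. $H\text{-}\mathtt{gmod}$ is the category of finitely generated graded left $H$-modules with degree-preserving homomorphisms; $(qV)_n=V_{n-1}$; $V\simeq V'$ means $V\cong q^nV'$ for some $n\in\mathbb{Z}$. Put $\mathrm{hom}_H(V,V')=\bigoplus_n \mathrm{hom}_H(V,V')_n$ with $\mathrm{hom}_H(V,V')_n=\mathrm{Hom}_{H\text{-}\mathtt{gmod}}(q^nV,V')$ and $\mathrm{end}_H(V)=\mathrm{hom}_H(V,V)$. It is always assumed that endomorphism rings of simple objects are $\cong\Bbbk$. Let $\{L(\pi)\mid\pi\in\Pi\}$ be a complete irredundant set of simple objects up to isomorphism and grading shift, $\Pi$ finite with partial order $\leq$, and $P(\pi)$ a projective cover of $L(\pi)$. Define the standard module $\Delta(\pi)=P(\pi)/\sum \mathrm{Im} f$, the sum over all $\sigma\not\leq\pi$ and $f\in\mathrm{hom}_H(P(\sigma),P(\pi))$. A filtration $V=V_0\supset V_1\supset\cdots$ is separated if $\bigcap_n V_n=0$; filtrations may be finite. $V$ has a $\Delta$-filtration if it has a separated filtration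 with (nonzero) subquotients $\simeq\Delta(\pi)$, $\pi\in\Pi$. $H$ is an affine quasi-hereditary algebra (equivalently, $H\text{-}\mathtt{gmod}$ is an affine highest weight category) if: (i) for each $\pi$ the kernel of $P(\pi)\twoheadrightarrow\Delta(\pi)$ has a $\Delta$-filtration with subquotients $\simeq\Delta(\sigma)$, $\sigma>\pi$; (ii) for each $\pi$, $B_\pi:=\mathrm{end}_H(\Delta(\pi))$ is isomorphic to a graded polynomial ring $\Bbbk[z_1,\dots,z_{n_\pi}]$ with $n_\pi\ge0$, $\deg z_i>0$; (iii) for all $\pi,\sigma$ the $B_\sigma$-module $\mathrm{hom}_H(P(\pi),\Delta(\sigma))$ is graded free of finite rank. Let $I(\pi)$ be an injective hull of $L(\pi)$ in the category of all graded $H$-modules and $A(\pi)\subset I(\pi)/L(\pi)$ the largest submodule all of whose composition factors are $\simeq L(\sigma)$ with $\sigma<\pi$; the proper costandard module $\bar\nabla(\pi)\subset I(\pi)$ is the preimage of $A(\pi)$. Property $(\spadesuit)$: there is a central $\mathbb{Z}_{\ge0}$-graded subalgebra $Z\subset H_{\ge0}$ with $Z_0=\Bbbk\cdot1$ such that $H$ is finitely generated as a $Z$-module. *)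

(* Defs.v *)
From HB Require Import structures.
From mathcomp Require Import all_boot all_order all_algebra.
From mathcomp Require Import mpoly.

Set Implicit Arguments.
Unset Strict Implicit.
Unset Printing Implicit Defensive.

Import GRing.Theory.
Local Open Scope ring_scope.

(* Graded objects are ungraded objects together with the family of subsets of
   homogeneous elements of each degree. In this way the grading shift does not
   change the carrier, and there is no transport along equations in int. *)

(** * Gradings *)

(* V is the internal direct sum of the subgroups [deg n]. *)
Record is_grading (V : zmodType) (deg : int -> V -> Prop) : Prop := IsGrading {
  grading0 : forall n, deg n 0;
  gradingB : forall n x y, deg n x -> deg n y -> deg n (x - y);
  grading_gen : forall v, exists (s : seq int) (f : int -> V),
    (forall n, deg n (f n)) /\ v = \sum_(n <- s) f n;
  grading_direct : forall (s : seq int) (f : int -> V),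
    uniq s -> (forall n, deg n (f n)) -> \sum_(n <- s) f n = 0 ->
    forall n, n \in s -> f n = 0 }.

Definition homogeneous (V : zmodType) (deg : int -> V -> Prop)
    (S : V -> Prop) : Prop :=
  forall v, S v -> exists (s : seq int) (f : int -> V),
    (forall n, deg n (f n) /\ S (f n)) /\ v = \sum_(n <- s) f n.

(** * Graded algebras *)

(* A k-algebra is a ring with a central ring morphism [scal] from k; unlike
   [algType], this allows the zero algebra. *)
Record galgebra (k : fieldType) := GAlgebra {
  galg :> pzRingType;
  scal : {rmorphism k -> galg};
  scal_central : forall c a, scal c * a = a * scal c;
  hdeg : int -> galg -> Prop;
  hdeg_grading : is_grading hdeg;
  hdeg_scal : forall c n a, hdeg n a -> hdeg n (scal c * a);
  hdeg1 : hdeg 0 1;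
  hdegM : forall m n a b, hdeg m a -> hdeg n b -> hdeg (m + n) (a * b) }.

Definition laurentian (k : fieldType) (H : galgebra k) : Prop :=
  (forall n, exists r (b : 'I_r -> H), forall x : H,
     hdeg n x <-> exists c : 'I_r -> k, x = \sum_i scal H (c i) * b i) /\
  (exists N : int, forall (n : int) (x : H), n < N -> hdeg n x -> x = 0).

Definition left_ideal (k : fieldType) (H : galgebra k) (I : H -> Prop) : Prop :=
  [/\ I 0, forall a x y, I x -> I y -> I (a * x + y)
    & homogeneous (@hdeg _ H) I].

(* Ideals are homogeneous. *)
Definition left_noetherian (k : fieldType) (H : galgebra k) : Prop :=
  forall I : H -> Prop, left_ideal I ->
  exists r (b : 'I_r -> H), forall x,
    I x <-> exists a : 'I_r -> H, x = \sum_i a i * b i.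

Definition property_spade (k : fieldType) (H : galgebra k) : Prop :=
  exists Z : H -> Prop,
  (Z 1 /\ (forall c x y, Z x -> Z y -> Z (scal H c * x + y)) /\
     (forall x y, Z x -> Z y -> Z (x * y)) /\ homogeneous (@hdeg _ H) Z) /\
  (forall z a, Z z -> z * a = a * z) /\
  (forall (n : int) z, Z z -> hdeg n z -> n < 0 -> z = 0) /\
  (forall z, Z z -> hdeg 0 z -> exists c, z = scal H c) /\
  (exists r (b : 'I_r -> H), forall x, exists z : 'I_r -> H,
     (forall i, Z (z i)) /\ x = \sum_i z i * b i).

(** * Graded modules *)

Record gmodule (k : fieldType) (H : galgebra k) := GModule {
  gcarrier :> lmodType H;
  mdeg : int -> gcarrier -> Prop;
  mdeg_grading : is_grading mdeg;
  mdeg_act : forall m n (a : H) v,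
    hdeg m a -> mdeg n v -> mdeg (m + n) (a *: v) }.

Definition finitely_generated (k : fieldType) (H : galgebra k)
    (V : lmodType H) : Prop :=
  exists r (b : 'I_r -> V), forall v,
  exists a : 'I_r -> H, v = \sum_i a i *: b i.

(* The objects of the category H-gmod. *)
Record fgmod (k : fieldType) (H : galgebra k) := FGMod {
  fg_gmod :> gmodule H;
  fg_fg : finitely_generated fg_gmod }.

Record ghom (k : fieldType) (H : galgebra k) (V W : gmodule H) := GHom {
  ghom_fun :> {linear V -> W};
  ghom_deg : forall n v, mdeg n v -> mdeg n (ghom_fun v) }.

Section Category.
Variables (k : fieldType) (H : galgebra k).

Definition ghom_id (V : gmodule H) : ghom V V :=
  @GHom k H V V (idfun : {linear V -> V}) (fun _ _ hv => hv).

Definition ghom_comp (U V W : gmodule H) (g : ghom V W) (f : ghom U V) :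
    ghom U W :=
  @GHom k H U W (g \o f : {linear U -> W})
    (fun _ _ hv => ghom_deg g (ghom_deg f hv)).

(* Morphisms are compared pointwise. *)
Definition is_iso (V W : gmodule H) (f : ghom V W) : Prop :=
  exists g : ghom W V, cancel f g /\ cancel g f.

Definition iso (V W : gmodule H) : Prop := exists f : ghom V W, is_iso f.

Definition sdeg (n : int) (V : gmodule H) (m : int) : V -> Prop :=
  @mdeg k H V (m - n).

Lemma sdeg_grading n V : is_grading (@sdeg n V).
Proof.
have [D0 DB Dgen Ddir] := mdeg_grading V; split.
- by move=> m; apply: D0.
- by move=> m x y; apply: DB.
- move=> v; have [s [f [hf ->]]] := Dgen v.
  exists [seq m + n | m <- s], (fun m => f (m - n)); split=> [m|].
    exact: hf.
  by rewrite big_map; apply: eq_bigr => m _; rewrite addrK.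
- move=> s f us hf sum0 m ms.
  have := Ddir [seq m - n | m <- s] (fun m => f (m + n)) _ _ _ (m - n).
  rewrite subrK; apply.
  + by rewrite map_inj_uniq //; apply: addIr.
  + by move=> j; have := hf (j + n); rewrite /sdeg addrK.
  + by rewrite big_map -[RHS]sum0; apply: eq_bigr => j _; rewrite subrK.
  + by apply/mapP; exists m.
Qed.

Lemma sdeg_act n (V : gmodule H) m p (a : H) (v : V) :
  hdeg m a -> sdeg n p v -> sdeg n (m + p) (a *: v).
Proof. by move=> ha hv; rewrite /sdeg -addrA; apply: mdeg_act. Qed.

(* [shift n V] is q^n V. *)
Definition shift (n : int) (V : gmodule H) : gmodule H :=
  @GModule k H V (@sdeg n V) (sdeg_grading n V) (@sdeg_act n V).

Definition fgshift (n : int) (V : fgmod H) : fgmod H :=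
  @FGMod k H (shift n V) (fg_fg V).

Definition ghom_shift (n : int) (V W : gmodule H) (f : ghom V W) :
    ghom (shift n V) (shift n W) :=
  @GHom k H (shift n V) (shift n W) (ghom_fun f)
    (fun m v hv => @ghom_deg k H V W f (m - n) v hv).

(* Isomorphism up to grading shift. *)
Definition sim (V W : gmodule H) : Prop := exists n, iso V (shift n W).

(* hom_H(V, W)_n, the degree-preserving maps from q^n V to W. *)
Definition hom_deg (n : int) (V W : gmodule H) (f : {linear V -> W}) : Prop :=
  forall m v, @mdeg k H (shift n V) m v -> mdeg m (f v).

(* hom_H(V, W), the direct sum of the hom_H(V, W)_n. *)
Definition in_hom (V W : gmodule H) (f : {linear V -> W}) : Prop :=
  exists (s : seq int) (g : int -> {linear V -> W}),
    (forall n, hom_deg n (g n)) /\ forall v, f v = \sum_(n <- s) g n v.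

(** Submodules, simple modules, subquotients *)

Definition gsub (V : gmodule H) (S : V -> Prop) : Prop :=
  [/\ S 0, forall (a : H) x y, S x -> S y -> S (a *: x + y)
    & homogeneous (@mdeg _ _ V) S].

Definition simple (V : gmodule H) : Prop :=
  (exists v : V, v <> 0) /\
  forall S : V -> Prop, gsub S -> (forall v, S v -> v = 0) \/ (forall v, S v).

Definition surj (V W : gmodule H) (f : ghom V W) : Prop :=
  forall w, exists v, f v = w.

Definition exact_at (U V W : gmodule H) (f : ghom U V) (g : ghom V W) : Prop :=
  forall v, g v = 0 <-> exists u, f u = v.

(* For submodules N of M of V, the module M / N is isomorphic to W; here U is
   M as an object of its own. *)
Definition subquotient_iso (V : gmodule H) (M N : V -> Prop)
    (W : gmodule H) : Prop :=
  exists (U : gmodule H) (i : ghom U V) (p : ghom U W),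
  [/\ injective i, forall v, M v <-> exists u, i u = v, surj p
    & forall u, p u = 0 <-> N (i u)].

Definition composition_factor (V : gmodule H) (A : V -> Prop)
    (S : gmodule H) : Prop :=
  simple S /\ exists M N : V -> Prop,
    [/\ gsub M, gsub N, forall v, N v -> M v, forall v, M v -> A v
      & subquotient_iso M N S].

(** Projective covers in H-gmod, injective hulls among all graded modules *)

Definition projective (P : fgmod H) : Prop :=
  forall (V W : fgmod H) (g : ghom V W) (f : ghom P W), surj g ->
  exists h : ghom P V, forall x, g (h x) = f x.

Definition projective_cover (P L : fgmod H) (f : ghom P L) : Prop :=
  [/\ projective P, surj f
    & forall S : P -> Prop, gsub S ->
        (forall v, exists2 s, S s & f s = f v) -> forall v, S v].

Definition inj_object (I : gmodule H) : Prop :=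
  forall (V W : gmodule H) (i : ghom V W) (f : ghom V I), injective i ->
  exists h : ghom W I, forall v, h (i v) = f v.

Definition injective_hull (L I : gmodule H) (e : ghom L I) : Prop :=
  [/\ inj_object I, injective e
    & forall S : I -> Prop, gsub S ->
        (forall x, S (e x) -> x = 0) -> forall v, S v -> v = 0].

(* The endomorphism ring end_H(L) of every simple object L is k. *)
Definition schurian : Prop :=
  forall L : fgmod H, simple L ->
  forall f : {linear L -> L}, in_hom f ->
  exists c : k, forall v, f v = scal H c *: v.

End Category.

(** * Affine quasi-hereditary algebras *)

Section Trace.
Variables (k : fieldType) (H : galgebra k) (d : Order.disp_t).
Variables (Pi : finPOrderType d) (P : Pi -> fgmod H).

(* The sum of the images of all f in hom_H(P(s), P(p)), s not <= p. *)
Definition trace (p : Pi) (x : P p) : Prop :=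
  exists2 t : seq (P p),
    (forall v, v \in t -> exists (s : Pi) (f : {linear P s -> P p}) (y : P s),
        [/\ ~~ (s <= p)%O, in_hom f & v = f y])
    & x = \sum_(v <- t) v.

End Trace.

(* The simple modules L(p), their projective covers P(p) and the standard
   modules Delta(p). *)
Record gmod_data (k : fieldType) (H : galgebra k) (d : Order.disp_t)
    (Pi : finPOrderType d) := GModData {
  simple_mod : Pi -> fgmod H;
  simple_modP : forall p, simple (simple_mod p);
  simple_complete : forall S : fgmod H, simple S ->
    exists p, sim S (simple_mod p);
  simple_irredundant : forall p s, sim (simple_mod p) (simple_mod s) -> p = s;
  proj_mod : Pi -> fgmod H;
  proj_map : forall p, ghom (proj_mod p) (simple_mod p);
  proj_mapP : forall p, projective_cover (proj_map p);
  Delta : Pi -> fgmod H;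
  Delta_map : forall p, ghom (proj_mod p) (Delta p);
  Delta_surj : forall p, surj (Delta_map p);
  Delta_ker : forall p x, Delta_map p x = 0 <-> trace x }.

Section AffineQuasiHereditary.
Variables (k : fieldType) (H : galgebra k) (d : Order.disp_t).
Variables (Pi : finPOrderType d) (D : gmod_data H Pi).

(* A submodule K of V has a separated filtration whose nonzero subquotients are
   Delta(s), up to shift, with s in Q. A finite filtration is one that is
   eventually 0. *)
Definition has_Delta_filtration (V : gmodule H) (K : V -> Prop)
    (Q : Pi -> Prop) : Prop :=
  exists F : nat -> V -> Prop,
  [/\ forall i, gsub (F i),
      forall v, F 0%N v <-> K v,
      forall i v, F i.+1 v -> F i v,
      forall v, (forall i, F i v) -> v = 0
    & forall i, (forall v, F i v -> F i.+1 v) \/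
        exists s n, Q s /\
          subquotient_iso (F i) (F i.+1) (shift n (Delta D s))].

(* An isomorphism of graded k-algebras from k[z_1, ..., z_n], deg z_i = e i, to
   end_H(V), which is a k-algebra under composition. *)
Definition end_poly_iso (V : gmodule H) (n : nat) (e : 'I_n -> nat)
    (theta : {mpoly k[n]} -> {linear V -> V}) : Prop :=
  [/\ forall (c : k) (p q : {mpoly k[n]}) v,
        theta (c *: p + q) v = scal H c *: theta p v + theta q v,
      (forall v, theta 1 v = v) /\
        (forall (p q : {mpoly k[n]}) v, theta (p * q) v = theta p (theta q v)),
      forall m : 'X_{1..n}, hom_deg (\sum_i m i * e i)%:Z (theta 'X_[m]),
      forall p q, (forall v, theta p v = theta q v) -> p = q
    & forall f : {linear V -> V},
        in_hom f <-> exists p, forall v, f v = theta p v].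

(* hom_H(V, W) has a finite homogeneous basis as a left end_H(W)-module. *)
Definition hom_gfree (V W : gmodule H) : Prop :=
  exists r (a : 'I_r -> int) (b : 'I_r -> {linear V -> W}),
  (forall i, hom_deg (a i) (b i)) /\
  forall f : {linear V -> W}, in_hom f ->
  exists2 B : 'I_r -> {linear W -> W},
    (forall i, in_hom (B i)) /\ (forall v, f v = \sum_i B i (b i v))
    & forall B' : 'I_r -> {linear W -> W},
        (forall i, in_hom (B' i)) ->
        (forall v, f v = \sum_i B' i (b i v)) ->
        forall i w, B' i w = B i w.

Record affine_quasi_hereditary : Prop := AffineQuasiHereditary {
  aqh_noetherian : left_noetherian H;
  aqh_laurentian : laurentian H;
  aqh_schurian : schurian H;
  aqh_filtration : forall p,
    has_Delta_filtration (fun x => Delta_map D p x = 0)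
      (fun s => (p < s)%O);
  aqh_end : forall p, exists n (e : 'I_n -> nat) theta,
    (forall i, 0 < e i)%N /\ @end_poly_iso (Delta D p) n e theta;
  aqh_free : forall p s, hom_gfree (proj_mod D p) (Delta D s) }.

(* N is the proper costandard module at p: I is an injective hull of L(p), Q is
   I / L(p), A is the largest submodule of Q all of whose composition factors
   are L(s), up to shift, with s < p, and N is the preimage of A in I. *)
Definition proper_costandard (p : Pi) (N : gmodule H) : Prop :=
  exists (I Q : gmodule H) (e : ghom (simple_mod D p) I) (g : ghom I Q)
    (A : Q -> Prop) (j : ghom N I),
  let small (B : Q -> Prop) := forall S, composition_factor B S ->
    exists2 s, (s < p)%O & sim S (simple_mod D s) in
  [/\ injective_hull e, surj g /\ exact_at e g, gsub A /\ small A,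
      forall B, gsub B -> small B -> forall x, B x -> A x
    & injective j /\ forall x, A (g x) <-> exists y, j y = x].

End AffineQuasiHereditary.

(** * Functors *)

(* k-linear functors from H1-gmod to H2-gmod. For c = 0, [fmap_linear] says that
   fmap respects pointwise equality of morphisms. *)
Record gfunctor (k : fieldType) (H1 H2 : galgebra k) := GFunctor {
  fobj :> fgmod H1 -> fgmod H2;
  fmap : forall V W : fgmod H1, ghom V W -> ghom (fobj V) (fobj W);
  fmap_id : forall (V : fgmod H1) v, @fmap V V (ghom_id V) v = v;
  fmap_comp : forall (U V W : fgmod H1) (g : ghom V W) (f : ghom U V) u,
    @fmap U W (ghom_comp g f) u = fmap g (fmap f u);
  fmap_linear : forall (V W : fgmod H1) (c : k) (f g h : ghom V W),
    (forall v, h v = scal H1 c *: f v + g v) ->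
    forall v, fmap h v = scal H2 c *: fmap f v + fmap g v }.

Lemma fmap_ext (k : fieldType) (H1 H2 : galgebra k) (F : gfunctor H1 H2)
    (V W : fgmod H1) (f g : ghom V W) :
  (forall v, f v = g v) -> forall v, fmap F f v = fmap F g v.
Proof.
move=> fg v; rewrite (@fmap_linear _ _ _ F _ _ 0 g g f) => [|u].
  by rewrite rmorph0 scale0r add0r.
by rewrite rmorph0 scale0r add0r.
Qed.

Definition functor_id (k : fieldType) (H : galgebra k) : gfunctor H H :=
  @GFunctor k H H id (fun _ _ f => f) (fun _ _ => erefl)
    (fun _ _ _ _ _ _ => erefl) (fun _ _ _ _ _ _ e => e).

Section FunctorComp.
Variables (k : fieldType) (H1 H2 H3 : galgebra k).
Variables (G : gfunctor H2 H3) (F : gfunctor H1 H2).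

Definition functor_comp : gfunctor H1 H3.
Proof.
refine (@GFunctor k H1 H3 (fun V => G (F V))
          (fun V W f => fmap G (fmap F f)) _ _ _).
- move=> V v; rewrite -[RHS](@fmap_id _ _ _ G (F V)).
  by apply: fmap_ext => u; apply: fmap_id.
- move=> U V W g f u; rewrite -(@fmap_comp _ _ _ G _ _ _ (fmap F g)).
  by apply: fmap_ext => v; apply: fmap_comp.
- by move=> V W c f g h e; do 2!apply: fmap_linear.
Defined.

End FunctorComp.

(* The grading shift functor q. *)
Definition functor_shift (k : fieldType) (H : galgebra k) : gfunctor H H :=
  @GFunctor k H H (fgshift 1) (fun _ _ f => ghom_shift 1 f)
    (fun _ _ => erefl) (fun _ _ _ _ _ _ => erefl) (fun _ _ _ _ _ _ e => e).

Definition nat_iso (k : fieldType) (H1 H2 : galgebra k)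
    (F G : gfunctor H1 H2) : Prop :=
  exists2 eta : forall V, ghom (F V) (G V),
    forall V, is_iso (eta V)
    & forall (V W : fgmod H1) (f : ghom V W) v,
        eta W (fmap F f v) = fmap G f (eta V v).

Definition graded_functor (k : fieldType) (H1 H2 : galgebra k)
    (F : gfunctor H1 H2) : Prop :=
  nat_iso (functor_comp F (functor_shift H1))
          (functor_comp (functor_shift H2) F).

Definition exact_functor (k : fieldType) (H1 H2 : galgebra k)
    (F : gfunctor H1 H2) : Prop :=
  forall (U V W : fgmod H1) (f : ghom U V) (g : ghom V W),
  [/\ injective f, exact_at f g & surj g] ->
  [/\ injective (fmap F f), exact_at (fmap F f) (fmap F g) & surj (fmap F g)].

Definition graded_equivalence (k : fieldType) (H1 H2 : galgebra k)
    (F : gfunctor H1 H2) : Prop :=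
  exists G : gfunctor H2 H1,
  [/\ graded_functor F, graded_functor G,
      nat_iso (functor_comp G F) (functor_id H1)
    & nat_iso (functor_comp F G) (functor_id H2)].

(* Main.v *)
(* An exact functor matching [Delta(p)] with [Delta(phi p)] and the proper
   costandard [N(p)] with [N(phi p)] sends [L(p)], the image of a map
   [Delta(p) -> N(p)], to [L(phi p)]; hence it is conservative and faithful.
   As [Ext^1(Delta, N) = 0] and [Hom(Delta(p), q^n N(s))] is at most [k],
   induction along the (finite) Delta-filtration of [P(p)] shows that [Phi] is
   bijective on [Hom(P(p), N(s))], hence on [Hom(P(p), L(s))], hence by
   devissage on [Hom(P(p), V)] for all bounded [V], and finally for all [V]
   since [Phi] shifts lower degree bounds by at most a constant. Therefore [Phi]
   is full. The same facts give [Ext^1(Phi P(p), L) = 0] and that [Phi P(p)] has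
   simple head, so [Phi P(p)] is the projective cover of [L(phi p)] and [Phi] is
   essentially surjective. Property (spade) is used only to see that [N(p)] is
   bounded above: central elements of positive degree act nilpotently on any
   finitely generated essential extension of a simple module. *)

From HB Require Import structures.
From mathcomp Require Import all_boot all_order all_algebra.
From mathcomp Require Import boolp zify.
Require Import Defs.

Set Implicit Arguments.
Unset Strict Implicit.
Unset Printing Implicit Defensive.

Import Order.TTheory GRing.Theory Num.Theory.
Local Open Scope ring_scope.

(** The obstacle is infinity in two places. Finitely generated modules need not have finite length,
    and the filtrations in the axioms are only separated, so an induction along them has no last
    step. The upper bound on [N(s)] repairs this: a map into [N(s)] kills every submodule that lives
    in high degrees, hence sees only finitely many layers. Combined with the extension of maps from
    a layer to all of [P(p)], the same bound shows that the filtration of [P(p)] is finite.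

    Nor is [Phi P(p)] known to be projective before the end, since [Phi] comes with no adjoint. In
    the proof of fullness, liftings along [P(p)] are therefore made in the source and then
    transported.

    Ext groups, multiplicities and dimensions do not appear as such. Vanishing of Ext^1 is an
    extension property of maps, a composition factor is recognised by a nonzero map from a shifted
    [P(p)], and dimensions are lengths of spanning lists. *)

Lemma sum_support (V : zmodType) (r t : seq int) (h : int -> V) :
  uniq r -> uniq t -> {subset r <= t} ->
  (forall n, n \notin r -> h n = 0) -> \sum_(i <- r) h i = \sum_(i <- t) h i.
Proof.
move=> ur ut rt h0; rewrite [RHS](bigID (mem r)) /= [X in _ + X]big1 ?addr0 //.
rewrite -[RHS]big_filter; apply: perm_big; apply: uniq_perm; rewrite ?filter_uniq //.
by move=> i; rewrite mem_filter /=; have := rt i; case: (i \in r) => // ->.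
Qed.

(** * Homogeneous components of a graded group *)

Section Components.
Variables (V : zmodType) (deg : int -> V -> Prop) (G : is_grading deg).

Lemma degD n x y : deg n x -> deg n y -> deg n (x + y).
Proof.
move=> hx hy; rewrite -[y]opprK; apply: (gradingB G) => //.
by rewrite -[- y]add0r; apply: (gradingB G) => //; apply: (grading0 G).
Qed.

Lemma deg_sum (I : Type) (r : seq I) (P : pred I) (F : I -> V) n :
  (forall i, P i -> deg n (F i)) -> deg n (\sum_(i <- r | P i) F i).
Proof. by move=> h; elim/big_rec: _ => [|i x /h]; [exact: (grading0 G)|exact: degD].
  Qed.

Lemma decomposition v : exists f : int -> V, (forall n, deg n (f n)) /\
  exists s, [/\ uniq s, forall n, n \notin s -> f n = 0
              & v = \sum_(n <- s) f n].
Proof.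
have [s [f [hf ->]]] := grading_gen G v.
(* The list [s] may repeat a degree, so [g n] takes one copy of [f n] for each occurrence of [n]. *)
pose g n := \sum_(m <- s | m == n) f n.
exists g; split=> [n|]; first by apply: deg_sum => m _.
exists (undup s); split=> [|n ns|]; first exact: undup_uniq.
  rewrite /g big_seq_cond big1 // => m /andP[ms /eqP mn].
  by rewrite -mn mem_undup ms in ns.
rewrite (exchange_big_dep xpredT) //=; apply: eq_big_seq => m ms.
rewrite -[RHS]big_filter.
have -> : [seq i <- undup s | m == i] = [:: m].
  apply: perm_small_eq => //; apply: uniq_perm; rewrite ?filter_uniq ?undup_uniq //.
  move=> i; rewrite mem_filter mem_undup inE eq_sym.
  by case: eqP => // ->; rewrite ms.
by rewrite big_seq1.
Qed.

Definition comp n v := projT1 (cid (decomposition v)) n.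

Lemma comp_deg n v : deg n (comp n v).
Proof. by rewrite /comp; case: cid => f []. Qed.

Lemma comp_sum v : exists s, [/\ uniq s, forall n, n \notin s -> comp n v = 0
  & v = \sum_(n <- s) comp n v].
Proof. by rewrite /comp; case: cid => f []. Qed.

(** On a common list of degrees the difference of two decompositions is a vanishing sum of
    homogeneous elements, so directness applies. Hence [comp] does not depend on the choice made in
    its definition. *)
Lemma comp_unique (f : int -> V) s v : (forall n, deg n (f n)) -> uniq s ->
  (forall n, n \notin s -> f n = 0) -> v = \sum_(n <- s) f n ->
  forall n, comp n v = f n.
Proof.
move=> hf us f0 vE n; have [t [ut c0 vt]] := comp_sum v.
have sub (a b : seq int) : {subset a <= undup (a ++ b)}.
  by move=> i; rewrite mem_undup mem_cat => ->.
have sub' (a b : seq int) : {subset b <= undup (a ++ b)}.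
  by move=> i; rewrite mem_undup mem_cat => ->; rewrite orbT.
have h : \sum_(i <- undup (s ++ t)) (comp i v - f i) = 0.
  rewrite sumrB -(sum_support us _ (sub s t) f0) ?undup_uniq //.
  by rewrite -(sum_support ut _ (sub' s t) c0) ?undup_uniq // -vt -vE subrr.
have [ns|] := boolP (n \in undup (s ++ t)).
  apply/eqP; rewrite -subr_eq0; apply/eqP.
  apply: (grading_direct G (f := fun i => comp i v - f i)) h _ ns.
    exact: undup_uniq.
  by move=> m; apply: (gradingB G) => //; apply: comp_deg.
by rewrite mem_undup mem_cat negb_or => /andP[/f0-> /c0->].
Qed.

Lemma comp_id n v : deg n v -> comp n v = v.
Proof.
move=> hv; rewrite (@comp_unique (fun m => if m == n then v else 0) [:: n]) //.
- by rewrite eqxx.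
- by move=> m; case: eqP => [->//|_]; apply: (grading0 G).
- by move=> m; rewrite inE => /negbTE->.
- by rewrite big_seq1 eqxx.
Qed.

Lemma comp_ne m n v : deg n v -> m != n -> comp m v = 0.
Proof.
move=> hv mn.
rewrite (@comp_unique (fun m => if m == n then v else 0) [:: n]) //.
- by rewrite (negbTE mn).
- by move=> i; case: eqP => [->//|_]; apply: (grading0 G).
- by move=> i; rewrite inE => /negbTE->.
- by rewrite big_seq1 eqxx.
Qed.

Lemma comp_is_zmod_morphism n : zmod_morphism (comp n).
Proof.
move=> x y.
have [s [us s0 xE]] := comp_sum x; have [t [ut t0 yE]] := comp_sum y.
apply: (@comp_unique (fun m => comp m x - comp m y) (undup (s ++ t))).
- by move=> m; apply: (gradingB G); apply: comp_deg.
- exact: undup_uniq.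
- by move=> m; rewrite mem_undup mem_cat negb_or => /andP[/s0-> /t0->]; rewrite subr0.
- have sub : {subset s <= undup (s ++ t)}.
    by move=> i; rewrite mem_undup mem_cat => ->.
  have sub' : {subset t <= undup (s ++ t)}.
    by move=> i; rewrite mem_undup mem_cat => ->; rewrite orbT.
  rewrite sumrB -(sum_support us _ sub s0) ?undup_uniq //.
  by rewrite -(sum_support ut _ sub' t0) ?undup_uniq // -xE -yE.
Qed.

HB.instance Definition _ n :=
  GRing.isZmodMorphism.Build V V (comp n) (comp_is_zmod_morphism n).

Lemma comp_eq0 v : (forall n, comp n v = 0) -> v = 0.
Proof. by move=> h; have [s [_ _ ->]] := comp_sum v; rewrite big1. Qed.

Lemma comp_homogeneous (S : V -> Prop) : S 0 ->
  (forall x y, S x -> S y -> S (x + y)) -> homogeneous deg S ->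
  forall n v, S v -> S (comp n v).
Proof.
move=> S0 SD Sh n v /Sh[s [f [hf ->]]]; rewrite raddf_sum /=.
elim/big_rec: _ => // m x _ Sx; apply: SD => //.
have [->|nm] := eqVneq n m; first by rewrite comp_id; have [] := hf m.
by rewrite (comp_ne (hf m).1 nm).
Qed.

Lemma homogeneousP (S : V -> Prop) :
  (forall n v, S v -> S (comp n v)) -> homogeneous deg S.
Proof.
move=> h v Sv; have [s [_ _ vE]] := comp_sum v.
by exists s, (comp^~ v); split=> // n; split; [exact: comp_deg|exact: h].
Qed.

End Components.

Lemma comp_morph (V W : zmodType) (dV : int -> V -> Prop) (dW : int -> W -> Prop)
    (GV : is_grading dV) (GW : is_grading dW) (f : {additive V -> W}) d :
  (forall n v, dV n v -> dW (n + d) (f v)) ->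
  forall n v, comp GW (n + d) (f v) = f (comp GV n v).
Proof.
move=> fd n v; have [s [us s0 {1}->]] := comp_sum GV v.
rewrite !raddf_sum /=.
have [ns|ns] := boolP (n \in s).
  rewrite (bigD1_seq n) //= big1 ?addr0 => [|m mn].
    by rewrite comp_id //; apply: fd; apply: comp_deg.
  rewrite (comp_ne GW (n := m + d)) //; first by apply: fd; apply: comp_deg.
  by rewrite eq_sym; apply: contraNneq mn => /addIr->.
rewrite (s0 _ ns) raddf0 big_seq big1 // => m ms.
rewrite (comp_ne GW (n := m + d)) //; first by apply: fd; apply: comp_deg.
by apply: contraNneq ns => /addIr->.
Qed.

(** * Graded modules and homomorphisms *)

Local Notation hc V := (comp (mdeg_grading V)).

Section GradedModules.
Variables (k : fieldType) (H : galgebra k).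
Implicit Types U V W X Y : gmodule H.

Definition mk_linear (V W : lmodType H) (f : V -> W)
    (lin : forall a x y, f (a *: x + y) = a *: f x + f y) : {linear V -> W} :=
  HB.pack f (GRing.isLinear.Build H V W *:%R f lin).

Definition mk_ghom V W (f : V -> W)
    (lin : forall a x y, f (a *: x + y) = a *: f x + f y)
    (hf : forall n v, mdeg n v -> mdeg n (f v)) : ghom V W :=
  @GHom k H V W (mk_linear lin) hf.

Lemma hc_linear V W (f : {linear V -> W}) d :
  (forall n v, mdeg n v -> mdeg (n + d) (f v)) ->
  forall n v, hc W (n + d) (f v) = f (hc V n v).
Proof. exact: comp_morph. Qed.

Lemma hc_ghom V W (f : ghom V W) n v : hc W n (f v) = f (hc V n v).
Proof.
have := @hc_linear V W f 0 _ n v; rewrite addr0; apply=> m w hw.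
by rewrite addr0; apply: ghom_deg.
Qed.

Lemma hc_act V m (a : H) n (v : V) :
  hdeg m a -> hc V (m + n) (a *: v) = a *: hc V n v.
Proof.
move=> ha; rewrite addrC.
apply: (@comp_morph V V (@mdeg _ _ V) (@mdeg _ _ V) _ _ (GRing.scale a)).
by move=> i w hw; rewrite addrC; apply: mdeg_act.
Qed.

Lemma ghom0 V W (f : ghom V W) : f 0 = 0. Proof. exact: raddf0. Qed.
Lemma ghomD V W (f : ghom V W) x y : f (x + y) = f x + f y.
Proof. exact: raddfD. Qed.
Lemma ghomB V W (f : ghom V W) x y : f (x - y) = f x - f y.
Proof. exact: raddfB. Qed.
Lemma ghomZ V W (f : ghom V W) a x : f (a *: x) = a *: f x.
Proof. exact: linearZ. Qed.
Lemma ghom_sum V W (f : ghom V W) (I : Type) (r : seq I) (P : pred I) F :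
  f (\sum_(i <- r | P i) F i) = \sum_(i <- r | P i) f (F i).
Proof. exact: raddf_sum. Qed.

Lemma gsub0 V (S : V -> Prop) : gsub S -> S 0. Proof. by case. Qed.
Lemma gsubZ V (S : V -> Prop) a x : gsub S -> S x -> S (a *: x).
Proof. by case=> S0 SD _ Sx; rewrite -[_ *: _]addr0; apply: SD. Qed.
Lemma gsubD V (S : V -> Prop) x y : gsub S -> S x -> S y -> S (x + y).
Proof. by case=> S0 SD _ Sx Sy; rewrite -[x]scale1r; apply: SD. Qed.
Lemma gsubB V (S : V -> Prop) x y : gsub S -> S x -> S y -> S (x - y).
Proof.
by move=> gS Sx Sy; apply: gsubD => //; rewrite -scaleN1r; apply: gsubZ.
Qed.
Lemma gsub_sum V (S : V -> Prop) (I : Type) (r : seq I) (P : pred I) F :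
  gsub S -> (forall i, P i -> S (F i)) -> S (\sum_(i <- r | P i) F i).
Proof.
move=> gS h; elim/big_rec: _ => [|i x /h]; first exact: gsub0.
exact: gsubD.
Qed.
Lemma gsub_hc V (S : V -> Prop) n v : gsub S -> S v -> S (hc V n v).
Proof.
move=> gS; apply: comp_homogeneous; first exact: gsub0.
  by move=> x y; apply: gsubD.
by case: gS.
Qed.

Lemma gsub_intro V (S : V -> Prop) : S 0 ->
  (forall a x y, S x -> S y -> S (a *: x + y)) ->
  (forall n v, S v -> S (hc V n v)) -> gsub S.
Proof. by move=> S0 SD /homogeneousP Sh; split. Qed.

Lemma gsub_eq V (S T : V -> Prop) : gsub S -> (forall v, S v <-> T v) -> gsub T.
Proof. by move=> gS ST; rewrite (_ : T = S) //; apply/predeqP => v; rewrite ST. Qed.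

Lemma gsub_zero V : gsub (fun v : V => v = 0).
Proof.
apply: gsub_intro => // [a x y -> ->|n v ->]; last by rewrite raddf0.
by rewrite scaler0 addr0.
Qed.

Lemma gsub_full V : gsub (fun _ : V => True).
Proof. exact: gsub_intro. Qed.

Lemma gsub_cap V (S T : V -> Prop) : gsub S -> gsub T ->
  gsub (fun v => S v /\ T v).
Proof.
move=> gS gT; apply: gsub_intro; first by split; apply: gsub0.
  by move=> a x y [? ?] [? ?]; split; apply: gsubD => //; apply: gsubZ.
by move=> n v [? ?]; split; apply: gsub_hc.
Qed.

Lemma gsub_add V (S T : V -> Prop) : gsub S -> gsub T ->
  gsub (fun v => exists x y, [/\ S x, T y & v = x + y]).
Proof.
move=> gS gT; apply: gsub_intro.
- by exists 0, 0; rewrite addr0; split=> //; apply: gsub0.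
- move=> a _ _ [x [y [Sx Ty ->]]] [x' [y' [Sx' Ty' ->]]].
  exists (a *: x + x'), (a *: y + y'); split.
  + by apply: gsubD => //; apply: gsubZ.
  + by apply: gsubD => //; apply: gsubZ.
  + by rewrite scalerDr addrACA.
- move=> n _ [x [y [Sx Ty ->]]]; exists (hc V n x), (hc V n y).
  by rewrite raddfD; split=> //; apply: gsub_hc.
Qed.

Lemma gsub_image V W (f : ghom V W) (S : V -> Prop) : gsub S ->
  gsub (fun w => exists2 v, S v & f v = w).
Proof.
move=> gS; apply: gsub_intro.
- by exists 0; [exact: gsub0|rewrite raddf0].
- move=> a _ _ [x Sx <-] [y Sy <-]; exists (a *: x + y); last by rewrite linearP.
  by apply: gsubD => //; apply: gsubZ.
- move=> n _ [x Sx <-]; exists (hc V n x); first exact: gsub_hc.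
  by rewrite hc_ghom.
Qed.

Lemma gsub_preimage V W (f : ghom V W) (T : W -> Prop) : gsub T ->
  gsub (fun v => T (f v)).
Proof.
move=> gT; apply: gsub_intro.
- by rewrite raddf0; apply: gsub0.
- by move=> a x y Tx Ty; rewrite linearP; apply: gsubD => //; apply: gsubZ.
- by move=> n v Tv; rewrite -hc_ghom; apply: gsub_hc.
Qed.

Lemma gsub_ker V W (f : ghom V W) : gsub (fun v => f v = 0).
Proof. exact: (gsub_preimage f (gsub_zero W)). Qed.

Lemma gsub_im V W (f : ghom V W) : gsub (fun w => exists v, f v = w).
Proof.
apply: gsub_eq (gsub_image f (gsub_full V)) _ => w.
by split=> [[v]|[v]]; exists v.
Qed.

Lemma ghom_inj V W (f : ghom V W) :
  (forall v, f v = 0 -> v = 0) -> injective f.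
Proof.
move=> h x y e; apply/eqP; rewrite -subr_eq0; apply/eqP/h.
by rewrite raddfB /= e subrr.
Qed.

Lemma inj0 V W (f : ghom V W) : injective f -> forall v, f v = 0 -> v = 0.
Proof. by move=> h v e; apply: h; rewrite e raddf0. Qed.

Lemma inj_mdeg V W (f : ghom V W) n v : injective f -> mdeg n (f v) -> mdeg n v.
Proof.
move=> fi /(comp_id (mdeg_grading W)); rewrite hc_ghom => /fi <-.
exact: comp_deg.
Qed.

Lemma surj_mdeg V W (f : ghom V W) n w : surj f -> mdeg n w ->
  exists2 v, mdeg n v & f v = w.
Proof.
move=> fs hw; have [v fv] := fs w; exists (hc V n v); first exact: comp_deg.
by rewrite -hc_ghom fv comp_id.
Qed.

(** The difference of two values at [x] is a value at 0, so the relation is a graph. Factorisations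
    through a quotient or a submodule come from here, without any choice of compatible
    representatives. *)
Lemma ghom_rel V W (R : V -> W -> Prop) :
  (forall x, exists y, R x y) -> (forall y, R 0 y -> y = 0) ->
  (forall a x y x' y', R x x' -> R y y' -> R (a *: x + y) (a *: x' + y')) ->
  (forall n x, mdeg n x -> exists2 y, mdeg n y & R x y) ->
  exists f : ghom V W, forall x, R x (f x).
Proof.
move=> tot R0 RD Rh; pose f x := projT1 (cid (tot x)).
have fP x : R x (f x) by rewrite /f; case: cid.
have uniq x y y' : R x y -> R x y' -> y = y'.
  move=> h h'; apply/eqP; rewrite eq_sym -subr_eq0; apply/eqP/R0.
  by rewrite -(addNr x) [y' - y]addrC -!scaleN1r; apply: RD.
unshelve eexists (@mk_ghom V W f _ _) => //.
- by move=> a x y; apply: (uniq _ _ _ (fP _)); apply: RD.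
- by move=> n v /Rh[y hy Ry]; rewrite (uniq _ _ _ (fP v) Ry).
Qed.

Lemma factor_surj X Y V (p : ghom X Y) (f : ghom X V) : surj p ->
  (forall x, p x = 0 -> f x = 0) -> exists h : ghom Y V, forall x, h (p x) = f x.
Proof.
move=> ps pf.
have [|y [x px <-]|||h hP] :=
  @ghom_rel Y V (fun y v => exists2 x, p x = y & f x = v).
- by move=> y; have [x px] := ps y; exists (f x), x.
- exact: pf.
- move=> a _ _ _ _ [x <- <-] [y <- <-].
  by exists (a *: x + y); rewrite linearP.
- move=> n y hy; have [x hx xy] := surj_mdeg ps hy.
  by exists (f x); [exact: ghom_deg|exists x].
- exists h => x; have [x' xx' <-] := hP (p x).
  apply/eqP; rewrite -subr_eq0 -raddfB; apply/eqP/pf.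
  by rewrite raddfB /= xx' subrr.
Qed.

Lemma factor_inj X Y V (i : ghom Y V) (f : ghom X V) : injective i ->
  (forall x, exists y, i y = f x) -> exists h : ghom X Y, forall x, i (h x) = f x.
Proof.
move=> ii h; apply: (@ghom_rel X Y (fun x y => i y = f x)) => //.
- by move=> y; rewrite raddf0 => /(inj0 ii).
- by move=> a x y x' y' e e'; rewrite !linearP /= e e'.
- move=> n x hx; have [y iy] := h x; exists y => //.
  by apply: (inj_mdeg ii); rewrite iy; apply: ghom_deg.
Qed.

Lemma bij_iso V W (f : ghom V W) : injective f -> surj f -> is_iso f.
Proof.
move=> fi fs.
have [//|g gP] := @factor_inj _ _ _ f (ghom_id W) fi.
by exists g; split=> [x|x]; [apply: fi|]; rewrite gP.
Qed.

Lemma iso_inj V W (f : ghom V W) : is_iso f -> injective f.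
Proof. by case=> g [/can_inj]. Qed.

Lemma iso_surj V W (f : ghom V W) : is_iso f -> surj f.
Proof. by case=> g [_ fg] w; exists (g w). Qed.

Lemma iso_refl V : iso V V.
Proof. by exists (ghom_id V), (ghom_id V). Qed.

Lemma iso_sym V W : iso V W -> iso W V.
Proof. by case=> f [g [h1 h2]]; exists g, f. Qed.

Lemma iso_trans U V W : iso U V -> iso V W -> iso U W.
Proof.
case=> f [g [h1 h2]] [f' [g' [h1' h2']]].
exists (ghom_comp f' f), (ghom_comp g g').
by split=> x; rewrite /= ?h1' ?h2.
Qed.

Definition ghom_zero V W : ghom V W :=
  @mk_ghom V W (fun=> 0)
    (fun a _ _ => esym (etrans (addr0 _) (scaler0 _ a)))
    (fun n _ _ => grading0 (mdeg_grading W) n).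

Lemma scal_lin V W c (f g : ghom V W) (a : H) x y :
  scal H c *: f (a *: x + y) + g (a *: x + y) =
  a *: (scal H c *: f x + g x) + (scal H c *: f y + g y).
Proof.
by rewrite !linearP /= !scalerDr !scalerA scal_central addrACA.
Qed.

Lemma mdeg_scal V n c (v : V) : mdeg n v -> mdeg n (scal H c *: v).
Proof.
move=> hv; rewrite -[n]add0r; apply: mdeg_act => //.
by rewrite -[scal H c]mulr1; apply: hdeg_scal; apply: hdeg1.
Qed.

Definition ghom_lin V W c (f g : ghom V W) : ghom V W :=
  @mk_ghom V W (fun x => scal H c *: f x + g x) (scal_lin c f g)
    (fun n v hv => degD (mdeg_grading W) (mdeg_scal c (ghom_deg f hv))
       (ghom_deg g hv)).

(** ** Submodules, quotients and products *)

Section SubObject.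
Variables (V : gmodule H) (S : V -> Prop) (gS : gsub S).

(** The proof of [gsub S] is a parameter so that the closure instance declared below can be inferred
    from the predicate. *)
Definition sub_pred (_ : gsub S) : {pred V} := fun v => `[<S v>].

Lemma sub_pred_closed : submod_closed (sub_pred gS).
Proof.
split; first by apply/asboolP; apply: gsub0.
move=> a x y /asboolP Sx /asboolP Sy; apply/asboolP.
by apply: gsubD => //; apply: gsubZ.
Qed.

HB.instance Definition _ := GRing.isSubmodClosed.Build H V (sub_pred gS)
  (GRing.submod_closed_semi sub_pred_closed).

Definition sub_type := {v : V | v \in sub_pred gS}.
HB.instance Definition _ := SubChoice.on sub_type.
HB.instance Definition _ := [SubChoice_isSubLmodule of sub_type by <:].

Lemma sub_typeP (u : sub_type) : S (val u).
Proof. by apply/asboolP; apply: (valP u). Qed.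

Definition sub_elt v (Sv : S v) : sub_type := exist _ v (asboolT Sv).

Definition sub_deg n (u : sub_type) := mdeg n (val u).

Lemma sub_grading : is_grading sub_deg.
Proof.
split.
- by move=> n; rewrite /sub_deg raddf0; apply: (grading0 (mdeg_grading V)).
- by move=> n x y hx hy; rewrite /sub_deg raddfB; apply: (gradingB (mdeg_grading V)).
- move=> u; have [s [_ _ uE]] := comp_sum (mdeg_grading V) (val u).
  exists s, (fun n => sub_elt (gsub_hc n gS (sub_typeP u))); split=> [n|].
    exact: comp_deg.
  by apply: val_inj; rewrite raddf_sum /=.
- move=> s f us hf sf n ns; apply: val_inj; rewrite raddf0.
  apply: (grading_direct (mdeg_grading V) us (f := fun n => val (f n))) => //.
  by rewrite -raddf_sum sf raddf0.
Qed.

Lemma sub_act m n (a : H) (u : sub_type) :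
  hdeg m a -> sub_deg n u -> sub_deg (m + n) (a *: u).
Proof. by move=> ha hu; rewrite /sub_deg linearZ; apply: mdeg_act. Qed.

Definition subm : gmodule H := GModule sub_grading sub_act.

Definition sub_incl : ghom subm V :=
  @GHom k H subm V (val : {linear sub_type -> V}) (fun n v hv => hv).

Lemma sub_incl_inj : injective sub_incl.
Proof. exact: val_inj. Qed.

Lemma sub_inclP v : S v <-> exists u, sub_incl u = v.
Proof. by split=> [Sv|[u <-]]; [exists (sub_elt Sv)|exact: sub_typeP]. Qed.

End SubObject.

Section QuotObject.
Variables (V : gmodule H) (S : V -> Prop) (gS : gsub S).

Local Notation Q := (Quotient.quot (sub_pred gS)).
Local Open Scope quotient_scope.

Lemma quot_pi_eq (x y : V) : S (x - y) <-> \pi_Q x = \pi_Q y.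
Proof.
split=> [Sxy|/eqP].
  by apply/eqP; rewrite -Quotient.idealrBE; apply/asboolP.
by rewrite -Quotient.idealrBE => /asboolP.
Qed.

Definition quot_scale (a : H) (x : Q) : Q := \pi_Q (a *: repr x).

Lemma quot_scaleE a x : quot_scale a (\pi_Q x) = \pi_Q (a *: x).
Proof.
apply/quot_pi_eq; rewrite -scalerBr; apply: gsubZ => //.
by apply/quot_pi_eq; rewrite reprK.
Qed.

Lemma quot_scaleA a b v : quot_scale a (quot_scale b v) = quot_scale (a * b) v.
Proof.
by rewrite -[v]reprK (quot_scaleE b (repr v)) (quot_scaleE a (b *: repr v))
  (quot_scaleE (a * b) (repr v)) scalerA.
Qed.
Lemma quot_scale1 : left_id 1 quot_scale.
Proof. by move=> v; rewrite -[v]reprK !quot_scaleE scale1r. Qed.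
Lemma quot_scaleDr : right_distributive quot_scale +%R.
Proof.
move=> a x y; rewrite -[x]reprK -[y]reprK -raddfD !quot_scaleE scalerDr.
exact: raddfD.
Qed.
Lemma quot_scaleDl v : {morph quot_scale^~ v : a b / a + b}.
Proof.
by move=> a b; rewrite -[v]reprK !quot_scaleE scalerDl raddfD.
Qed.

(** A separate name for the additive quotient, to carry the module structure. *)
Definition quot_type : Type := Q.
HB.instance Definition _ := GRing.Zmodule.on quot_type.
HB.instance Definition _ := GRing.Zmodule_isLmodule.Build H quot_type
  quot_scaleA quot_scale1 quot_scaleDr quot_scaleDl.

Definition quot_fun (v : V) : quot_type := \pi_Q v.

Lemma quot_fun_lin a x y : quot_fun (a *: x + y) = a *: quot_fun x + quot_fun y.
Proof.
rewrite /quot_fun raddfD; congr (_ + _); apply: esym; exact: quot_scaleE.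
Qed.

Definition quot_lin := mk_linear quot_fun_lin.

Lemma quot_lin_surj y : exists x, quot_lin x = y.
Proof. by exists (repr (y : Q)); exact: reprK. Qed.

Lemma quot_lin0 x : quot_lin x = 0 <-> S x.
Proof. by rewrite -[0](raddf0 quot_lin) -[x in S x]subr0 quot_pi_eq. Qed.

Definition quot_deg n (y : quot_type) := exists2 x, mdeg n x & quot_lin x = y.

Lemma quot_grading : is_grading quot_deg.
Proof.
pose G := mdeg_grading V; split.
- by move=> n; exists 0; rewrite ?raddf0 //; apply: (grading0 G).
- move=> n _ _ [x hx <-] [y hy <-]; exists (x - y); first exact: (gradingB G).
  exact: raddfB.
- move=> y; have [x <-] := quot_lin_surj y.
  have [s [_ _ xE]] := comp_sum G x.
  exists s, (fun n => quot_lin (hc V n x)); split=> [n|].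
    by exists (hc V n x) => //; apply: comp_deg.
  by rewrite [in LHS]xE raddf_sum.
- move=> s f us hf sf n ns.
  pose g n := s2val (cid2 (hf n)).
  have gd m : mdeg m (g m) by rewrite /g; case: cid2.
  have gE m : quot_lin (g m) = f m by rewrite /g; case: cid2.
  have Ssum : S (\sum_(n <- s) g n).
    by apply/quot_lin0; rewrite raddf_sum -[RHS]sf; apply: eq_bigr => i _; exact: gE.
  (* Directness comes from the homogeneity of [S]: the component in degree [n] of the sum of lifts
     is [g n], which therefore lies in [S]. *)
  have := gsub_hc n gS Ssum; rewrite raddf_sum (bigD1_seq n) //= big1 ?addr0.
    by rewrite comp_id // -gE => /quot_lin0.
  by move=> m mn; rewrite (comp_ne G (gd m)) // eq_sym.
Qed.

Lemma quot_act m n (a : H) y :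
  hdeg m a -> quot_deg n y -> quot_deg (m + n) (a *: y).
Proof.
move=> ha [x hx <-]; exists (a *: x); first exact: mdeg_act.
exact: linearZ.
Qed.

Definition quotm : gmodule H := GModule quot_grading quot_act.

Definition quot_map : ghom V quotm :=
  @GHom k H V quotm quot_lin (fun n v hv => ex_intro2 _ _ v hv erefl).

Lemma quot_map_surj : surj quot_map.
Proof. exact: quot_lin_surj. Qed.

Lemma quot_map0 x : quot_map x = 0 <-> S x.
Proof. exact: quot_lin0. Qed.

End QuotObject.

End GradedModules.

Lemma pair_ext (A B : Type) (x y : A * B) : x.1 = y.1 -> x.2 = y.2 -> x = y.
Proof. by case: x y => [a b] [c d] /= -> ->. Qed.

(** * Products, the regular module, and generators *)

Section Constructions.
Variables (k : fieldType) (H : galgebra k).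
Implicit Types U V W X Y : gmodule H.

Section Product.
Variables V W : gmodule H.

Definition prod_deg n (x : V * W) := mdeg n x.1 /\ mdeg n x.2.

Lemma prod_grading : is_grading prod_deg.
Proof.
have GV := mdeg_grading V; have GW := mdeg_grading W; split.
- by move=> n; split; [apply: (grading0 GV)|apply: (grading0 GW)].
- by move=> n x y [? ?] [? ?]; split; [apply: (gradingB GV)|apply: (gradingB GW)].
- move=> [v w].
  have [s [us s0 vE]] := comp_sum GV v; have [t [ut t0 wE]] := comp_sum GW w.
  have us' : uniq (undup (s ++ t)) by rewrite undup_uniq.
  exists (undup (s ++ t)), (fun n => (comp GV n v, comp GW n w)); split=> [n|].
    by split; apply: comp_deg.
  apply: pair_ext; rewrite (raddf_sum fst, raddf_sum snd) /=.
  + rewrite {1}vE; apply: sum_support => // i.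
    by rewrite mem_undup mem_cat => ->.
  + rewrite {1}wE; apply: sum_support => // i.
    by rewrite mem_undup mem_cat => ->; rewrite orbT.
- move=> s f us hf sf n ns; apply: pair_ext.
  + apply: (grading_direct GV us (f := fun n => (f n).1)) => //.
      by move=> m; have [] := hf m.
    by rewrite -(raddf_sum fst) sf.
  + apply: (grading_direct GW us (f := fun n => (f n).2)) => //.
      by move=> m; have [] := hf m.
    by rewrite -(raddf_sum snd) sf.
Qed.

Lemma prod_act m n (a : H) (x : V * W) :
  hdeg m a -> prod_deg n x -> prod_deg (m + n) (a *: x).
Proof. by move=> ha [hv hw]; split; apply: mdeg_act. Qed.

Definition prodm : gmodule H := GModule prod_grading prod_act.

Definition prod_fst : ghom prodm V :=
  @GHom k H prodm V (fst : {linear (V * W)%type -> V}) (fun n x hx => hx.1).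
Definition prod_snd : ghom prodm W :=
  @GHom k H prodm W (snd : {linear (V * W)%type -> W}) (fun n x hx => hx.2).

Lemma prod_inl_lin (a : H) (x y : V) :
  (a *: x + y, 0 : W) = a *: (x, 0) + (y, 0).
Proof. by apply: pair_ext => /=; rewrite ?scaler0 ?addr0. Qed.
Lemma prod_inr_lin (a : H) (x y : W) :
  (0 : V, a *: x + y) = a *: (0, x) + (0, y).
Proof. by apply: pair_ext => /=; rewrite ?scaler0 ?addr0. Qed.

Definition prod_inl : ghom V prodm :=
  @mk_ghom k H V prodm (fun v => (v, 0)) prod_inl_lin
    (fun n v hv => conj hv (grading0 (mdeg_grading W) n)).
Definition prod_inr : ghom W prodm :=
  @mk_ghom k H W prodm (fun w => (0, w)) prod_inr_lin
    (fun n w hw => conj (grading0 (mdeg_grading V) n) hw).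

Lemma prod_eta (x : prodm) : x = prod_inl (prod_fst x) + prod_inr (prod_snd x).
Proof.
by case: x => v w; apply/pair_equal_spec; rewrite /= addr0 add0r.
Qed.

End Product.

Definition prod_case V W U (f : ghom V U) (g : ghom W U) : ghom (prodm V W) U :=
  ghom_lin 1 (ghom_comp f (prod_fst V W)) (ghom_comp g (prod_snd V W)).

Lemma prod_caseE V W U (f : ghom V U) (g : ghom W U) x :
  prod_case f g x = f x.1 + g x.2.
Proof. by rewrite /= rmorph1 scale1r. Qed.

Definition reg_grading : @is_grading (H^o : lmodType H) (@hdeg k H) :=
  hdeg_grading H.

Definition regm : gmodule H :=
  @GModule k H (H^o : lmodType H) (@hdeg k H) reg_grading (@hdegM k H).

(** ** Homogeneous maps *)

(** Shifts leave the carrier unchanged, so a morphism between shifted modules is a plain linear map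
    with a degree. Every passage from one pair of shifts to another goes through this predicate, and
    the equation between the degrees is passed as a separate argument. *)
Definition is_deg V W (d : int) (f : {linear V -> W}) :=
  forall n v, mdeg n v -> mdeg (n + d) (f v).

Lemma is_deg_ghom V W (f : ghom V W) : @is_deg V W 0 f.
Proof. by move=> n v hv; rewrite addr0; apply: ghom_deg. Qed.

Lemma is_deg_shift V W a b (f : ghom (shift a V) (shift b W)) :
  @is_deg V W (a - b) f.
Proof.
by move=> n v hv; rewrite addrA; apply: (ghom_deg f); rewrite /= /sdeg addrK.
Qed.

Lemma is_deg_shiftl V W a (f : ghom (shift a V) W) : @is_deg V W a f.
Proof.
by move=> n v hv; apply: (ghom_deg f); rewrite /= /sdeg addrK.
Qed.

Lemma is_deg_shiftr V W b (f : ghom V (shift b W)) : @is_deg V W (- b) f.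
Proof. by move=> n v hv; apply: (ghom_deg f). Qed.

Definition ghom_of V W a b d (f : {linear V -> W}) (hf : is_deg d f)
    (e : d = a - b) : ghom (shift a V) (shift b W).
Proof.
refine (@GHom k H (shift a V) (shift b W) f _) => n v hv.
by have := hf _ _ hv; rewrite e /= /sdeg addrA subrK.
Defined.

Definition ghom_ofl V W d (f : {linear V -> W}) (hf : is_deg d f) :
  ghom (shift d V) W.
Proof.
refine (@GHom k H (shift d V) W f _) => n v hv.
by have := hf _ _ hv; rewrite subrK.
Defined.

Definition ghom_ofr V W d b (f : {linear V -> W}) (hf : is_deg d f)
    (e : d = - b) : ghom V (shift b W).
Proof.
by refine (@GHom k H V (shift b W) f _) => n v hv; have := hf _ _ hv; rewrite e.
Defined.

Definition ghom_of0 V W d (f : {linear V -> W}) (hf : is_deg d f) (e : d = 0) :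
  ghom V W.
Proof.
by refine (@GHom k H V W f _) => n v hv; have := hf _ _ hv; rewrite e addr0.
Defined.

Lemma reg_map_lin V (b : V) (a x y : H) :
  (a * x + y) *: b = a *: (x *: b) + y *: b.
Proof. by rewrite scalerDl scalerA. Qed.

Definition reg_lin V (b : V) : {linear regm -> V} :=
  @mk_linear k H regm V (fun a : H => a *: b) (reg_map_lin b).

Lemma is_deg_reg V m (b : V) : mdeg m b -> is_deg m (reg_lin b).
Proof. by move=> hb n a ha; apply: mdeg_act. Qed.

Definition reg_map V m (b : V) (hb : mdeg m b) : ghom (shift m regm) V :=
  ghom_ofl (is_deg_reg hb).

Lemma reg_map1 V m (b : V) (hb : mdeg m b) : reg_map hb (1 : H) = b.
Proof. exact: scale1r. Qed.

Lemma hc_scale V m n (a : H) (b : V) : mdeg m b ->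
  hc V n (a *: b) = (comp (hdeg_grading H) (n - m) a : H) *: b.
Proof.
by move=> hb; have := hc_linear (is_deg_reg hb) (n - m) a; rewrite subrK.
Qed.

(** ** Spans *)

(** One notion serves for spans over [H], over the field and over a central subalgebra, according to
    [K]. The recursion peels off one generator at a time, as the inductions below do. *)
Fixpoint span (K : H -> Prop) V (l : seq V) (x : V) : Prop :=
  if l is b :: l' then exists2 a : H, K a & span K l' (x - a *: b) else x = 0.

Definition coeffs (K : H -> Prop) :=
  [/\ K 0, K 1 & forall c a b, K c -> K a -> K b -> K (c * a + b)].

Lemma coeffs_all : coeffs (fun=> True). Proof. by []. Qed.

Section Span.
Variables (K : H -> Prop) (hK : coeffs K).

Let K0 : K 0. Proof. by case: hK. Qed.
Let K1 : K 1. Proof. by case: hK. Qed.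
Let KD c a b : K c -> K a -> K b -> K (c * a + b).
Proof. by case: hK => _ _; apply. Qed.

Lemma span0 V (l : seq V) : span K l 0.
Proof.
by elim: l => //= b l IH; exists 0 => //; rewrite scale0r subr0.
Qed.

Lemma span_lin V (l : seq V) c x y :
  K c -> span K l x -> span K l y -> span K l (c *: x + y).
Proof.
move=> Kc; elim: l x y => [|b l IH] x y /=.
  by move=> -> ->; rewrite scaler0 addr0.
move=> [a Ka hx] [a' Ka' hy]; exists (c * a + a'); first exact: KD.
rewrite scalerDl -scalerA opprD addrACA -scalerBr; exact: IH.
Qed.

Lemma spanD V (l : seq V) x y : span K l x -> span K l y -> span K l (x + y).
Proof. by rewrite -{2}[x]scale1r => hx hy; apply: span_lin. Qed.

Lemma span_sum V (l : seq V) (I : Type) (r : seq I) (P : pred I) F :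
  (forall i, P i -> span K l (F i)) -> span K l (\sum_(i <- r | P i) F i).
Proof.
move=> h; elim/big_rec: _ => [|i x /h]; [exact: span0|exact: spanD].
Qed.

Lemma span_mem V (l : seq V) x : x \in l -> span K l x.
Proof.
elim: l => //= b l IH; rewrite inE => /predU1P[->|xl].
  by exists 1 => //; rewrite scale1r subrr; apply: span0.
by exists 0 => //; rewrite scale0r subr0; apply: IH.
Qed.

Lemma span_trans V (l l' : seq V) x :
  (forall b, b \in l -> span K l' b) -> span K l x -> span K l' x.
Proof.
elim: l x => [|b l IH] x h /=; first by move=> ->; apply: span0.
move=> [a Ka hx]; rewrite -(subrK (a *: b) x) addrC; apply: span_lin => //.
  by apply: h; rewrite mem_head.
by apply: IH => // c cl; apply: h; rewrite inE cl orbT.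
Qed.

Lemma span_sub V (l l' : seq V) x :
  {subset l <= l'} -> span K l x -> span K l' x.
Proof. by move=> ll; apply: span_trans => b /ll; apply: span_mem. Qed.

Lemma span_gsub V (S : V -> Prop) (l : seq V) x : gsub S ->
  (forall b, b \in l -> S b) -> span K l x -> S x.
Proof.
move=> gS; elim: l x => [|b l IH] x h /=; first by move=> ->; apply: gsub0.
move=> [a Ka hx]; rewrite -(subrK (a *: b) x); apply: gsubD => //.
  by apply: IH => // c cl; apply: h; rewrite inE cl orbT.
by apply: gsubZ => //; apply: h; rewrite mem_head.
Qed.

Lemma span_linear V W (f : {linear V -> W}) (l : seq V) x :
  span K l x -> span K (map f l) (f x).
Proof.
elim: l x => [|b l IH] x /=; first by move=> ->; rewrite raddf0.
by move=> [a Ka /IH]; rewrite linearB linearZ /=; exists a.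
Qed.

Lemma span_map V (I : eqType) (r : seq I) (b : I -> V) x : uniq r ->
  span K (map b r) x <->
  exists2 a : I -> H, forall i, K (a i) & x = \sum_(i <- r) a i *: b i.
Proof.
elim: r x => [|j r IH] x /=.
  by move=> _; split=> [->|[a _ ->]]; rewrite ?big_nil //; exists (fun=> 0);
    rewrite ?big_nil.
move=> /andP[jr ur]; split=> [[c Kc /(IH _ ur) [a Ka xE]]|[a Ka ->]].
  exists (fun i => if i == j then c else a i) => [i|]; first by case: eqP.
  rewrite big_cons eqxx -[LHS](subrK (c *: b j)) addrC xE; congr (_ + _).
  apply: eq_big_seq => i ir; case: eqP => // ij; by rewrite -ij ir in jr.
exists (a j) => //; apply/(IH _ ur); exists a => //.
by rewrite big_cons addrC addKr.
Qed.

Lemma span_ord V r (b : 'I_r -> V) x :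
  span K (codom b) x <->
  exists2 a : 'I_r -> H, forall i, K (a i) & x = \sum_i a i *: b i.
Proof.
rewrite /codom /image_mem span_map ?enum_uniq //.
by split=> [[a Ka ->]|[a Ka ->]]; exists a; rewrite ?big_enum.
Qed.

Lemma span_nth V (l : seq V) x : span K l x -> exists2 a : 'I_(size l) -> H,
  forall i, K (a i) & x = \sum_i a i *: l`_i.
Proof.
move=> hx; apply/(span_ord (fun i : 'I_(size l) => l`_i)).
suff -> : codom (fun i : 'I_(size l) => l`_i) = l by [].
rewrite /codom /image_mem (map_comp (nth 0 l)) val_enum_ord.
by rewrite -/(mkseq _ _) mkseq_nth.
Qed.

End Span.

#[local] Hint Resolve coeffs_all : core.
Notation hspan := (@span (fun=> True)).

Lemma hspan_nth V (l : seq V) x : hspan l x ->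
  exists a : 'I_(size l) -> H, x = \sum_i a i *: l`_i.
Proof. by move=> hx; have [a _ xE] := span_nth coeffs_all hx; exists a. Qed.

Definition homogl V (l : seq V) := forall b, b \in l -> exists n, mdeg n b.

Lemma gsub_hspan V (l : seq V) : homogl l -> gsub (hspan l).
Proof.
move=> hl; apply: gsub_intro; first exact: span0.
  by move=> a x y; apply: span_lin.
move=> n; elim: l hl => [|b l IH] hl x /=; first by move=> ->; rewrite raddf0.
move=> [a _ /IH]; have [m hb] := hl b (mem_head _ _).
rewrite raddfB /= (hc_scale _ _ hb) => hx; eexists => //; apply: hx.
by move=> c cl; apply: hl; rewrite inE cl orbT.
Qed.

(** Each generator is replaced by its nonzero components, which stay in [S]. Being nonzero, the new
    generators have a well-defined degree, on which the later degree estimates rely. *)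
Lemma homogeneous_gens K V (S : V -> Prop) (l : seq V) : coeffs K -> gsub S ->
  (forall b, b \in l -> S b) -> exists l' : seq V,
  (forall b, b \in l' -> [/\ S b, b <> 0 & exists n, mdeg n b]) /\
  (forall x, span K l x -> span K l' x).
Proof.
move=> hK gS Sl; suff [l' [h1 h2]] : exists l' : seq V,
    (forall b, b \in l' -> [/\ S b, b <> 0 & exists n, mdeg n b]) /\
    (forall b, b \in l -> span K l' b).
  by exists l'; split=> // x; apply: span_trans.
elim: l Sl => [|b l IH] Sl; first by exists [::].
have [|l' [h1 h2]] := IH; first by move=> c cl; apply: Sl; rewrite inE cl orbT.
have [s [_ _ bE]] := comp_sum (mdeg_grading V) b.
pose lb := [seq x <- [seq hc V n b | n <- s] | x != 0].
exists (lb ++ l'); split=> c.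
  rewrite mem_cat => /orP[|/h1//]; rewrite mem_filter => /andP[/eqP c0].
  move=> /mapP[n _ cE]; split=> //; last by exists n; rewrite cE; apply: comp_deg.
  by rewrite cE; apply: gsub_hc => //; apply: Sl; rewrite mem_head.
rewrite inE => /predU1P[->|/h2]; last first.
  by apply: span_sub => // x xl; rewrite mem_cat xl orbT.
rewrite bE big_seq; apply: span_sum => // n ns.
have [->|c0] := eqVneq (hc V n b) 0; first exact: span0.
apply: span_mem => //; rewrite mem_cat mem_filter c0 /=.
by apply/orP; left; apply: map_f.
Qed.

Lemma fg_span V : finitely_generated V -> exists l : seq V, forall x, hspan l x.
Proof.
case=> r [b h]; exists (codom b) => x; apply/span_ord => //.
by have [a xE] := h x; exists a.
Qed.

Lemma span_fg V (l : seq V) : (forall x, hspan l x) -> finitely_generated V.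
Proof.
move=> h; exists (size l), (fun i => l`_i) => v.
by have [a ->] := hspan_nth (h v); exists a.
Qed.

Lemma surj_fg V W (f : ghom V W) : surj f -> finitely_generated V ->
  finitely_generated W.
Proof.
move=> fs /fg_span[l hl]; apply: (@span_fg _ (map f l)) => w.
by have [v <-] := fs w; apply: span_linear.
Qed.

Lemma prod_fg V W : finitely_generated V -> finitely_generated W ->
  finitely_generated (prodm V W).
Proof.
move=> /fg_span[l hl] /fg_span[l' hl'].
apply: (@span_fg (prodm V W) (map (prod_inl V W) l ++ map (prod_inr V W) l')) => x.
rewrite [x]prod_eta; apply: spanD => //.
  apply: (@span_sub _ coeffs_all _ (map (prod_inl V W) l)) => //.
    by move=> y; rewrite mem_cat => ->.
  exact: span_linear.
apply: (@span_sub _ coeffs_all _ (map (prod_inr V W) l')) => //.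
  by move=> y; rewrite mem_cat => ->; rewrite orbT.
exact: span_linear.
Qed.

Lemma reg_fg : finitely_generated regm.
Proof.
apply: (@span_fg regm [:: (1 : H) : regm]) => x; exists x => //=.
by apply/eqP; rewrite subr_eq0 /GRing.scale /= mulr1.
Qed.

Section Noetherian.
Hypothesis Hn : left_noetherian H.

(** The coefficients at [b] of elements of [S], taken modulo the other generators, form a
    homogeneous left ideal. Lifts to [S] of finitely many generators of this ideal, together with
    generators of the part of [S] spanned by [l], generate [S]. *)
Lemma noetherian_span V (l : seq V) (S : V -> Prop) : homogl l -> gsub S ->
  (forall x, S x -> hspan l x) ->
  exists l' : seq V, (forall b, b \in l' -> S b) /\ forall x, S x -> hspan l' x.
Proof.
elim: l S => [|b l IH] S hl gS Sl.
  by exists [::].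
have hl' : homogl l by move=> c cl; apply: hl; rewrite inE cl orbT.
have [m hb] := hl b (mem_head _ _).
pose I (a : H) := exists2 x, S x & hspan l (x - a *: b).
have gI : left_ideal I.
  split.
  - by exists 0; [exact: gsub0|rewrite scale0r subr0; apply: span0].
  - move=> a x y [x' Sx hx] [y' Sy hy]; exists (a *: x' + y').
      by apply: gsubD => //; apply: gsubZ.
    by rewrite scalerDl -scalerA opprD addrACA -scalerBr; apply: span_lin.
  - apply: (@homogeneousP _ _ (hdeg_grading H)) => n a [x Sx hx].
    exists (hc V (n + m) x); first exact: gsub_hc.
    have := gsub_hc (n + m) (gsub_hspan hl') hx.
    by rewrite raddfB /= (hc_scale _ _ hb) addrK.
have [r [a aP]] := Hn gI.
have Ia i : I (a i).
  apply/aP; exists (fun j => if j == i then 1 else 0).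
  rewrite (bigD1 i) //= eqxx mul1r big1 ?addr0 // => j /negbTE->.
  by rewrite mul0r.
pose x i := s2val (cid2 (Ia i)).
have xS i : S (x i) by rewrite /x; case: cid2.
have xP i : hspan l (x i - a i *: b) by rewrite /x; case: cid2.
have [l1 [l1S l1P]] := IH _ hl' (gsub_cap gS (gsub_hspan hl'))
  (fun x Sx => Sx.2).
exists (codom x ++ l1); split=> [c|v Sv].
  by rewrite mem_cat => /orP[/codomP[i ->]|/l1S[]].
have /= [c _ hc] := Sl v Sv.
have /aP[e cE] : I c by exists v.
(* [w] is in [S] and has the same coefficient at [b] as [v], so [v - w] falls under the induction
   hypothesis. *)
pose w := \sum_i e i *: x i.
rewrite -(subrK w v); apply: spanD => //; last first.
  apply: (@span_sub _ coeffs_all _ (codom x)) => //.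
    by move=> y; rewrite mem_cat => ->.
  by apply/span_ord => //; exists e.
apply: (@span_sub _ coeffs_all _ l1) => //.
  by move=> y yl; rewrite mem_cat yl orbT.
apply: l1P; split.
  by apply: gsubB => //; apply: gsub_sum => // i _; apply: gsubZ.
have -> : v - w = (v - c *: b) + \sum_i (- e i) *: (x i - a i *: b).
  rewrite cE scaler_suml -addrA; congr (_ + _).
  rewrite /w -sumrN -sumrN -big_split /=; apply: eq_bigr => i _.
  by rewrite scalerBr !scaleNr scalerA opprK [RHS]addrC addrK.
apply: spanD => //; apply: span_sum => // i _.
by rewrite -[_ *: _]addr0; apply: span_lin => //; apply: span0.
Qed.

Lemma gsub_gens V (S : V -> Prop) : finitely_generated V -> gsub S ->
  exists l : seq V,
  (forall b, b \in l -> [/\ S b, b <> 0 & exists n, mdeg n b]) /\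
  forall x, S x -> hspan l x.
Proof.
move=> /fg_span[l hl] gS.
have [l' [l'h l'P]] := @homogeneous_gens _ V _ l coeffs_all (gsub_full V) (fun _ _ =>
  Logic.I).
have [||l2 [l2S l2P]] := @noetherian_span V l' S _ gS.
- by move=> b /l'h[].
- by move=> x _; apply: l'P.
have [l3 [l3h l3P]] := homogeneous_gens coeffs_all gS l2S.
by exists l3; split=> // x /l2P/l3P.
Qed.

Lemma sub_fg V (S : V -> Prop) (gS : gsub S) :
  finitely_generated V -> finitely_generated (subm gS).
Proof.
move=> Vfg; have [l [lS lP]] := gsub_gens Vfg gS.
have Sl (i : 'I_(size l)) : S l`_i by have [] := lS l`_i (mem_nth _ (ltn_ord i)).
exists (size l), (fun i => sub_elt gS (Sl i)) => u.
have [a uE] := hspan_nth (lP _ (sub_typeP u)).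
exists a; apply: (@sub_incl_inj _ _ _ _ gS).
rewrite ghom_sum [LHS]uE; apply: eq_bigr => i _.
by rewrite ghomZ.
Qed.

Definition fgsub (V : fgmod H) (S : V -> Prop) (gS : gsub S) : fgmod H :=
  FGMod (sub_fg gS (fg_fg V)).

(** Without a maximal member, choice yields a strictly increasing sequence in the family. Its union
    is finitely generated, hence already reached at a finite stage. *)
Lemma gsub_max (V : fgmod H) (F : (V -> Prop) -> Prop) :
  (forall S, F S -> gsub S) -> (exists S, F S) ->
  exists2 S, F S & forall T, F T -> (forall v, S v -> T v) -> forall v, T v -> S v.
Proof.
move=> Fg [S0 FS0]; apply: contrapT => /forall2NP nmax.
have step (S : {S | F S}) : exists T : {S | F S},
    (forall v, sval S v -> sval T v) /\ exists v, sval T v /\ ~ sval S v.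
  have [//|/existsNP[T /not_implyP[FT /not_implyP[ST /existsNP[v /not_implyP[Tv
    Sv]]]]]] :=
    nmax (sval S); first by case: S.
  by exists (exist _ T FT); split=> //; exists v.
have [g gP] := choice step.
pose C n := sval (iter n g (exist _ S0 FS0)).
have Cg n : gsub (C n) by apply: Fg; exact: proj2_sig.
have CS n v : C n v -> C n.+1 v by apply: (gP _).1.
have Cle m n v : (m <= n)%N -> C m v -> C n v.
  by move=> /subnK <-; elim: (n - m)%N => //= j IH /IH; rewrite addSn; apply: CS.
have gU : gsub (fun v => exists n, C n v).
  apply: gsub_intro; first by exists 0%N; apply: gsub0.
    move=> a x y [m hx] [n hy]; exists (maxn m n).
    by apply: gsubD => //; [apply: gsubZ => //; apply: Cle hx|apply: Cle hy];
      rewrite ?leq_maxl ?leq_maxr.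
  by move=> n v [m hv]; exists m; apply: gsub_hc.
have [l [lS lP]] := gsub_gens (fg_fg V) gU.
have [n hn] : exists n, forall b, b \in l -> C n b.
  have : forall b, b \in l -> exists n, C n b by move=> b /lS[].
  elim: l {lS lP} => [|b l IH] h; first by exists 0%N.
  have [|n hn] := IH; first by move=> c cl; apply: h; rewrite inE cl orbT.
  have [m hm] := h b (mem_head _ _); exists (maxn m n) => c.
  rewrite inE => /predU1P[->|/hn]; last by apply: Cle; rewrite leq_maxr.
  by apply: Cle hm; rewrite leq_maxl.
have [v [h1 h2]] := (gP (iter n g (exist _ S0 FS0))).2.
by apply/h2/(span_gsub (Cg n) hn)/lP; exists n.+1.
Qed.

End Noetherian.

Definition fgquot (V : fgmod H) (S : V -> Prop) (gS : gsub S) : fgmod H :=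
  FGMod (surj_fg (@quot_map_surj _ _ _ _ gS) (fg_fg V)).

Definition fgprod (V W : fgmod H) : fgmod H := FGMod (prod_fg (fg_fg V) (fg_fg W)).

Definition fgreg : fgmod H := FGMod reg_fg.

End Constructions.

Notation hspan := (@span _ _ (fun=> True) _).

#[global] Hint Resolve coeffs_all : core.

(** * Finite-dimensional pieces and degree bounds *)

Section Laurentian.
Variables (k : fieldType) (H : galgebra k).
Hypothesis Hn : left_noetherian H.
Implicit Types U V W X Y : gmodule H.

Definition scalars (a : H) := exists c : k, a = scal H c.
Notation kspan := (@span k H scalars _).

Lemma scalars0 : scalars 0. Proof. by exists 0; rewrite rmorph0. Qed.
Lemma scalars1 : scalars 1. Proof. by exists 1; rewrite rmorph1. Qed.
Lemma scalarsD c a b : scalars c -> scalars a -> scalars b -> scalars (c * a + b).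
Proof.
by move=> [x ->] [y ->] [z ->]; exists (x * y + z); rewrite rmorphD rmorphM.
Qed.
Lemma coeffs_scalars : coeffs scalars.
Proof. by split; [exact: scalars0|exact: scalars1|exact: scalarsD]. Qed.
Local Hint Resolve coeffs_scalars : core.

Definition ksub V (S : V -> Prop) :=
  S 0 /\ forall c x y, S x -> S y -> S (scal H c *: x + y).

Lemma gsub_ksub V (S : V -> Prop) : gsub S -> ksub S.
Proof. by case=> S0 SD _; split=> // c x y; apply: SD. Qed.

Lemma ksub_kspan V (l : seq V) : ksub (kspan l).
Proof.
split; first exact: span0.
by move=> c x y; apply: span_lin => //; exists c.
Qed.

Lemma kscaleK V c (x : V) : c != 0 -> scal H c^-1 *: (scal H c *: x) = x.
Proof. by move=> c0; rewrite scalerA -rmorphM mulVf // rmorph1 scale1r. Qed.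

(** Exchange: an element [s] of [S] with nonzero coefficient at [b] replaces [b], and the rest of
    [S] is what lies in the span of [l]. The last clause is the strict drop of dimension for a
    proper subspace, measured by the length of the list. *)
Lemma steinitz V (l : seq V) (S : V -> Prop) : ksub S ->
  (forall x, S x -> kspan l x) ->
  exists l' : seq V, [/\ (size l' <= size l)%N, forall x, S x <-> kspan l' x
    & (exists2 t, kspan l t & ~ S t) -> (size l' < size l)%N].
Proof.
elim: l S => [|b l IH] S kS Sl.
  exists [::]; split=> // [x|[t /= ->]]; last by case: kS.
  by split=> [/Sl//|/= ->]; case: kS.
have [Sl'|/existsNP[s /not_implyP[Ss ls]]] := pselect (forall x, S x -> kspan l x).
  have [l' [h1 h2 _]] := IH S kS Sl'; by exists l'; split=> //=; exact: leqW.
have /= [_ [c ->] cl] := Sl s Ss.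
have c0 : c != 0.
  by apply: contra_notN ls => /eqP c0; move: cl; rewrite c0 rmorph0 scale0r subr0.
(* Subtracting [d / c] times [s] clears the coefficient at [b], because that of [s] is [c]. *)
have red x d : S x -> kspan l (x - scal H d *: b) ->
    S (x - scal H (d / c) *: s) /\ kspan l (x - scal H (d / c) *: s).
  move=> Sx dl; have [_ SD] := kS; have [_ lD] := ksub_kspan l; split.
    by rewrite addrC -scaleNr -rmorphN; apply: SD.
  have := lD (- (d / c)) _ _ cl dl; congr (kspan l _).
  rewrite scalerBr scalerA -rmorphM mulNr mulfVK // !rmorphN !scaleNr opprK.
  by rewrite addrACA subrr addr0 addrC.
have red' x d : kspan l (x - scal H d *: b) -> kspan l (x - scal H (d / c) *: s).
  move=> dl; have [_ lD] := ksub_kspan l.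
  have := lD (- (d / c)) _ _ cl dl; congr (kspan l _).
  rewrite scalerBr scalerA -rmorphM mulNr mulfVK // !rmorphN !scaleNr opprK.
  by rewrite addrACA subrr addr0 addrC.
have kS' : ksub (fun x => S x /\ kspan l x).
  have [S0 SD] := kS; have [l0 lD] := ksub_kspan l.
  by split=> // d x y [? ?] [? ?]; split; [apply: SD|apply: lD].
have [l' [h1 h2 h3]] := IH _ kS' (fun x h => h.2).
have SE x : S x <-> kspan (s :: l') x.
  split=> [Sx|[_ [d ->] /h2[h _]]].
    have [_ [d ->] dl] := Sl x Sx; exists (scal H (d / c)); first by exists (d / c).
    by apply/h2/red.
  by rewrite -(subrK (scal H d *: s) x) addrC; case: kS => _; apply.
exists (s :: l'); split=> // [[t [_ [d ->] tl] St]].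
rewrite /= ltnS; apply: h3; exists (t - scal H (d / c) *: s); first exact: red'.
move=> [h _]; apply: St; rewrite -(subrK (scal H (d / c) *: s) t) addrC.
by case: kS => _; apply.
Qed.

(** Either the chain is constant, and then zero by separation, or some member is proper in the first
    one and is spanned by a shorter list. *)
Lemma chain_stationary V (l : seq V) (T : nat -> V -> Prop) :
  (forall i, ksub (T i)) -> (forall i v, T i.+1 v -> T i v) ->
  (forall v, (forall i, T i v) -> v = 0) -> (forall v, T 0%N v -> kspan l v) ->
  exists i, forall v, T i v -> v = 0.
Proof.
have [r] := ubnP (size l); elim: r l T => // r IH l T lr kT Td T0 Tl.
have Tle m n v : (m <= n)%N -> T n v -> T m v.
  by move=> /subnK <-; elim: (n - m)%N => //= j IHj; rewrite addSn => /Td.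
have [l' [ll' lT _]] := steinitz (kT 0%N) Tl.
have [h|/existsNP[i /existsNP[t /not_implyP[Tt nTt]]]] :=
  pselect (forall i v, T 0%N v -> T i v).
  by exists 0%N => v Tv; apply: T0 => i; apply: h.
have [|l2 [_ lT2 lt2]] := @steinitz _ l' (T i) (kT i).
  by move=> x Tx; apply/lT; apply: (Tle _ i).
have {}lt2 : (size l2 < size l')%N by apply: lt2; exists t => //; apply/lT.
have [||||v|j hj] := IH l2 (fun j => T (i + j)%N).
- exact: leq_trans lt2 (leq_trans ll' lr).
- by [].
- by move=> j v; rewrite addnS; apply: Td.
- by move=> v hv; apply: T0 => j; apply: (Tle _ (i + j)%N); rewrite ?leq_addl.
- by rewrite addn0 => /lT2.
- by exists (i + j)%N.
Qed.

Hypothesis Hl : laurentian H.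

Definition bounded_below V (N : int) :=
  forall (n : int) (v : V), n < N -> mdeg n v -> v = 0.
Definition bounded_above V (N : int) :=
  forall (n : int) (v : V), N <= n -> mdeg n v -> v = 0.

Lemma fg_bounded_below V : finitely_generated V -> exists N, bounded_below V N.
Proof.
move=> /fg_span[l0 hl0].
have [l [hl lP]] := @homogeneous_gens _ _ _ V _ l0 (@coeffs_all k H) (gsub_full V)
  (fun _ _ => Logic.I).
suff [N hN] : exists N : int, forall n x, n < N -> hspan l x -> hc V n x = 0.
  exists N => n v nN /(comp_id (mdeg_grading V)) <-.
  exact: hN (lP _ (hl0 v)).
have {}hl : homogl l by move=> b /hl[].
elim: l hl {lP} => [|b l IH] hl.
  by exists 0 => n x _ /= ->; rewrite raddf0.
have [|N hN] := IH; first by move=> c cl; apply: hl; rewrite inE cl orbT.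
have [m hb] := hl b (mem_head _ _); have [NH hNH] := Hl.2.
(* In degree [n] the coefficient of [b] has degree [n - m], and [H] vanishes below [NH]. *)
exists (Num.min N (NH + m)) => n x; rewrite lt_min => /andP[nN nH] [a _ hx].
rewrite -[x](subrK (a *: b)) raddfD /= (hN _ _ nN hx) add0r (hc_scale _ _ hb).
rewrite (hNH (n - m) _ _ (comp_deg _ _ _)) ?scale0r //.
by rewrite ltrBlDr.
Qed.

Lemma degree_fin V n : finitely_generated V ->
  exists l : seq V, forall v, mdeg n v -> kspan l v.
Proof.
move=> /fg_span[l0 hl0].
have [l [hl lP]] := @homogeneous_gens _ _ _ V _ l0 (@coeffs_all k H) (gsub_full V)
  (fun _ _ => Logic.I).
suff [l' hl'] : exists l' : seq V, forall x, hspan l x -> kspan l' (hc V n x).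
  exists l' => v /(comp_id (mdeg_grading V)) <-.
  exact: hl' (lP _ (hl0 v)).
have {}hl : homogl l by move=> b /hl[].
elim: l hl {lP} => [|b l IH] hl.
  by exists [::] => x /= ->; rewrite raddf0.
have [|l' hl'] := IH; first by move=> c cl; apply: hl; rewrite inE cl orbT.
have [m hb] := hl b (mem_head _ _); have [r [h hP]] := Hl.1 (n - m).
exists (codom (fun i => h i *: b) ++ l') => x [a _ hx].
rewrite -[x](subrK (a *: b)) raddfD /= (hc_scale _ _ hb) addrC; apply: spanD => //.
  apply: (@span_sub _ _ _ coeffs_scalars _ (codom (fun i => h i *: b))) => //.
    by move=> y; rewrite mem_cat => ->.
  apply/span_ord => //; have /hP[c ->] := comp_deg (hdeg_grading H) (n - m) a.
  exists (fun i => scal H (c i)) => [i|]; first by exists (c i).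
  by rewrite scaler_suml; apply: eq_bigr => i _; rewrite scalerA.
apply: (@span_sub _ _ _ coeffs_scalars _ l'); [|exact: hl'].
by move=> y; rewrite mem_cat => ->; rewrite orbT.
Qed.

Lemma bounded_fin V M : finitely_generated V -> bounded_above V M ->
  exists l : seq V, forall v, kspan l v.
Proof.
move=> Vfg hM; have [N hN] := fg_bounded_below Vfg.
have [l hl] : exists l : seq V, forall n v, N <= n -> n < M -> mdeg n v -> kspan l v.
  have [j] : exists j : nat, M <= N + j%:Z by exists `|M - N|%N; lia.
  elim: j M {hM} => [|j IH] M Mj.
    by exists [::] => n v h1 h2; exfalso; lia.
  have [|l hl] := IH (M - 1); first lia.
  have [l' hl'] := degree_fin (M - 1) Vfg.
  exists (l ++ l') => n v nN nM hv.
  have [nM1|nM1] := ltP n (M - 1).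
    apply: (@span_sub _ _ _ coeffs_scalars _ l); [|exact: hl hv].
    by move=> y; rewrite mem_cat => ->.
  have nE : n = M - 1 by lia.
  apply: (@span_sub _ _ _ coeffs_scalars _ l'); [|by apply: hl'; rewrite -nE].
  by move=> y; rewrite mem_cat => ->; rewrite orbT.
exists l => v; have [s [_ _ ->]] := comp_sum (mdeg_grading V) v.
apply: span_sum => // n _.
have hv := comp_deg (mdeg_grading V) n v.
have [nN|nN] := ltP n N; first by rewrite (hN _ _ nN hv); apply: span0.
have [nM|nM] := ltP n M; first exact: hl hv.
by rewrite (hM _ _ nM hv); apply: span0.
Qed.

(** In each degree the chain consists of subspaces of a finite-dimensional space and so reaches
    zero, and only finitely many degrees lie between the lower bound of [V] and [M]. This stands in
    for finiteness of the filtration. *)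
Lemma separated_degree V (F : nat -> V -> Prop) : finitely_generated V ->
  (forall i, gsub (F i)) -> (forall i v, F i.+1 v -> F i v) ->
  (forall v, (forall i, F i v) -> v = 0) ->
  forall M : int, exists i, forall (n : int) v, n < M -> F i v -> mdeg n v -> v = 0.
Proof.
move=> Vfg gF Fd F0 M; have [N hN] := fg_bounded_below Vfg.
have Fle m n v : (m <= n)%N -> F n v -> F m v.
  by move=> /subnK <-; elim: (n - m)%N => //= j IHj; rewrite addSn => /Fd.
have [j] : exists j : nat, M <= N + j%:Z by exists `|M - N|%N; lia.
elim: j M => [|j IH] M Mj.
  by exists 0%N => n v nM _; apply: hN; lia.
have [|i hi] := IH (M - 1); first lia.
have [l hl] := degree_fin (M - 1) Vfg.
have [|||v [_ /hl]//|i' hi'] :=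
  @chain_stationary V l (fun i v => F i v /\ mdeg (M - 1) v).
- move=> r; split; first by split; [apply: gsub0|apply: grading0 (mdeg_grading V) _].
  move=> c x y [Fx hx] [Fy hy]; split; first by case: (gsub_ksub (gF r)) => _; apply.
  by apply: (degD (mdeg_grading V)) => //; apply: mdeg_scal.
- by move=> r v [/Fd].
- by move=> v h; apply: F0 => r; case: (h r).
exists (maxn i i') => n v nM Fv hv.
have [nM1|nM1] := ltP n (M - 1).
  by apply: hi nM1 _ hv; apply: Fle Fv; rewrite leq_maxl.
have nE : n = M - 1 by lia.
by apply: hi'; split; [apply: Fle Fv; rewrite leq_maxr|rewrite -nE].
Qed.

End Laurentian.

Notation kspan := (@span _ _ (@scalars _ _) _).
#[global] Hint Resolve coeffs_scalars : core.

(** * Grading shifts *)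

Section ShiftLemmas.
Variables (k : fieldType) (H : galgebra k).
Implicit Types V W : gmodule H.

Lemma hc_shift V n m v : hc (shift n V) m v = hc V (m - n) v.
Proof.
have := @comp_morph V V (@mdeg _ _ V) (@sdeg _ _ n V) (mdeg_grading V)
  (sdeg_grading n V) (idfun : {additive V -> V}) n _ (m - n) v.
by rewrite subrK; apply=> i w; rewrite /sdeg addrK.
Qed.

Lemma gsub_shift V n (S : V -> Prop) : @gsub k H (shift n V) S <-> gsub S.
Proof.
split=> gS; apply: gsub_intro.
- exact: gsub0 gS.
- by case: gS.
- by move=> m v Sv; have := gsub_hc (m + n) gS Sv; rewrite hc_shift addrK.
- exact: gsub0 gS.
- by case: gS.
- by move=> m v Sv; rewrite hc_shift; apply: gsub_hc.
Qed.

Lemma simple_shift V n : simple V -> simple (shift n V).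
Proof. by case=> h1 h2; split=> // S /gsub_shift /h2. Qed.

Lemma iso_shift V W n : iso V W -> iso (shift n V) (shift n W).
Proof. by case=> f [g h]; exists (ghom_shift n f), (ghom_shift n g). Qed.

Definition shift_shift V m n p (e : p = m + n) :
  ghom (shift m (shift n V)) (shift p V).
Proof.
refine (@GHom k H (shift m (shift n V)) (shift p V) (idfun : {linear V -> V}) _).
by move=> i v; rewrite /= /sdeg e opprD addrA.
Defined.

Lemma iso_shift_shift V m n p : p = m + n ->
  iso (shift m (shift n V)) (shift p V).
Proof.
move=> e; exists (shift_shift V e).
unshelve eexists (@GHom k H (shift p V) (shift m (shift n V))
  (idfun : {linear V -> V}) _); last by [].
by move=> i v; rewrite /= /sdeg e opprD addrA.
Qed.

Lemma iso_shift0 V : iso (shift 0 V) V.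
Proof.
unshelve eexists (@GHom k H (shift 0 V) V (idfun : {linear V -> V}) _).
  by move=> i v; rewrite /= /sdeg subr0.
unshelve eexists (@GHom k H V (shift 0 V) (idfun : {linear V -> V}) _); last by [].
by move=> i v; rewrite /= /sdeg subr0.
Qed.

Lemma simple_im V W (f : ghom V W) : simple W -> (exists v, f v <> 0) -> surj f.
Proof.
move=> [_ h] [v fv]; have [h0|//] := h _ (gsub_im f).
by case: fv; apply: h0; exists v.
Qed.

Lemma simple_inj V W (f : ghom V W) : simple V -> (exists v, f v <> 0) ->
  injective f.
Proof.
move=> [_ h] [v fv]; have [h0|h1] := h _ (gsub_ker f); first exact: ghom_inj.
by case: fv.
Qed.

Lemma projective_shift (P : fgmod H) n : projective P -> projective (fgshift n P).
Proof.
move=> pP V W g f gs.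
pose f' : ghom P (shift (- n) W) :=
  ghom_ofr (@is_deg_shiftl _ _ P W n f) (esym (opprK n)).
have [h hP] := pP (fgshift (- n) V) (fgshift (- n) W) (ghom_shift (- n) g) f' gs.
have hd := @is_deg_shiftr _ _ P V (- n) h; rewrite opprK in hd.
by exists (ghom_ofl hd).
Qed.

End ShiftLemmas.

(** * Simple modules and their projective covers *)

Section Simple.
Variables (k : fieldType) (H : galgebra k) (d : Order.disp_t)
  (Pi : finPOrderType d) (D : gmod_data H Pi).
Hypothesis Hn : left_noetherian H.
Implicit Types U V W : fgmod H.

Local Notation L p := (simple_mod D p).
Local Notation P p := (proj_mod D p).
Local Notation pr p := (proj_map D p).

Lemma maximal_gsub V (T : V -> Prop) : gsub T -> (exists v, ~ T v) ->
  exists S, [/\ gsub S, forall v, T v -> S v, exists v, ~ S v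
    & forall S' : V -> Prop, gsub S' -> (forall v, S v -> S' v) ->
      (forall v, S' v -> S v) \/ (forall v, S' v)].
Proof.
move=> gT nT.
have [||S [gS TS nS] mS] := @gsub_max _ _ Hn V
  (fun S => [/\ gsub S, forall v, T v -> S v & exists v, ~ S v]).
- by move=> S [].
- by exists T.
exists S; split=> // S' gS' SS'.
have [|/existsNP nS'] := pselect (forall v, S' v); first by right.
by left; apply: mS => //; split=> // v /TS/SS'.
Qed.

Lemma simple_quotient V (T : V -> Prop) : gsub T -> (exists v, ~ T v) ->
  exists p n (f : ghom V (shift n (L p))), surj f /\ forall v, T v -> f v = 0.
Proof.
move=> gT nT; have [S [gS TS [v nSv] mS]] := maximal_gsub gT nT.
have sQ : simple (fgquot gS).
  split; first by exists (quot_map gS v) => /quot_map0.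
  move=> R gR; have [|h|h] := mS _ (gsub_preimage (quot_map gS) gR).
  - by move=> w /(quot_map0 gS) ->; apply: gsub0.
  - left=> q; have [w <-] := quot_map_surj (gS := gS) q => Rw.
    by apply/quot_map0/h.
  - by right=> q; have [w <-] := quot_map_surj (gS := gS) q.
have [p [n [f [g [fg gf]]]]] := simple_complete D sQ.
exists p, n, (ghom_comp f (quot_map gS)); split=> [w|w /TS Sw].
  have [u uE] := quot_map_surj (gS := gS) (g w).
  by exists u; rewrite /= -[RHS]gf -uE.
have e : quot_map gS w = 0 by apply/quot_map0.
by change (f (quot_map gS w) = 0); rewrite e ghom0.
Qed.

Lemma simple_nz p : exists v : L p, v <> 0.
Proof. by have [] := simple_modP D p. Qed.

Lemma pr_surj p : surj (pr p). Proof. by have [] := proj_mapP D p. Qed.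

Lemma pr_nz p : exists x, pr p x <> 0.
Proof. by have [v v0] := simple_nz p; have [x xv] := pr_surj v; exists x; rewrite xv.
  Qed.

Lemma proj_projective p : projective (P p).
Proof. by have [] := proj_mapP D p. Qed.

Lemma lift_cover V p n (f : ghom V (shift n (L p))) : surj f ->
  exists t : ghom (shift n (P p)) V, forall x, f (t x) = pr p x.
Proof.
move=> fs; have pP := @projective_shift _ _ (P p) n (@proj_projective p).
have [t tP] := pP V (fgshift n (L p)) f (ghom_shift n (pr p)) fs.
by exists t.
Qed.

Lemma pr_radical p (S : P p -> Prop) : gsub S -> (exists v, ~ S v) ->
  forall v, S v -> pr p v = 0.
Proof.
move=> gS [w nSw] v Sv; apply: contrapT => pv; apply: nSw.
have [_ _ sup] := proj_mapP D p; apply: sup => // u.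
have [_ h] := simple_modP D p; have [h0|h1] := h _ (gsub_image (pr p) gS).
  by case: pv; apply: h0; exists v.
by have [s Ss sE] := h1 (pr p u); exists s.
Qed.

Lemma shift_radical p n (W : gmodule H) (t : ghom (shift n (P p)) W) :
  (exists x, t x <> 0) -> forall x, t x = 0 -> pr p x = 0.
Proof.
move=> nt; apply: (@pr_radical p (fun x => t x = 0)) => //.
exact/gsub_shift/(gsub_ker t).
Qed.

(** Says that [L p] is, up to shift, a composition factor of [W]. As [P p] is projective, exact
    sequences can be treated without counting multiplicities. *)
Definition occurs p (W : gmodule H) :=
  exists n (t : ghom (shift n (P p)) W) x, t x <> 0.

Lemma simple_factor p s n (t : ghom (shift n (P p)) (L s)) :
  (exists x, t x <> 0) -> exists h : ghom (L s) (shift n (L p)),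
  injective h /\ forall x, h (t x) = pr p x.
Proof.
move=> nt; have ts := simple_im (simple_modP D s) nt.
have [h hP] := factor_surj (f := ghom_shift n (pr p)) ts (shift_radical nt).
exists h; split=> //; apply: simple_inj; first exact: simple_modP.
by have [x xP] := pr_nz p; exists (t x); rewrite hP.
Qed.

Lemma occurs_simple p s : occurs p (L s) -> p = s.
Proof.
move=> [n [t [x tx]]]; have [|h [hi hP]] := @simple_factor p s n t; first by exists x.
apply/esym/(@simple_irredundant _ _ _ _ D); exists n, h; apply: bij_iso => // v.
by have [y <-] := @pr_surj p v; exists (t y).
Qed.

Lemma occurs_shift p n (W : gmodule H) : occurs p (shift n W) -> occurs p W.
Proof.
move=> [m [t [x tx]]]; exists (m - n).
by exists (ghom_ofl (@is_deg_shift _ _ _ _ _ _ t)), x.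
Qed.

Lemma occurs_sub p (W W' : gmodule H) (f : ghom W W') :
  injective f -> occurs p W -> occurs p W'.
Proof.
move=> fi [n [t [x tx]]]; exists n, (ghom_comp f t), x => /=.
by move/(inj0 fi).
Qed.

Lemma occurs_quot p V W (f : ghom V W) : surj f -> occurs p W -> occurs p V.
Proof.
move=> fs [n [t [x tx]]].
have [h hP] := @projective_shift _ _ (P p) n (@proj_projective p) V W f t fs.
by exists n, h, x => hx; apply: tx; rewrite -hP hx ghom0.
Qed.

Lemma occurs_ext p U V W (f : ghom U V) (g : ghom V W) :
  injective f -> exact_at f g -> occurs p V -> occurs p U \/ occurs p W.
Proof.
move=> fi fg [n [t [x tx]]].
have [[y gy]|/forallNP ng] := pselect (exists y, g (t y) <> 0).
  by right; exists n, (ghom_comp g t), y.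
have [y|h hP] := factor_inj (i := f) (f := t) fi.
  by apply/fg; apply: contrapT => /ng.
by left; exists n, h, x => hx; apply: tx; rewrite -hP hx ghom0.
Qed.

Hypothesis Hs : schurian H.

Lemma is_deg_in_hom V W e (f : {linear V -> W}) : @is_deg k H V W e f -> in_hom f.
Proof.
move=> hf.
exists [:: e], (fun n => if n == e then f else (ghom_zero V W : {linear V -> W})).
split=> [n|v]; last by rewrite big_seq1 eqxx.
case: eqP => [->|_] m v hv; last exact: (grading0 (mdeg_grading W)).
by have := hf _ _ hv; rewrite subrK.
Qed.

(** The map is multiplication by a scalar. This preserves degrees, so it can have degree [e <> 0]
    only if it is zero. *)
Lemma schur_deg p e (f : {linear L p -> L p}) : is_deg e f ->
  exists c, (forall v, f v = scal H c *: v) /\ (e = 0 \/ c = 0).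
Proof.
move=> hf; have [c cP] := Hs (simple_modP D p) (is_deg_in_hom hf).
exists c; split=> //; have [->|e0] := eqVneq e 0; first by left.
right; apply/eqP; apply: contrapT => /negP c0; have [v] := simple_nz p; apply.
apply: (comp_eq0 (G := mdeg_grading (L p))) => n.
rewrite -[LHS](kscaleK _ c0) -cP.
have hn := comp_deg (mdeg_grading (L p)) n v.
have := comp_id (mdeg_grading _) (hf _ _ hn).
rewrite (comp_ne (mdeg_grading _) (n := n)); first by move=> <-; rewrite scaler0.
  by rewrite cP; apply: mdeg_scal.
by rewrite -subr_eq0 addrAC subrr add0r.
Qed.

Lemma proj_simple_scal p n (t : ghom (shift n (P p)) (L p)) :
  exists c, (forall x, t x = scal H c *: pr p x) /\ (n = 0 \/ c = 0).
Proof.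
have [[y ty]|/forallNP nt] := pselect (exists y, t y <> 0); last first.
  exists 0; split=> [x|]; last by right.
  by rewrite rmorph0 scale0r; apply: contrapT => /nt.
have [|h [hi hP]] := @simple_factor p p n t; first by exists y.
have [c [cP nc]] := schur_deg (@is_deg_shiftr _ _ (L p) (L p) n h).
have c0 : c != 0.
  apply/eqP => c0; apply: ty; apply: (inj0 hi).
  by rewrite cP c0 rmorph0 scale0r.
exists c^-1; split=> [x|]; first by rewrite -hP cP kscaleK.
by left; case: nc => [/eqP|/eqP]; [rewrite oppr_eq0 => /eqP|rewrite (negbTE c0)].
Qed.

(** ** Composition factors *)

(** The subquotient is the image of [t] modulo the image of the radical of [P p]. It is the shifted
    [L p] because the kernel of [t] is contained in that radical. *)
Lemma occurs_composition_factor p n (Q : gmodule H) (B : Q -> Prop)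
    (t : ghom (shift n (P p)) Q) :
  (exists x, t x <> 0) -> (forall x, B (t x)) ->
  composition_factor B (shift n (L p)).
Proof.
move=> nt Bt; split; first exact/simple_shift/simple_modP.
have gR : @gsub k H (shift n (P p)) (fun x => pr p x = 0).
  exact/gsub_shift/(gsub_ker (pr p)).
exists (fun q => exists x, t x = q), (fun q => exists2 x, pr p x = 0 & t x = q).
have gI := gsub_im t.
split=> //; [exact: (gsub_image t gR)|by move=> q [x _ <-]; exists x| |].
  by move=> _ [x <-].
have [x|t' t'P] := factor_inj (f := t) (@sub_incl_inj _ _ _ _ gI).
  by exists (sub_elt gI (ex_intro _ x erefl)).
have t's : surj t'.
  move=> u; have [x xu] := sub_typeP u; exists x.
  by apply: sub_incl_inj; rewrite t'P.
have [x t'x|p' p'P] := factor_surj (f := ghom_shift n (pr p)) t's.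
  by apply: (shift_radical nt); rewrite -t'P t'x ghom0.
exists (subm gI), (sub_incl gI), p'; split.
- exact: sub_incl_inj.
- exact: (sub_inclP gI).
- by move=> v; have [x xv] := pr_surj v; exists (t' x); rewrite p'P.
- move=> u; have [x <-] := t's u; rewrite p'P t'P; split=> [px|[y py tyx]].
    by exists x.
  rewrite /= -[LHS]subr0 -[in LHS]py -ghomB; apply: (shift_radical nt).
  by rewrite (ghomB t) tyx subrr.
Qed.

(** [Q] may fail to be finitely generated, while the classification of simples concerns [fgmod]
    only. So the upper term [M] of the subquotient is pulled back to [X], which makes [S] a quotient
    of a finitely generated module, and the projective cover is lifted to that pullback. *)
Lemma composition_factor_occurs (X : fgmod H) (Q S : gmodule H) (f : ghom X Q)
    (B : Q -> Prop) : (forall q, B q -> exists x, f x = q) ->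
  composition_factor B S ->
  exists p n (t : ghom (shift n (P p)) X),
    sim S (L p) /\ exists x, B (f (t x)) /\ f (t x) <> 0.
Proof.
move=> Bf [sS [M [N [gM gN NM MB [U [i [e [ii iM es eN]]]]]]]].
have gX := gsub_preimage f gM; pose X' := fgsub Hn gX.
have [x|a aP] := factor_inj (i := i) (f := ghom_comp f (sub_incl gX)) ii.
  by apply/iM/(sub_typeP x).
have eas : surj (ghom_comp e a).
  move=> s; have [u us] := es s.
  have Mu : M (i u) by apply/iM; exists u.
  have [x xu] := Bf _ (MB _ Mu).
  have Mx : M (f x) by rewrite xu.
  exists (sub_elt gX Mx); rewrite /= -us; congr (e _); apply: ii.
  by rewrite aP.
pose S' := FGMod (surj_fg eas (fg_fg X')).
have [p [n [g [g' [gg' g'g]]]]] := simple_complete D (S := S') sS.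
have [|t tP] := @lift_cover X' p n (ghom_comp g (ghom_comp e a)).
  move=> v; have [x xv] := eas (g' v); exists x.
  by rewrite -[RHS]g'g -xv.
exists p, n, (ghom_comp (sub_incl gX) t); split.
  by exists n, g, g'.
have [y yP] := pr_nz p; exists y; split; first by apply/MB/(sub_typeP (t y)).
move=> fty; apply: yP; rewrite -tP /=.
have -> : a (t y) = 0 by apply: (inj0 ii); rewrite aP.
by rewrite !ghom0.
Qed.

(** Induction on the length of a spanning list, splitting off a simple quotient. Only the simples
    that occur in [V] are asked for, since the property is at times known for these alone. *)
Lemma devissage (C : fgmod H -> Prop) :
  (forall V, (forall v : V, v = 0) -> C V) ->
  (forall U V W (f : ghom U V) (g : ghom V W),
     [/\ injective f, exact_at f g & surj g] -> C U -> C W -> C V) ->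
  forall (V : fgmod H) (l : seq V), (forall v, kspan l v) ->
  (forall p n, occurs p V -> C (fgshift n (L p))) -> C V.
Proof.
move=> C0 Cext V l hl Cs.
suff h r : forall (l : seq V) (S : V -> Prop) (gS : gsub S), (size l < r)%N ->
    (forall v, S v <-> kspan l v) -> C (fgsub Hn gS).
  (* [C] is not assumed invariant under isomorphism, so [V] is reached from its full submodule by an
     extension with zero quotient. *)
  pose Z := fgsub Hn (gsub_zero V).
  apply: (@Cext (fgsub Hn (gsub_full V)) V Z (sub_incl _) (ghom_zero V Z)).
  - split=> [|v|z]; first exact: sub_incl_inj.
      by split=> // _; apply/sub_inclP.
    by exists 0; apply: sub_incl_inj; rewrite ghom0 /= [RHS](sub_typeP z).
  - by apply: (h (size l).+1 l) => // v; split=> // _; apply: hl.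
  - apply: C0 => z; apply: sub_incl_inj; rewrite ghom0; exact: (sub_typeP z).
elim: r => // r IH {hl}l S gS lr Sl.
have [S0|/existsNP[v /not_implyP[Sv v0]]] := pselect (forall v, S v -> v = 0).
  apply: C0 => u; apply: sub_incl_inj; rewrite ghom0; exact/S0/(sub_typeP u).
have [|p [n [f [fs _]]]] := simple_quotient (gsub_zero (fgsub Hn gS)).
  by exists (sub_elt gS Sv) => /(congr1 (sub_incl gS)); rewrite ghom0.
have gS' := gsub_image (sub_incl gS) (gsub_ker f).
have S'S w : (exists2 u, f u = 0 & sub_incl gS u = w) -> S w.
  by move=> [u _ <-]; apply: sub_typeP.
have [|l' [_ S'l' lt]] := steinitz (l := l) (gsub_ksub gS').
  by move=> w /S'S /Sl.
have [w|j jP] := factor_inj (f := sub_incl gS') (@sub_incl_inj _ _ _ _ gS).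
  by exists (sub_elt gS (S'S _ (sub_typeP w))).
apply: (Cext (fgsub Hn gS') (fgsub Hn gS) (fgshift n (L p)) j f).
- split=> // [u v'|u].
    by move=> /(congr1 (sub_incl gS)); rewrite !jP => /sub_incl_inj.
  split=> [fu|[u' <-]].
    have h : exists2 u', f u' = 0 & sub_incl gS u' = sub_incl gS u by exists u.
    by exists (sub_elt gS' h); apply: sub_incl_inj; rewrite jP.
  have [w fw wE] := sub_typeP u'.
  by rewrite (_ : j u' = w) //; apply: sub_incl_inj; rewrite jP; exact: esym wE.
- apply: (IH l') => //; apply: leq_trans (lt _) lr.
  have [x xn] := simple_nz p; have [u fu] := fs x.
  exists (sub_incl gS u); first by apply/Sl/(sub_typeP u).
  by move=> [u' fu' /sub_incl_inj uu']; apply: xn; rewrite -fu -uu'.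
- apply: Cs; apply: (occurs_sub (@sub_incl_inj _ _ _ _ gS)).
  have [t tP] := lift_cover fs; have [x xP] := pr_nz p.
  by exists n, t, x => tx; apply: xP; rewrite -tP tx ghom0.
Qed.

End Simple.

(** * Boundedness of essential extensions of simple modules *)

Section Central.
Variables (k : fieldType) (H : galgebra k).
Implicit Types (V : gmodule H) (a : H).

Lemma central_lin V (a : H) (ca : forall b, a * b = b * a) (b : H) (x y : V) :
  a *: (b *: x + y) = b *: (a *: x) + a *: y.
Proof. by rewrite scalerDr !scalerA ca. Qed.

Definition cmul V a (ca : forall b, a * b = b * a) : {linear V -> V} := mk_linear
  (@central_lin V a ca).

Lemma is_deg_cmul V m a (ca : forall b, a * b = b * a) : hdeg m a -> @is_deg k H V V
  m (cmul V ca).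
Proof. by move=> ha n v hv; rewrite addrC; apply: mdeg_act. Qed.

Definition cmap V m a (ca : forall b, a * b = b * a) (ha : hdeg m a) : ghom (shift m
  V) V :=
  ghom_ofl (@is_deg_cmul V m a ca ha).

Definition central_homog (a : H) := (forall b, a * b = b * a) /\ exists m, hdeg m a.

Lemma central_homog_exp a j : central_homog a -> central_homog (a ^+ j).
Proof.
move=> [ca [m ha]]; elim: j => [|j [cj [m' hj]]].
  by split=> [b|]; [rewrite mulr1 mul1r|exists 0; apply: hdeg1].
rewrite exprS; split=> [b|]; first by rewrite -mulrA cj mulrA ca mulrA.
by exists (m + m'); apply: hdegM.
Qed.

Lemma gsub_cim V a : central_homog a -> gsub (fun v : V => exists u, a *: u = v).
Proof. by move=> [ca [m ha]]; apply: (gsub_im (@cmap V m a ca ha)). Qed.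

Lemma gsub_cker V a : central_homog a -> gsub (fun v : V => a *: v = 0).
Proof.
by move=> [ca [m ha]]; apply/(gsub_shift m); apply: (gsub_ker (@cmap V m a ca ha)).
Qed.

(** The submodule z_1 V + ... + z_r V for the list [zs] of central elements. *)
Fixpoint csum V (zs : seq H) (v : V) : Prop :=
  if zs is z :: zs' then
    exists x y, [/\ exists u, z *: u = x, csum zs' y & v = x + y]
  else v = 0.

Lemma gsub_csum V (zs : seq H) : (forall z, z \in zs -> central_homog z) ->
  gsub (@csum V zs).
Proof.
elim: zs => [|z zs IH] h /=; first exact: gsub_zero.
apply: gsub_add; first by apply/gsub_cim/h; rewrite mem_head.
by apply: IH => y yz; apply: h; rewrite inE yz orbT.
Qed.

End Central.

Section Essential.
Variables (k : fieldType) (H : galgebra k) (d : Order.disp_t)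
  (Pi : finPOrderType d) (D : gmod_data H Pi).
Hypothesis (Hn : left_noetherian H) (Hs : schurian H) (Hz : property_spade H).
Variables (p : Pi) (N : fgmod H) (i : ghom (simple_mod D p) N).
Hypothesis ess : forall S : N -> Prop, gsub S ->
  (forall x, S (i x) -> x = 0) -> forall v, S v -> v = 0.

(* [z] kills the socle, so [z ^ j N] meets it trivially once the kernels of
   the powers of [z] have become stationary. *)
Hypothesis ii : injective i.

Lemma central_nilpotent (z : H) m : (forall b, z * b = b * z) -> hdeg m z -> 0 < m ->
  exists e, forall v : N, z ^+ e *: v = 0.
Proof.
move=> cz hz m0.
(* On the simple socle [z] acts with degree [m > 0], and Schur's lemma leaves only zero. *)
have zi x : z *: i x = 0.
  have [c [cP]] := schur_deg Hs (@is_deg_cmul _ _ (simple_mod D p) _ _ cz hz).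
  move=> [mE|c0]; first by rewrite mE ltxx in m0.
  have zx : z *: x = scal H c *: x := cP x.
  by rewrite -ghomZ zx c0 rmorph0 scale0r ghom0.
have ch j : central_homog (z ^+ j) by apply: central_homog_exp; split=> //; exists m.
have [_ [j _ <-]||S [e _ <-] mS] := @gsub_max _ _ Hn N
  (fun S => exists2 j : nat, True & (fun v : N => z ^+ j *: v = 0) = S).
- exact: gsub_cker.
- by exists (fun v : N => z ^+ 0 *: v = 0), 0%N.
exists e => v; apply: (ess (gsub_cim N (ch e))); last by exists v.
move=> x [u uE]; apply: (inj0 ii); rewrite -uE.
apply: (mS (fun v => z ^+ e.+1 *: v = 0)); first by exists e.+1.
  by move=> w we; rewrite exprS -scalerA we scaler0.
by rewrite exprS -scalerA uE zi.
Qed.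

(** [N] is finitely generated over [Z], so in high degrees each of its elements lies in z_1 N + ...
    + z_r N, where the z_i in [Z] have positive degree. They act nilpotently on [N] and are removed
    from the sum one at a time, at the price of a larger degree bound. *)
Lemma essential_bounded : exists M, bounded_above N M.
Proof.
have [Z [[Z1 [ZD [ZM Zh]]] [Zc [Zpos [Z0 [r [b bP]]]]]]] := Hz.
have Zscal c : Z (scal H c).
  have Z00 : Z 0 by have := ZD (-1) 1 1 Z1 Z1; rewrite rmorphN1 mulN1r addNr.
  by have := ZD c 1 0 Z1 Z00; rewrite mulr1 addr0.
have Z00 : Z 0 by have := Zscal 0; rewrite rmorph0.
have ZA x y : Z x -> Z y -> Z (x + y).
  by move=> Zx; have := ZD 1 x y Zx; rewrite rmorph1 mul1r.
have cZ : coeffs Z.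
  by split=> // c x y Zc' Zx Zy; apply: ZA => //; apply: ZM.
have ZC n z : Z z -> Z (comp (hdeg_grading H) n z) by apply: comp_homogeneous.
pose Zp z := Z z /\ exists2 m, 0 < m & hdeg m z.
have Zpc z : Zp z -> central_homog z.
  by move=> [Zz [m _ hz]]; split; [move=> c; exact: Zc|exists m].
(* The Noetherian property is applied to the left ideal of [H] generated by the homogeneous elements
   of positive degree in [Z]; each of its generators involves only finitely many of them. *)
have [zs [zsP zsI]] : exists zs : seq H, (forall z, z \in zs -> Zp z) /\
    forall z, Zp z -> @span k H (fun=> True) (regm H) zs z.
  pose I (x : regm H) := exists zs : seq (regm H),
    (forall z, z \in zs -> Zp z) /\ hspan zs x.
  have Zph (zs : seq (regm H)) : (forall z, z \in zs -> Zp z) -> homogl zs.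
    by move=> h z /h[_ [m _ hz]]; exists m.
  have gI : gsub I.
    apply: gsub_intro.
    - by exists [::].
    - move=> a x y [zs [h1 h2]] [zs' [h1' h2']]; exists (zs ++ zs'); split.
        by move=> z; rewrite mem_cat => /orP[/h1|/h1'].
      apply: span_lin => //; [move: h2|move: h2']; apply: span_sub => // z zz;
      by rewrite mem_cat zz ?orbT.
    - move=> n x [zs [h1 h2]]; exists zs; split=> //; move: h2.
      exact: gsub_hc (gsub_hspan (Zph _ h1)).
  have [l [lI lP]] := gsub_gens Hn (reg_fg H) gI.
  have [zs [h1 h2]] : exists zs : seq (regm H), (forall z, z \in zs -> Zp z) /\
      forall c, c \in l -> hspan zs c.
    elim: l lI {lP} => [|c l IH] lI; first by exists [::].
    have [|zs [h1 h2]] := IH; first by move=> e el; apply: lI; rewrite inE el orbT.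
    have [[zs' [h1' h2']] _ _] := lI c (mem_head _ _).
    exists (zs' ++ zs); split=> z.
      by rewrite mem_cat => /orP[/h1'|/h1].
    rewrite inE => /predU1P[->|/h2]; [move: h2'|]; apply: span_sub => // y yz;
    by rewrite mem_cat yz ?orbT.
  exists zs; split=> // z Zz; apply: (span_trans _ h2) => //; apply: lP.
  exists [:: (z : regm H)]; split=> [y|]; first by rewrite inE => /eqP->.
  by apply: span_mem => //; rewrite mem_head.
(* Products of the generators of [H] over [Z] with those of [N] over [H] generate [N] over [Z]. *)
have [gs [gsh gsP]] : exists gs : seq N, homogl gs /\ forall v, span Z gs v.
  have [l hl] := fg_span (fg_fg N).
  have [gs h] : exists gs : seq N, forall v, hspan l v -> span Z gs v.
    elim: l {hl} => [|c l [gs IH]]; first by exists [::].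
    exists ([seq b j *: c | j <- enum 'I_r] ++ gs) => v [a _ hv].
    rewrite -(subrK (a *: c) v) addrC; apply: spanD => //; last first.
      by apply: span_sub (IH _ hv) => // y yz; rewrite mem_cat yz ?orbT.
    apply: (@span_sub _ _ _ cZ _ [seq b j *: c | j <- enum 'I_r]).
      by move=> y yz; rewrite mem_cat yz.
    have [z [zZ ->]] := bP a.
    apply/span_map; [by []|exact: enum_uniq|exists z => //].
    by rewrite scaler_suml big_enum; apply: eq_bigr => j _; rewrite scalerA.
  have [gs' [h1 h2]] := homogeneous_gens (l := gs) cZ (gsub_full N) (fun _ _ =>
    Logic.I).
  by exists gs'; split=> [c /h1[]|v]; [|apply/h2/h/hl].
have zsum (zs' : seq H) (x : H) (g : N) : (forall z, z \in zs' -> Zp z) ->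
    @span k H (fun=> True) (regm H) zs' x -> csum zs' (x *: g).
  elim: zs' x => [|z zs' IH] x h /=; first by move=> ->; rewrite scale0r.
  move=> [a _ hx]; exists (z *: (a *: g)), ((x - a * z) *: g); split.
  - by exists (a *: g).
  - by apply: IH => // y yz; apply: h; rewrite inE yz orbT.
  - have [cz _] := Zpc z (h z (mem_head _ _)).
    by rewrite scalerA cz -scalerDl addrC subrK.
have [M hM] : exists M : int, forall n v, M <= n -> span Z gs v -> csum zs (hc N n v).
  have gzs : gsub (@csum _ _ N zs) by apply: gsub_csum => z /zsP/Zpc.
  elim: gs gsh {gsP} => [|g gs IH] gsh.
    by exists 0 => n v _ /= ->; rewrite raddf0; apply: gsub0.
  have [|M hM] := IH; first by move=> c cl; apply: gsh; rewrite inE cl orbT.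
  have [m hg] := gsh g (mem_head _ _).
  (* From degree [m + 1] on, the coefficient of [g] has positive degree [n - m] and lies in the
     ideal spanned by [zs]. *)
  exists (Num.max M (m + 1)) => n v; rewrite ge_max => /andP[Mn mn] [a Za hv].
  rewrite -(subrK (a *: g) v) raddfD /=; apply: gsubD => //; first exact: hM.
  rewrite (hc_scale _ _ hg); apply: zsum => //; apply: zsI; split; first exact: ZC.
  by exists (n - m); [lia|exact: comp_deg].
have {gs gsh gsP} hM n (v : N) : M <= n -> mdeg n v -> csum zs v.
  move=> Mn /(comp_id (mdeg_grading N)) <-; exact: hM (gsP v).
elim: zs zsP {zsI} M hM => [|z zs IH] zsP M hM.
  by exists M => n v; apply: hM.
have gzs : gsub (@csum _ _ N zs).
  by apply: gsub_csum => y yz; apply/Zpc/zsP; rewrite inE yz orbT.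
have [Zz [m m0 hz]] := zsP z (mem_head _ _).
have [e eP] := central_nilpotent (Zc z ^~ Zz) hz m0.
apply: (IH _ (M + e%:Z * m)); first by move=> y yz; apply: zsP; rewrite inE yz orbT.
(* Rewriting [y] as [z u + w] trades [m] degrees for one more power of [z]. After [e] rounds the
   power is zero and [z] has left the list. *)
suff h j n (v : N) : M + j%:Z * m <= n -> mdeg n v ->
    exists2 y, mdeg (n - j%:Z * m) y & csum zs (v - z ^+ j *: y).
  by move=> n v Mn hv; have [y _] := h e n v Mn hv; rewrite eP subr0.
elim: j n v => [|j IHj] n v Mn hv.
  exists v; first by rewrite mul0r subr0.
  by rewrite expr0 scale1r subrr; exact: (gsub0 gzs).
have jm : j.+1%:Z * m = j%:Z * m + m by rewrite -addn1 PoszD mulrDl mul1r.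
have [|y hy yP] := IHj n v _ hv; first by lia.
have [_ [w [[u <-] hw yE]]] : csum (z :: zs) y by apply: hM hy; lia.
exists (hc N (n - j.+1%:Z * m) u); first exact: comp_deg.
rewrite exprSr -scalerA -(hc_act _ _ hz).
have -> : m + (n - j.+1%:Z * m) = n - j%:Z * m by lia.
have -> : hc N (n - j%:Z * m) (z *: u) = y - hc N (n - j%:Z * m) w.
  have := comp_id (mdeg_grading N) hy; rewrite {1}yE raddfD /= => <-.
  by rewrite addrK.
rewrite scalerBr opprB addrCA; apply: (gsubD gzs _ yP).
by apply: (gsubZ _ gzs); apply: (gsub_hc _ gzs).
Qed.

End Essential.

(** * Extensions of standard by proper costandard modules *)

Lemma uniform_bound (T : finType) (B : T -> int -> Prop) :
  (forall p (M M' : int), M <= M' -> B p M -> B p M') ->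
  (forall p, exists M, B p M) -> exists M, forall p, B p M.
Proof.
move=> mono h; suff [M hM] : exists M, forall p, p \in enum T -> B p M.
  by exists M => p; apply: hM; rewrite mem_enum.
elim: (enum T) => [|p s [M hM]]; first by exists 0.
have [M' hM'] := h p; exists (Num.max M M') => q; rewrite inE => /predU1P[->|/hM].
  by apply: mono hM'; rewrite le_max lexx orbT.
by apply: mono; rewrite le_max lexx.
Qed.

Section ExtVanishing.
Variables (k : fieldType) (H : galgebra k).

(* [Ext^1(V, N) = 0], in a form that avoids pushouts. *)
Definition ext_split (V N : gmodule H) := forall (A B : fgmod H) (i : ghom A B)
  (q : ghom B V), injective i -> exact_at i q -> surj q ->
  forall f : ghom A N, exists h : ghom B N, forall a, h (i a) = f a.

Lemma ext_split_iso (V V' N : gmodule H) : iso V V' -> ext_split V N -> ext_split V' N.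
Proof.
move=> [a [b [ab ba]]] e A B i q ii iq qs f.
apply: (e A B i (ghom_comp b q)) => // [v|v].
  rewrite -iq /=; split=> [bq|->]; last by rewrite ghom0.
  by rewrite -[q v]ba bq ghom0.
by have [w wv] := qs (a v); exists w; rewrite /= wv.
Qed.

Lemma ext_split_isor (V N N' : gmodule H) : iso N N' -> ext_split V N -> ext_split V N'.
Proof.
move=> [a [b [ab ba]]] e A B i q ii iq qs f.
have [h hP] := e A B i q ii iq qs (ghom_comp b f).
by exists (ghom_comp a h) => x; rewrite /= hP /= ba.
Qed.

Lemma ext_split_shift (V N : gmodule H) n m :
  ext_split (shift (n - m) V) N -> ext_split (shift n V) (shift m N).
Proof.
move=> e A B i q ii iq qs f.
pose i' : ghom (fgshift (- m) A) (fgshift (- m) B) := ghom_shift (- m) i.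
have dq := @is_deg_shiftr _ _ B V n q.
have en : - n = - m - (n - m) by lia.
pose q' : ghom (fgshift (- m) B) (shift (n - m) V) := ghom_of dq en.
have df := @is_deg_shiftr _ _ A N m f.
pose f' : ghom (fgshift (- m) A) N := ghom_ofl df.
have [h hP] := e (fgshift (- m) A) (fgshift (- m) B) i' q' ii iq qs f'.
by exists (ghom_ofr (@is_deg_shiftl _ _ B N (- m) h) erefl).
Qed.

End ExtVanishing.

Section Costandard.
Variables (k : fieldType) (H : galgebra k) (d : Order.disp_t)
  (Pi : finPOrderType d) (D : gmod_data H Pi).
Hypothesis (aqh : affine_quasi_hereditary D) (spade : property_spade H).
Variable nabla : Pi -> fgmod H.
Hypothesis nablaP : forall p, proper_costandard D p (nabla p).

Let Hn : left_noetherian H := aqh_noetherian aqh.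
Let Hl : laurentian H := aqh_laurentian aqh.
Let Hs : schurian H := aqh_schurian aqh.

Local Notation L p := (simple_mod D p).
Local Notation P p := (proj_mod D p).
Local Notation pr p := (proj_map D p).
Local Notation De p := (Delta D p).
Local Notation dm p := (Delta_map D p).
Local Notation N p := (nabla p).

Lemma sim_shift (V W : gmodule H) n : sim (shift n V) W -> sim V W.
Proof.
move=> [m h]; exists (m - n); have := iso_shift (- n) h => h'.
have e1 : iso (shift (- n) (shift n V)) (shift 0 V).
  by apply: iso_shift_shift; rewrite addNr.
have e2 : iso (shift (- n) (shift m W)) (shift (m - n) W).
  by apply: iso_shift_shift; rewrite addrC.
apply: iso_trans (iso_sym (iso_shift0 V)) _.
exact: iso_trans (iso_sym e1) (iso_trans h' e2).
Qed.

(** A map from [P p] lifts to [P s]; if [p] is not [<= s], the lift lands in the trace, which [dm s]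
    kills. *)
Lemma occurs_Delta p s : occurs D p (De s) -> (p <= s)%O.
Proof.
move=> [n [t [x tx]]]; apply: contrapT => /negP nps; apply: tx.
have [h hP] := @projective_shift _ _ (P p) n (@proj_projective _ _ _ _ D p)
  (P s) (De s) (dm s) t (@Delta_surj _ _ _ _ D s).
rewrite -hP; apply/Delta_ker; exists [:: h x]; last by rewrite big_seq1.
move=> v; rewrite inE => /eqP ->; exists p, (h : {linear P p -> P s}), x; split=> //.
exact: is_deg_in_hom (is_deg_shiftl h).
Qed.

(** A nonzero map from [P s] to [L p] forces [s = p], so the trace lies in the radical of [P p]. *)
Lemma Delta_ker_pr p x : dm p x = 0 -> pr p x = 0.
Proof.
move=> /Delta_ker[t tP ->]; rewrite ghom_sum big_seq big1 // => v /tP.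
move=> [s [f [y [nsp [r [g [gd gE]]] ->]]]]; rewrite gE ghom_sum big1 // => n _.
apply: contrapT => gy; have ps : s = p.
  apply: (@occurs_simple _ _ _ _ D); exists n.
  by exists (ghom_comp (pr p) (GHom (gd n) : ghom (shift n (P s)) (P p))), y.
by rewrite ps lexx in nsp.
Qed.

Lemma Delta_head p : exists h : ghom (De p) (L p), forall x, h (dm p x) = pr p x.
Proof.
exact: factor_surj (@Delta_surj _ _ _ _ D p) (@Delta_ker_pr p).
Qed.

(** The working description of [N p] within finitely generated modules; the injective hull enters
    only here. For the last clause, [f] extends to the hull [I], and the extension stays in [N p]
    because the factors of its image in [I / L p] are [< p], so that maximality of [A] applies. *)
Lemma costandard_socle p : exists l : ghom (L p) (N p),
  [/\ injective l,
      forall S : N p -> Prop, gsub S -> (forall x, S (l x) -> x = 0) ->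
        forall v, S v -> v = 0,
      forall s n (t : ghom (shift n (P s)) (N p)),
        (forall x, exists y, l y = t x) \/ (s < p)%O
    & forall (A B : fgmod H) (i : ghom A B) (f : ghom A (N p)), injective i ->
        (forall s n (t : ghom (shift n (P s)) B),
           (exists x, ~ exists a, i a = t x) -> (s < p)%O) ->
        exists h : ghom B (N p), forall a, h (i a) = f a].
Proof.
have [I [Q [e [g [A [j [[Iinj ei ess] [gs eg] [gA sA] mA [ji jA]]]]]]]] := nablaP p.
have A0 : A 0 by apply: gsub0 gA.
have [x|l lP] := factor_inj (i := j) (f := e) ji.
  by apply/jA; rewrite (_ : g (e x) = 0) //; apply/eg; exists x.
have sAt s n (t : ghom (shift n (P s)) Q) :
    (exists x, t x <> 0) -> (forall x, A (t x)) -> (s < p)%O.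
  move=> nt At; have [r rp sr] := sA _ (occurs_composition_factor nt At).
  by rewrite (simple_irredundant (sim_shift sr)).
have Aj y : A (g (j y)) by apply/jA; exists y.
exists l; split.
- by move=> x y xy; apply: ei; rewrite -!lP xy.
- move=> S gS Sl v Sv; apply: (inj0 ji); apply: (ess _ (gsub_image j gS)); last by
  exists v.
  by move=> x [w Sw]; rewrite -lP => /ji wx; apply: Sl; rewrite -wx.
- move=> s n t; have [nt|/forallNP nt] := pselect (exists x, g (j (t x)) <> 0).
    by right; apply: (sAt s n (ghom_comp g (ghom_comp j t))) => // x; apply: Aj.
  left=> x; have /contrapT/eg[y yE] := nt x; exists y.
  by apply: ji; rewrite lP.
- move=> X B i f ii hB.
  have [h hP] := Iinj X B i (ghom_comp j f) ii.
  pose gh := ghom_comp g h.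
  have Agh b : A (gh b).
    apply: (mA _ (gsub_im gh)); last by exists b.
    move=> S cS.
    have [r [n [t [simS [x [_ nx]]]]]] :=
      @composition_factor_occurs _ _ _ _ D Hn B Q S gh _ (fun q h => h) cS.
    exists r => //.
    (* Such a factor comes either from the cokernel of [i], where [hB] applies, or from the smaller
       module and hence from [A]. *)
    have [ht|/existsNP nt] := pselect (forall x, exists a, i a = t x); last exact: hB
      nt.
    have [y|t' t'P] := factor_inj (f := t) ii; first exact: ht.
    apply: (sAt r n (ghom_comp gh t)); first by exists x.
    by move=> y; rewrite /= -t'P hP; apply: Aj.
  have [b|h' h'P] := factor_inj (f := h) ji; first by apply/jA/Agh.
  by exists h' => a; apply: ji; rewrite h'P hP.
Qed.

Lemma occurs_self p : occurs D p (L p).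
Proof.
exists 0; have [x xP] := pr_nz D p.
by exists (ghom_of0 (@is_deg_shiftr _ _ (shift 0 (P p)) (L p) 0 (ghom_shift 0 (pr
  p))) (oppr0 _)), x.
Qed.

Lemma occurs_costandard s p : occurs D s (N p) -> (s <= p)%O.
Proof.
have [l [li _ lt _]] := costandard_socle p.
move=> [n [t [x tx]]]; have [h|/ltW//] := lt s n t.
have [//|t' t'P] := factor_inj (f := t) li.
rewrite (@occurs_simple _ _ _ _ D s p) //.
by exists n, t', x => t'x; apply: tx; rewrite -t'P t'x ghom0.
Qed.

Lemma costandard_above : exists M, forall p, bounded_above (N p) M.
Proof.
apply: uniform_bound => [p M M' MM' h n v nM|p].
  by apply: h; apply: le_trans nM.
have [l [li ess _ _]] := costandard_socle p.
exact: (essential_bounded Hn Hs spade ess li).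
Qed.

Lemma costandard_below : exists M, forall p, bounded_below (N p) M.
Proof.
have [M hM] : exists M, forall p, bounded_below (N p) (- M).
  apply: uniform_bound => [p M M' MM' h n v nM|p].
    by apply: h; apply: lt_le_trans nM _; rewrite lerN2.
  have [M hM] := fg_bounded_below Hl (fg_fg (N p)).
  by exists (- M); rewrite opprK.
by exists (- M).
Qed.

Lemma shift_Delta_occurs p n (W : gmodule H) (f : ghom (shift n (De p)) W) :
  (exists x, f x <> 0) -> occurs D p W.
Proof.
move=> [x fx]; have [y yx] := @Delta_surj _ _ _ _ D p x.
by exists n, (ghom_comp f (ghom_shift n (dm p))), y; rewrite /= yx.
Qed.

(** If the generator of [De p] goes to the socle, comparison of simples gives [p = s]. Otherwise
    [p < s]; but the image meets the essential socle [L s], which thus occurs in [De p], so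
    [s <= p]. The properties of [l] are hypotheses in order that the conclusion concern the caller's
    embedding. *)
Lemma hom_Delta_costandard p s n (l : ghom (L s) (N s)) (f : ghom (shift n (De p)) (N
  s)) :
  injective l ->
  (forall S : N s -> Prop, gsub S -> (forall x, S (l x) -> x = 0) ->
        forall v, S v -> v = 0) ->
  (forall r m (t : ghom (shift m (P r)) (N s)),
        (forall x, exists y, l y = t x) \/ (r < s)%O) ->
  (exists x, f x <> 0) -> p = s /\ forall x, exists y, l y = f x.
Proof.
move=> li ess lt [x fx].
have [fl|ps] := lt _ _ (ghom_comp f (ghom_shift n (dm p))).
  have fl' v : exists y, l y = f v.
    by have [w <-] := @Delta_surj _ _ _ _ D p v; have [y yE] := fl w; exists y.
  split=> //; have [//|f' f'P] := factor_inj (f := f) li.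
  apply: (@occurs_simple _ _ _ _ D); apply: (@shift_Delta_occurs _ _ _ f').
  by exists x => f'x; apply: fx; rewrite -f'P f'x ghom0.
have gI := gsub_im f.
have lI y : exists v, f v = l y.
  have [_ sL] := simple_modP D s; have [h|//] := sL _ (gsub_preimage l gI).
  by case: fx; apply: (ess _ gI) => //; exists x.
have gX := gsub_preimage f (gsub_im l).
pose X : fgmod H := @fgsub _ _ Hn (fgshift n (De p)) _ gX.
have [v|a aP] := factor_inj (f := ghom_comp f (sub_incl gX)) li.
  exact: (sub_typeP v).
have as_ : surj a.
  move=> y; have [v vE] := lI y.
  have hv : exists y, l y = f v by exists y.
  by exists (sub_elt gX hv); apply: li; rewrite aP.
have /occurs_Delta sp : occurs D s (De p).
  apply: (@occurs_shift _ _ _ _ D _ n); apply: (occurs_sub (@sub_incl_inj _ _ _ _ gX)).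
  exact: (occurs_quot (V := X) as_ (occurs_self s)).
by have := le_lt_trans sp ps; rewrite ltxx.
Qed.

(** Both maps land in the socle, so after composition with [dm p] they are scalar multiples of the
    same map [pr p] followed by [l]. *)
Lemma hom_Delta_costandard_scal p n (f1 f2 : ghom (shift n (De p)) (N p)) :
  (exists x, f1 x <> 0) -> n = 0 /\ exists c, forall x, f2 x = scal H c *: f1 x.
Proof.
move=> nf1; have [l [li ess lt _]] := costandard_socle p.
have [_ l1] := hom_Delta_costandard li ess lt nf1.
have sc (f : ghom (shift n (De p)) (N p)) : (forall x, exists y, l y = f x) ->
    exists c, (forall x, f (dm p x) = scal H c *: l (pr p x)) /\ (n = 0 \/ c = 0).
  move=> lf; have [|f' f'P] := factor_inj (f := ghom_comp f (ghom_shift n (dm p))) li.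
    by move=> x; apply: lf.
  have [c [cP nc]] := proj_simple_scal Hs f'.
  by exists c; split=> // x; rewrite -ghomZ -cP f'P.
have [c1 [c1P n1]] := sc f1 l1.
have c10 : c1 != 0.
  apply/eqP => c0; have [x] := nf1; have [y <-] := @Delta_surj _ _ _ _ D p x.
  by rewrite c1P c0 rmorph0 scale0r.
split; first by case: n1 => // c0; rewrite c0 eqxx in c10.
have [/(hom_Delta_costandard li ess lt)[_ l2]|/forallNP nf2] := pselect (exists x, f2
  x <> 0).
  have [c2 [c2P _]] := sc f2 l2; exists (c2 / c1) => x.
  have [y <-] := @Delta_surj _ _ _ _ D p x.
  by rewrite c1P c2P scalerA -rmorphM divfK.
exists 0 => x; rewrite rmorph0 scale0r; exact: contrapT (nf2 x).
Qed.

Lemma exists_Delta_costandard p : exists u : ghom (De p) (N p), exists x, u x <> 0.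
Proof.
have [h hP] := Delta_head p; have [l [li _ _ _]] := costandard_socle p.
exists (ghom_comp l h); have [x xP] := pr_nz D p; exists (dm p x) => /= /(inj0 li).
by rewrite hP.
Qed.

(** Cuts off a separated filtration: deep inside it only high degrees survive, and a module that is
    bounded above does not see them. *)
Lemma bounded_zero (V W : gmodule H) M (S : V -> Prop) (f : ghom V W) : gsub S ->
  (forall (n : int) v, n < M -> S v -> mdeg n v -> v = 0) -> bounded_above W M ->
  forall v, S v -> f v = 0.
Proof.
move=> gS hS hM v Sv; apply: (comp_eq0 (G := mdeg_grading W)) => n.
rewrite hc_ghom; have hv := comp_deg (mdeg_grading V) n v.
have [nM|nM] := ltP n M; last by apply: (hM n) => //; apply: ghom_deg.
by rewrite (hS _ _ nM _ hv) ?ghom0 //; apply: gsub_hc.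
Qed.

Lemma bounded_above_shift (V : gmodule H) n M :
  bounded_above V M -> bounded_above (shift n V) (M + n).
Proof. by move=> h m v Mm; apply: h; rewrite lerBrDr. Qed.

Section Filtration.
Variables (p : Pi) (F : nat -> P p -> Prop).
Hypothesis (gF : forall i, gsub (F i)) (F0 : forall v, F 0%N v <-> dm p v = 0)
  (Fd : forall i v, F i.+1 v -> F i v) (Fs : forall v, (forall i, F i v) -> v = 0)
  (Fq : forall i, (forall v, F i v -> F i.+1 v) \/
     exists s n, (p < s)%O /\ subquotient_iso (F i) (F i.+1) (shift n (De s))).

Lemma filtration_le i j v : (i <= j)%N -> F j v -> F i v.
Proof. by move=> /subnK <-; elim: (j - i)%N => //= m IH; rewrite addSn => /Fd. Qed.

Lemma filtration_quotient i : (forall v, F i v -> F i.+1 v) \/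
  exists s n (q : ghom (fgsub Hn (gF i)) (shift n (De s))),
  [/\ (p < s)%O, surj q & forall u, q u = 0 <-> F i.+1 (sub_incl (gF i) u)].
Proof.
have [|[s [n [ps [U [j [q [ji jF qs qF]]]]]]]] := Fq i; first by left.
right; have [u|a aP] := factor_inj (f := sub_incl (gF i)) ji.
  by apply/jF/(sub_typeP u).
exists s, n, (ghom_comp q a); split=> // [v|u]; last by rewrite qF aP.
have [u uv] := qs v; have Fu : F i (j u) by apply/jF; exists u.
exists (sub_elt (gF i) Fu); rewrite /= -uv; congr (q _).
by apply: ji; rewrite aP.
Qed.

(* The subquotients below [De p] have heads [> p], which do not occur in
   [N s] unless [p < s]. *)
Lemma filtration_hom0 s m (f : ghom (fgsub Hn (gF 0)) (shift m (N s))) :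
  ~~ (p < s)%O -> forall u, f u = 0.
Proof.
move=> nps; have [M hM] := costandard_above.
have hMm := bounded_above_shift (n := m) (hM s).
(* [F i] starts only where the shifted [N s] has ended, so [f] kills it; the layers above are then
   treated from [F i] up to [F 0]. *)
have [i hi] := separated_degree Hl (fg_fg (P p)) gF Fd Fs (M + m).
suff h j : (j <= i)%N -> forall u, F j (sub_incl (gF 0) u) -> f u = 0.
  by move=> u; apply: (h 0%N) => //; apply: (sub_typeP u).
move=> /subKn <-; elim: (i - j)%N => [|r IH] u; rewrite ?subn0 => Fu.
  apply: (@bounded_zero (fgsub Hn (gF 0)) _ (M + m) (fun v => F i (sub_incl (gF 0)
    v)) f) => //.
    exact: gsub_preimage.
  move=> n v nM Fv hv; apply: sub_incl_inj; rewrite ghom0; exact: hi nM Fv hv.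
(* For [i <= r] both truncated differences are 0. *)
have [ri|ri] := leqP i r.
  by apply: IH; rewrite (eqP ri); move: Fu; rewrite (eqP (leqW ri)).
have e : (i - r = (i - r.+1).+1)%N by rewrite subnSK.
have [h|[s' [n [q [ps' qs qF]]]]] := filtration_quotient (i - r.+1).
  by apply: IH; rewrite e; apply: h.
have [w|a aP] := factor_inj (f := sub_incl (gF (i - r.+1))) (@sub_incl_inj _ _ _ _
  (gF 0)).
  have Fw : F 0 (sub_incl (gF (i - r.+1)) w).
    by apply: filtration_le (sub_typeP w).
  by exists (sub_elt (gF 0) Fw).
have [w qw|g gP] := factor_surj (f := ghom_comp f a) qs.
  by apply: IH; rewrite aP e; apply/qF.
apply: contrapT => fu; move/negP: nps; apply; apply: (lt_le_trans ps').
apply/occurs_costandard/(occurs_shift (n := m)); apply: (@shift_Delta_occurs _ n _ g).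
exists (q (sub_elt (gF _) Fu)); rewrite gP /=.
by rewrite (_ : a _ = u) //; apply: sub_incl_inj; rewrite aP.
Qed.

End Filtration.

(** If [p < s], all factors of [De p] are [< s] and the extension property of [N s] applies.
    Otherwise the map [P p -> De p] lifts to [B], and its kernel has no nonzero map to a shift of
    [N s], so [f] extends by zero on the image of [P p]. *)
Lemma ext_Delta_costandard p s n m : ext_split (shift n (De p)) (shift m (N s)).
Proof.
apply: ext_split_shift; move: (n - m) => {m}n A B i q ii iq qs f.
have [l [_ _ _ lext]] := costandard_socle s.
have [ps|nps] := boolP (p < s)%O.
  apply: lext => // r m t [x xP]; apply: le_lt_trans ps.
  apply/occurs_Delta/(occurs_shift (n := n)).
  exists m, (ghom_comp q t), x => /= /iq; exact: xP.
have [F [gF F0 Fd Fs Fq]] := aqh_filtration aqh p.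
have [t tP] := @projective_shift _ _ (P p) n (@proj_projective _ _ _ _ D p)
  B (fgshift n (De p)) q (ghom_shift n (dm p)) qs.
pose K := fgsub Hn (gF 0%N).
have [x|tK tKP] := factor_inj (i := i)
  (f := ghom_comp t (ghom_shift n (sub_incl (gF 0%N)))) ii.
  by apply/iq; rewrite tP; apply/F0; apply: (sub_typeP x).
have fK x : f (tK x) = 0.
  have dd := @is_deg_shiftl _ _ K (N s) n (ghom_comp f tK).
  exact: (@filtration_hom0 _ _ gF Fd Fs Fq s (- n) (ghom_ofr dd (esym (opprK n))) nps
    x).
(* [B] is a quotient of the sum of [A] and the shifted [P p]. The kernel consists of pairs whose
   second entry [x] lies in [F 0] and whose first is [- tK x], and [f] vanishes on these by [fK]. *)
have [|x xP|h hP] := @factor_surj _ _ _ _ _ (prod_case i t)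
  (prod_case f (ghom_zero (shift n (P p)) (N s))).
- move=> b; have [x xb] := @Delta_surj _ _ _ _ D p (q b).
  have [|a aP] := (iq (b - t x)).1; first by rewrite ghomB tP /= xb subrr.
  by exists (a, x); rewrite prod_caseE /= aP subrK.
- rewrite prod_caseE in xP; rewrite prod_caseE /= addr0.
  have Kx : F 0%N x.2.
    apply/F0; have := congr1 q xP; rewrite ghomD ghom0 tP => <-.
    by rewrite (_ : q (i x.1) = 0) ?add0r //; apply/iq; exists x.1.
  have -> : x.1 = - tK (sub_elt (gF 0%N) Kx).
    apply: ii; rewrite raddfN /= tKP /=; apply/eqP.
    by rewrite -addr_eq0; apply/eqP.
  by rewrite raddfN /= fK oppr0.
- exists h => a; rewrite -[i a]addr0 -(ghom0 t).
  by have := hP (a, 0); rewrite !prod_caseE /= addr0.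
Qed.

(** * Modules with a finite standard filtration *)

(** Short exact sequences rather than chains of submodules, since an exact functor transports them
    as they are. *)
Inductive Delta_filtered : fgmod H -> Prop :=
| Delta_filtered0 (V : fgmod H) : (forall v : V, v = 0) -> Delta_filtered V
| Delta_filteredS (U V : fgmod H) n p (f : ghom U V) (g : ghom V (shift n (De p))) :
    injective f -> exact_at f g -> surj g -> Delta_filtered U -> Delta_filtered V.

Lemma Delta_filtered_iso (V W : fgmod H) : iso V W -> Delta_filtered V ->
  Delta_filtered W.
Proof.
move=> [a [b [ab ba]]] hV; elim: hV W a b ab ba => {V} [V V0 W a b _ ba|].
  by apply: Delta_filtered0 => w; rewrite -(ba w) (V0 (b w)) ghom0.
move=> U V n p f g fi fg gs hU _ W a b ab ba.
apply: (@Delta_filteredS U W n p (ghom_comp a f) (ghom_comp g b)) => //.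
- by move=> x y /= /(can_inj ab)/fi.
- move=> w; rewrite /= fg; split=> [[u uE]|[u <-]]; exists u.
    by rewrite uE ba.
  by rewrite ab.
- by move=> v; have [w <-] := gs v; exists (a w); rewrite /= ab.
Qed.

(** The map is extended first to the preimage [B'] of [U] in [B], by induction, and then to [B],
    where the cokernel is a standard module. *)
Lemma ext_Delta_filtered (V : fgmod H) s m : Delta_filtered V -> ext_split V (shift m
  (N s)).
Proof.
elim=> {V} [V V0|U V n p f g fi fg gs _ IH] A B i q ii iq qs u.
  have [b|x ix|h hP] := factor_surj (p := i) (f := u).
  - by apply/iq; rewrite (V0 (q b)).
  - by rewrite (inj0 ii ix) ghom0.
  - by exists h.
have gB := gsub_ker (ghom_comp g q); pose B' := fgsub Hn gB.
have [a|i' i'P] := factor_inj (f := i) (@sub_incl_inj _ _ _ _ gB).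
  have ha : ghom_comp g q (i a) = 0.
    by rewrite /= (_ : q (i a) = 0) ?ghom0 //; apply/iq; exists a.
  by exists (sub_elt gB ha).
have [b|q' q'P] := factor_inj (f := ghom_comp q (sub_incl gB)) fi.
  by apply/fg; apply: (sub_typeP b).
have [| | |u' u'P] := IH A B' i' q' _ _ _ u.
- by move=> x y e; apply: ii; rewrite -!i'P e.
- move=> b; split=> [q'b|[a <-]].
    have [|a aE] := (iq (sub_incl gB b)).1.
      by have := q'P b; rewrite q'b ghom0.
    by exists a; apply: sub_incl_inj; rewrite i'P.
  apply: (inj0 fi); rewrite q'P; change (q (sub_incl gB (i' a)) = 0).
  by rewrite i'P; apply/iq; exists a.
- move=> v; have [b bE] := qs (f v).
  have gb : ghom_comp g q b = 0 by rewrite /= bE; apply/fg; exists v.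
  by exists (sub_elt gB gb); apply: fi; rewrite q'P.
have [| | |h hP] := @ext_Delta_costandard p s n m B' B (sub_incl gB) (ghom_comp g q)
  _ _ _ u'.
- exact: sub_incl_inj.
- by move=> b; rewrite -(sub_inclP gB).
- by move=> v; have [w <-] := gs v; have [b <-] := qs w; exists b.
by exists h => a; rewrite -i'P hP u'P.
Qed.

Section FiniteFiltration.
Variables (p : Pi) (F : nat -> P p -> Prop).
Hypothesis (gF : forall i, gsub (F i)) (F0 : forall v, F 0%N v <-> dm p v = 0)
  (Fd : forall i v, F i.+1 v -> F i v) (Fs : forall v, (forall i, F i v) -> v = 0)
  (Fq : forall i, (forall v, F i v -> F i.+1 v) \/
     exists s n, (p < s)%O /\ subquotient_iso (F i) (F i.+1) (shift n (De s))).

(** Climbs from [F i] to [P p] one layer at a time. Each layer is standard or trivial, so Ext^1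
    gives no obstruction. *)
Lemma filtration_extend s m i (f : ghom (fgsub Hn (gF i)) (shift m (N s))) :
  exists h : ghom (P p) (shift m (N s)), forall u, h (sub_incl (gF i) u) = f u.
Proof.
elim: i f => [|i IH] f.
  have e := ext_split_iso (iso_shift0 (De p)) (@ext_Delta_costandard p s 0 m).
  apply: (e (fgsub Hn (gF 0%N)) (P p) (sub_incl (gF 0%N)) (dm p)); [exact:
    sub_incl_inj| |exact: Delta_surj].
  by move=> v; rewrite -F0 (sub_inclP (gF 0)).
have [u|j jP] := factor_inj (f := sub_incl (gF i.+1)) (@sub_incl_inj _ _ _ _ (gF i)).
  by exists (sub_elt (gF i) (Fd (sub_typeP u))).
suff [f' f'P] : exists f' : ghom (fgsub Hn (gF i)) (shift m (N s)),
    forall u, f' (j u) = f u.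
  by have [h hP] := IH f'; exists h => u; rewrite -jP hP.
have [h|[s' [n [q [_ qs qF]]]]] := filtration_quotient gF Fq i.
  have [u|j' j'P] := factor_inj (f := sub_incl (gF i)) (@sub_incl_inj _ _ _ _ (gF
    i.+1)).
    by exists (sub_elt (gF i.+1) (h _ (sub_typeP u))).
  exists (ghom_comp f j') => u; congr (f _).
  by apply: sub_incl_inj; rewrite j'P jP.
have ji : injective j.
  by move=> x y e; apply: sub_incl_inj; rewrite -!jP e.
apply: (@ext_Delta_costandard s' s n m (fgsub Hn (gF i.+1)) (fgsub Hn (gF i)) j q ji
  _ qs) => u.
rewrite qF (sub_inclP (gF i.+1)).
by split=> [[v vu]|[v <-]]; exists v; [apply: sub_incl_inj|]; rewrite jP.
Qed.

(* A subquotient [q^n Delta(s)] of [F i] gives a nonzero map to [q^n N(s)] that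
   extends to [P p]; its degrees bound [n] above through the generators of
   [P p] and below through [F i]. *)
Lemma filtration_finite : exists i, forall v, F i v -> v = 0.
Proof.
have [M hM] := costandard_above; have [lo hlo] := costandard_below.
have [l0 hl0] := fg_span (fg_fg (P p)).
have [l [lh lP]] := homogeneous_gens (coeffs_all H) (l := l0) (gsub_full (P p))
  (fun _ _ => Logic.I).
have [b0 hb0] : exists b0 : int, forall b, b \in l -> forall n, mdeg n b -> n <= b0.
  have : forall b, b \in l -> b <> 0 /\ exists n, mdeg n b by move=> b /lh[].
  elim: l {lh lP} => [|b l IH] lh; first by exists 0.
  have [|b0 hb0] := IH; first by move=> c cl; apply: lh; rewrite inE cl orbT.
  have [bn [m hb]] := lh b (mem_head _ _).
  exists (Num.max b0 m) => c; rewrite inE => /predU1P[->|/hb0 h n /h]; last first.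
    by rewrite le_max => ->.
  move=> n hn; rewrite le_max; have [->|nm] := eqVneq n m; first by rewrite lexx orbT.
  case: bn; rewrite -(comp_id (mdeg_grading (P p)) hb).
  by rewrite (comp_ne _ hn) // eq_sym.
(* If [n <= b0 - lo], then [q^n N(s)] ends before degree [b0 + M - lo + 1], below which [F i] is
   zero. If [n > b0 - lo], generators of [P p], of degree at most [b0], are sent below the first
   degree of [q^n N(s)]. *)
have [i0 hi0] := separated_degree Hl (fg_fg (P p)) gF Fd Fs (b0 + M - lo + 1).
have stab i : (i0 <= i)%N -> forall v, F i v -> F i.+1 v.
  move=> i0i; have [//|[s [n [q [_ qs qF]]]]] := filtration_quotient gF Fq i.
  have [h hP] := Delta_head s; have [e [ei _ _ _]] := costandard_socle s.
  pose w := ghom_comp (ghom_shift n e) (ghom_comp (ghom_shift n h) q).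
  have [g gP] := filtration_extend w.
  have [u wu] : exists u, w u <> 0.
    have [x xP] := pr_nz D s; have [u uE] := qs (dm s x).
    by exists u; rewrite /= uE => /(inj0 ei); rewrite hP.
  exfalso; apply: wu; have [nlo|nlo] := lerP n (b0 - lo).
    have hMn := bounded_above_shift (n := n) (hM s).
    apply: (@bounded_zero (fgsub Hn (gF i)) _ _ (fun=> True) w _ _ hMn) => //.
      exact: gsub_full.
    move=> m v mM _ hv.
    apply: sub_incl_inj; rewrite ghom0; apply: (hi0 m) => //; first by lia.
    by apply: filtration_le i0i _ => //; apply: (sub_typeP v).
  rewrite -gP; apply: (span_gsub (gsub_ker g) _ (lP _ (hl0 _))) => b bl.
  have [_ _ [m hb]] := lh b bl.
  apply: (hlo s (m - n)); last exact: (ghom_deg g hb).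
  by have := hb0 b bl m hb; lia.
exists i0 => v Fv; apply: Fs => i.
have [ii|/ltnW ii] := leqP i i0; first exact: filtration_le ii Fv.
by rewrite -(subnK ii); elim: (i - i0)%N => //= j; rewrite addSn; apply: stab;
  rewrite leq_addl.
Qed.

Lemma Delta_filtered_chain : Delta_filtered (P p).
Proof.
have [i0 hi0] := filtration_finite.
have h i : Delta_filtered (fgsub Hn (gF (i0 - i))).
  elim: i => [|i IH].
    apply: Delta_filtered0 => u; apply: sub_incl_inj; rewrite ghom0.
    by apply: hi0; rewrite -[in F _](subn0 i0); apply: (sub_typeP u).
  have [ii|ii] := leqP i0 i.
    by move: IH; rewrite /fgsub (eqP ii) (eqP (leqW ii)).
  move: IH; rewrite -(subnSK ii); move: (i0 - i.+1)%N => j IH.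
  have [u|a aP] := factor_inj (f := sub_incl (gF j.+1)) (@sub_incl_inj _ _ _ _ (gF j)).
    by exists (sub_elt (gF j) (Fd (sub_typeP u))).
  have ai : injective a by move=> x y e; apply: sub_incl_inj; rewrite -!aP e.
  have aE u : F j.+1 (sub_incl (gF j) u) <-> exists v, a v = u.
    split=> [Fu|[v <-]]; last by rewrite aP; apply: (sub_typeP v).
    by exists (sub_elt (gF j.+1) Fu); apply: sub_incl_inj; rewrite aP.
  have [h|[s [n [q [_ qs qF]]]]] := filtration_quotient gF Fq j.
    apply: Delta_filtered_iso IH; exists a; apply: bij_iso => // u.
    by apply/aE/h/(sub_typeP u).
  by apply: (@Delta_filteredS (fgsub Hn (gF j.+1)) (fgsub Hn (gF j)) n s a q) => //
    u; rewrite qF aE.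
have := h i0; rewrite subnn => h0.
have dd := is_deg_ghom (dm p).
apply: (@Delta_filteredS (fgsub Hn (gF 0)) (P p) 0 p (sub_incl (gF 0)) (ghom_ofr dd
  (esym (oppr0 _)))) h0.
- exact: sub_incl_inj.
- by move=> v; rewrite -(sub_inclP (gF 0)) F0.
- exact: Delta_surj.
Qed.

End FiniteFiltration.

Lemma Delta_filtered_proj p : Delta_filtered (P p).
Proof.
by have [F [gF F0 Fd Fs Fq]] := aqh_filtration aqh p; apply: Delta_filtered_chain Fq.
Qed.

End Costandard.

(** * Exact functors *)

Section Functor.
Variables (k : fieldType) (H1 H2 : galgebra k).
Hypothesis (Hn1 : left_noetherian H1).
Variable Phi : gfunctor H1 H2.
Implicit Types U V W X Y : fgmod H1.

Lemma fmap_idE V (x : Phi V) : fmap Phi (ghom_id V) x = x.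
Proof. exact: fmap_id. Qed.

Lemma fmap_compE U V W (g : ghom V W) (f : ghom U V) x :
  fmap Phi (ghom_comp g f) x = fmap Phi g (fmap Phi f x).
Proof. exact: fmap_comp. Qed.

Lemma fmap_can U V (f : ghom U V) (g : ghom V U) :
  cancel f g -> cancel (fmap Phi f) (fmap Phi g).
Proof. by move=> fg x; rewrite -fmap_compE -[RHS]fmap_idE; apply: fmap_ext. Qed.

Lemma fmap_lin U V c (f g : ghom U V) x :
  fmap Phi (ghom_lin c f g) x = scal H2 c *: fmap Phi f x + fmap Phi g x.
Proof. exact: fmap_linear. Qed.

Lemma fmap0 U V (f : ghom U V) : (forall v, f v = 0) ->
  forall x, fmap Phi f x = 0.
Proof.
move=> f0 x; have ff v : f v = scal H1 1 *: f v + f v.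
  by rewrite f0 scaler0 addr0.
have := @fmap_linear _ _ _ Phi U V 1 f f f ff x.
by rewrite (rmorph1 (scal H2)) scale1r -{1}[fmap Phi f x]add0r => /addIr.
Qed.

Lemma fmap_is_iso U V (f : ghom U V) : is_iso f -> is_iso (fmap Phi f).
Proof.
by move=> [g [fg gf]]; exists (fmap Phi g); split; apply: fmap_can.
Qed.

Lemma fobj_iso U V : iso U V -> iso (Phi U) (Phi V).
Proof. by move=> [f /fmap_is_iso h]; exists (fmap Phi f). Qed.

Lemma fobj0 V : (forall v : V, v = 0) -> forall x : Phi V, x = 0.
Proof. by move=> V0 x; rewrite -[x]fmap_idE; apply: fmap0 => v. Qed.

Hypothesis Phi_exact : exact_functor Phi.

Lemma fmap_inj U V (f : ghom U V) : injective f -> injective (fmap Phi f).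
Proof.
move=> fi; pose Q := fgquot (gsub_im f).
have [|h _ _] := @Phi_exact U V Q f (quot_map (gsub_im f)); last exact: h.
split=> // [v|]; first exact: quot_map0.
exact: quot_map_surj.
Qed.

Lemma fmap_surj U V (f : ghom U V) : surj f -> surj (fmap Phi f).
Proof.
move=> fs; pose K := fgsub Hn1 (gsub_ker f).
have [|_ _ h] := @Phi_exact K U V (sub_incl (gsub_ker f)) f; last exact: h.
split=> // [|v]; first exact: sub_incl_inj.
exact: sub_inclP.
Qed.

Lemma fmap_exact U V W (f : ghom U V) (g : ghom V W) :
  injective f -> exact_at f g -> surj g -> exact_at (fmap Phi f) (fmap Phi g).
Proof. by move=> fi fg gs; have [] := @Phi_exact U V W f g (And3 fi fg gs). Qed.

Section Faithful.
Hypothesis Phi_conservative : forall V, (forall x : Phi V, x = 0) ->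
  forall v : V, v = 0.

(** [Phi] of the image of [f] is a quotient of [Phi U] inside [Phi V], so it vanishes with
    [fmap Phi f]; then the image itself is zero. *)
Lemma fmap_faithful U V (f : ghom U V) : (forall x, fmap Phi f x = 0) ->
  forall v, f v = 0.
Proof.
move=> f0; have gI := gsub_im f; pose I := fgsub Hn1 gI.
have [u|e eP] := factor_inj (f := f) (@sub_incl_inj _ _ _ _ gI).
  by apply/(sub_inclP gI); exists u.
have es : surj (e : ghom U I).
  move=> w; have [u uw] := sub_typeP w; exists u.
  by apply: sub_incl_inj; rewrite eP.
have I0 : forall w : I, w = 0.
  apply: Phi_conservative => y; have [x <-] := fmap_surj es y.
  apply: (inj0 (@fmap_inj I V (sub_incl gI) (@sub_incl_inj _ _ _ _ gI))).
  rewrite -fmap_compE -[RHS](f0 x); apply: fmap_ext => u; exact: eP.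
by move=> v; rewrite -eP (I0 (e v)) ghom0.
Qed.

Lemma fmap_faithful2 U V (f g : ghom U V) :
  (forall x, fmap Phi f x = fmap Phi g x) -> forall v, f v = g v.
Proof.
move=> fg v; apply/eqP; rewrite -subr_eq0 addrC; apply/eqP.
have := @fmap_faithful _ _ (ghom_lin (-1) g f) _ v.
rewrite /= rmorphN1 scaleN1r; apply=> x.
by rewrite fmap_lin fg rmorphN1 scaleN1r addNr.
Qed.

End Faithful.

(** ** Fullness *)

Definition full_on U V := forall g : ghom (Phi U) (Phi V),
  exists f : ghom U V, forall x, g x = fmap Phi f x.

Lemma full_on_iso U U' V V' : iso U U' -> iso V V' -> full_on U V -> full_on U' V'.
Proof.
move=> [a [b [ab ba]]] [c [d [cd dc]]] h g.
have [f fP] := h (ghom_comp (fmap Phi d) (ghom_comp g (fmap Phi a))).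
exists (ghom_comp c (ghom_comp f b)) => x; rewrite !fmap_compE -fP /=.
by rewrite (fmap_can dc) (fmap_can ba).
Qed.

Lemma full_on_zero U V : (forall v : V, v = 0) -> full_on U V.
Proof.
move=> V0 g; exists (ghom_zero U V) => x.
by rewrite (fmap0 (f := ghom_zero U V)) // (fobj0 V0 (g x)).
Qed.

(** The part of the map seen in [V''] is lifted in the source, where [U] is projective. The
    difference from [u] then factors through [Phi V']. *)
Lemma full_on_ext U V' V V'' (f : ghom V' V) (g : ghom V V'') :
  projective U -> injective f -> exact_at f g -> surj g ->
  full_on U V' -> full_on U V'' -> full_on U V.
Proof.
move=> pU fi fg gs h' h'' u.
have [t'' t''P] := h'' (ghom_comp (fmap Phi g) u).
have [t tP] := pU _ _ g t'' gs.
have [|v vP] := factor_inj (f := ghom_lin (-1) (fmap Phi t) u) (fmap_inj fi).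
  move=> x; apply/(fmap_exact fi fg gs).
  rewrite /= rmorphN1 scaleN1r ghomD raddfN /= -fmap_compE.
  rewrite (fmap_ext (g := t'')) -?t''P ?addNr //.
have [t' t'P] := h' v; exists (ghom_lin 1 (ghom_comp f t') t) => x.
rewrite fmap_lin fmap_compE -t'P vP /= rmorph1 rmorphN1 scale1r scaleN1r.
by rewrite addrC addrA subrr add0r.
Qed.

Lemma fprod_eta X Y (y : Phi (fgprod X Y)) :
  y = fmap Phi (prod_inl X Y : ghom X (fgprod X Y))
        (fmap Phi (prod_fst X Y : ghom (fgprod X Y) X) y) +
      fmap Phi (prod_inr X Y : ghom Y (fgprod X Y))
        (fmap Phi (prod_snd X Y : ghom (fgprod X Y) Y) y).
Proof.
rewrite -!fmap_compE -[LHS]fmap_idE.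
rewrite -[X in _ = X + _]scale1r -(rmorph1 (scal H2)).
apply: fmap_linear => v; rewrite rmorph1 scale1r; exact: prod_eta.
Qed.

Lemma full_on_prod U U' V : full_on U V -> full_on U' V -> full_on (fgprod U U') V.
Proof.
move=> h h' g.
have [f fP] := h (ghom_comp g (fmap Phi (prod_inl U U' : ghom U (fgprod U U')))).
have [f' f'P] := h' (ghom_comp g (fmap Phi (prod_inr U U' : ghom U' (fgprod U U')))).
exists (prod_case f f') => y; rewrite {1}[y]fprod_eta ghomD fmap_lin.
by rewrite rmorph1 scale1r !fmap_compE -fP -f'P.
Qed.

Hypothesis Phi_graded : graded_functor Phi.

Lemma full_on_shift1 U V : full_on U V -> full_on (fgshift 1 U) (fgshift 1 V).
Proof.
have [eta etai nat] := Phi_graded.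
have [a [ea ae]] := etai U; have [b [eb be]] := etai V.
move=> h g; pose g1 := ghom_comp (eta V) (ghom_comp g a).
have [f fP] := h (ghom_of0 (@is_deg_shift _ _ (Phi U) (Phi V) 1 1 g1) (subrr 1)).
exists (ghom_shift 1 f) => x; apply: (can_inj eb).
have := nat _ _ f x; rewrite /= => ->; rewrite -[RHS]fP /=.
by congr (eta V (g _)); rewrite ea.
Qed.

Lemma full_on_unshift1 U V : full_on (fgshift 1 U) (fgshift 1 V) -> full_on U V.
Proof.
have [eta etai nat] := Phi_graded.
have [a [ea ae]] := etai U; have [b [eb be]] := etai V.
move=> h g; have [f fP] := h (ghom_comp b (ghom_comp (ghom_shift 1 g) (eta U))).
pose f0 : ghom U V := ghom_of0 (@is_deg_shift _ _ U V 1 1 f) (subrr 1).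
exists f0 => x.
have e := fP (a x); rewrite /= ae in e.
have e' := congr1 (eta V) e; rewrite be /= in e'; rewrite e'.
have := nat _ _ f0 (a x); rewrite /= ae => <-.
by congr (eta V _); apply: (@fmap_ext _ _ _ Phi (fgshift 1 U) (fgshift 1 V) f
  (ghom_shift 1 f0)).
Qed.

Lemma full_on_shift n U V : full_on U V -> full_on (fgshift n U) (fgshift n V).
Proof.
move=> h; have [j [->|->]] : exists j : nat, n = j%:Z \/ n = - j%:Z.
  by exists `|n|%N; have [?|?] := leP 0 n; [left|right]; lia.
- elim: j => [|j IH].
    by apply: full_on_iso h; apply: iso_sym; apply: iso_shift0.
  by apply: full_on_iso (full_on_shift1 IH); apply: iso_shift_shift; lia.
- elim: j => [|j IH].
    by apply: full_on_iso h; apply: iso_sym; rewrite oppr0; apply: iso_shift0.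
  apply: full_on_unshift1; apply: full_on_iso IH; apply: iso_sym;
  by apply: iso_shift_shift; lia.
Qed.

(** Commutation with [q] is the case [n = 1]. Positive shifts iterate it, and a negative shift is
    recovered by shifting back. *)
Lemma fobj_shift n V : iso (Phi (fgshift n V)) (shift n (Phi V)).
Proof.
have pos (j : nat) W : iso (Phi (fgshift j%:Z W)) (shift j%:Z (Phi W)).
  have [eta etai _] := Phi_graded.
  elim: j => [|j IH].
    apply: iso_trans (iso_sym (iso_shift0 _)).
    exact: (@fobj_iso (fgshift 0 W) W (iso_shift0 W)).
  apply: iso_trans (_ : iso _ (Phi (fgshift 1 (fgshift j%:Z W)))) _.
    apply: (@fobj_iso (fgshift j.+1%:Z W) (fgshift 1 (fgshift j%:Z W))).
    by apply: iso_sym; apply: iso_shift_shift; lia.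
  apply: iso_trans (_ : iso _ (shift 1 (Phi (fgshift j%:Z W)))) _.
    by exists (eta (fgshift j%:Z W)); exact: etai.
  by apply: iso_trans (iso_shift 1 IH) _; apply: iso_shift_shift; lia.
have [j [->|->]] : exists j : nat, n = j%:Z \/ n = - j%:Z.
  by exists `|n|%N; have [?|?] := leP 0 n; [left|right]; lia.
  exact: pos.
have h : iso (Phi V) (shift j%:Z (Phi (fgshift (- j%:Z) V))).
  apply: iso_trans (pos j _).
  apply: (@fobj_iso V (fgshift j%:Z (fgshift (- j%:Z) V))); apply: iso_sym.
  by apply: iso_trans (iso_shift0 V); apply: iso_shift_shift; lia.
apply: iso_sym; apply: iso_trans (iso_shift (- j%:Z) h) _.
by apply: iso_trans (iso_shift0 _); apply: iso_shift_shift; lia.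
Qed.

Lemma full_on_shiftl n U V : full_on U (fgshift (- n) V) -> full_on (fgshift n U) V.
Proof.
move=> h; apply: full_on_iso (iso_refl _) _ (@full_on_shift n _ _ h).
by apply: iso_trans (iso_shift0 V); apply: iso_shift_shift; rewrite subrr.
Qed.

End Functor.

(** * Covers by a class of modules *)

Section Cover.
Variables (k : fieldType) (H : galgebra k) (V : fgmod H).
Variable T : forall X : fgmod H, ghom X V -> Prop.
Hypothesis T0 : exists (X : fgmod H) (f : ghom X V), T f.
Hypothesis TU : forall (X X' : fgmod H) (f : ghom X V) (f' : ghom X' V), T f -> T f' ->
  exists (X'' : fgmod H) (f'' : ghom X'' V), T f'' /\
    forall x x', exists x'', f'' x'' = f x + f' x'.

(** [T] singles out admissible maps into [V]; by [TU] finitely many of them combine into one that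
    reaches all generators. *)
Lemma cover_gens (l : seq V) : (forall v, hspan l v) ->
  (forall b, b \in l -> exists (X : fgmod H) (f : ghom X V) x, T f /\ f x = b) ->
  exists (X : fgmod H) (f : ghom X V), T f /\ surj f.
Proof.
move=> hl lT; suff [X [f [Tf fl]]] : exists (X : fgmod H) (f : ghom X V), T f /\
    forall b, b \in l -> exists x, f x = b.
  exists X, f; split=> // v; exact: span_gsub (gsub_im f) fl (hl v).
elim: l {hl} lT => [|b l IH] lT.
  by have [X [f Tf]] := T0; exists X, f.
have [|X [f [Tf fl]]] := IH; first by move=> c cl; apply: lT; rewrite inE cl orbT.
have [Y [g [y [Tg gy]]]] := lT b (mem_head _ _).
have [Z [h [Th hP]]] := TU Tf Tg; exists Z, h; split=> // c.
rewrite inE => /predU1P[->|/fl[x xc]].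
  by have [z zE] := hP 0 y; exists z; rewrite zE ghom0 add0r.
by have [z zE] := hP x 0; exists z; rewrite zE ghom0 addr0.
Qed.

(** The elements reached by admissible maps form a submodule. If it were proper, a simple quotient
    of [V] would kill it, against the hypothesis. *)
Lemma cover_simple (d : Order.disp_t) (Pi : finPOrderType d) (D : gmod_data H Pi) :
  left_noetherian H ->
  (forall p n (f : ghom V (shift n (simple_mod D p))), surj f ->
     exists (X : fgmod H) (t : ghom X V), T t /\ exists x, f (t x) <> 0) ->
  exists (X : fgmod H) (f : ghom X V), T f /\ surj f.
Proof.
move=> Hn h; pose S v := exists (X : fgmod H) (f : ghom X V) x, T f /\ f x = v.
have gS : gsub S.
  apply: gsub_intro.
  - by have [X [f Tf]] := T0; exists X, f, 0; rewrite ghom0.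
  - move=> a _ _ [X [f [x [Tf <-]]]] [Y [g [y [Tg <-]]]].
    have [Z [e [Te eP]]] := TU Tf Tg; have [z zE] := eP (a *: x) y.
    by exists Z, e, z; rewrite zE ghomZ.
  - by move=> n _ [X [f [x [Tf <-]]]]; exists X, f, (hc X n x); rewrite hc_ghom.
have [allS|/existsNP nS] := pselect (forall v, S v).
  have [l hl] := fg_span (fg_fg V).
  by apply: (cover_gens hl) => b _; apply: allS.
have [p [n [f [fs fS]]]] := simple_quotient D Hn gS nS.
have [X [t [Tt [x fx]]]] := h p n f fs.
by case: fx; apply: fS; exists X, t, x.
Qed.

End Cover.

(** * Lower degree bounds under the functor *)

Section BoundedBelow.
Variables (k : fieldType) (H1 H2 : galgebra k).
Hypothesis (Hn1 : left_noetherian H1) (Hl2 : laurentian H2).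
Variable Phi : gfunctor H1 H2.
Hypothesis (Phi_exact : exact_functor Phi) (Phi_graded : graded_functor Phi).

Lemma iso_bounded_below (V W : gmodule H2) n :
  iso V W -> bounded_below V n -> bounded_below W n.
Proof.
move=> [f [g [fg gf]]] h m w mn hw; rewrite -(gf w).
by rewrite (h m (g w) mn) ?ghom0 //; apply: ghom_deg.
Qed.

(* A module generated in degrees [>= m] is a quotient of a finite sum of
   modules [q^n H1] with [n >= m]. *)
Lemma fobj_bounded_below : exists c, forall (V : fgmod H1) m,
  bounded_below V m -> bounded_below (Phi V) (m + c).
Proof.
(* The constant is a lower degree bound of the image of the regular module. *)
have [c hc'] := fg_bounded_below Hl2 (fg_fg (Phi (fgreg H1))).
exists c => V m Vm; pose T (X : fgmod H1) (f : ghom X V) := bounded_below (Phi X) (m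
  + c).
have [l0 hl0] := fg_span (fg_fg V).
have [l [lh lP]] := homogeneous_gens (coeffs_all H1) (l := l0) (gsub_full V)
  (fun _ _ => Logic.I).
have [||||X [f [Xm fs]]] := @cover_gens _ _ V T _ _ l.
- exists (fgsub Hn1 (gsub_zero V)), (sub_incl _) => n y _ _.
  apply: fobj0 y => z; apply: sub_incl_inj; rewrite ghom0; exact: (sub_typeP z).
- move=> X X' f f' TX TX'; exists (fgprod X X'), (prod_case f f'); split.
    move=> n y nm hy; rewrite [y]fprod_eta.
    have -> := TX n _ nm (ghom_deg (fmap Phi (prod_fst X X' : ghom (fgprod X X') X))
      hy).
    have -> := TX' n _ nm (ghom_deg (fmap Phi (prod_snd X X' : ghom (fgprod X X')
      X')) hy).
    by rewrite !ghom0 addr0.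
  by move=> x x'; exists (x, x'); rewrite prod_caseE.
- by move=> v; apply/lP/hl0.
- move=> b /lh[_ b0 [n hb]].
  exists (fgshift n (fgreg H1)), (reg_map hb), (1 : H1); split; last exact: reg_map1.
  apply: (iso_bounded_below (iso_sym (fobj_shift Phi_graded n (fgreg H1)))).
  have nm : m <= n by rewrite leNgt; apply/negP => nm; apply: b0; apply: Vm hb.
  by move=> i y im; apply: hc'; lia.
move=> n y nm hy; have [x hx <-] := surj_mdeg (fmap_surj Hn1 Phi_exact fs) hy.
by rewrite (Xm n x nm hx) ghom0.
Qed.

End BoundedBelow.

(** * Full faithfulness and essential surjectivity *)

Lemma quotient_bounded_above (k : fieldType) (H : galgebra k) (V W : gmodule H)
    (f : ghom V W) M : surj f -> bounded_above V M -> bounded_above W M.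
Proof.
move=> fs hM n w nM hw; have [v hv <-] := surj_mdeg fs hw.
by rewrite (hM n v nM hv) ghom0.
Qed.

Lemma iso_occurs (k : fieldType) (H : galgebra k) (d : Order.disp_t)
    (Pi : finPOrderType d) (D : gmod_data H Pi) p (V W : gmodule H) :
  iso V W -> occurs D p V -> occurs D p W.
Proof. by move=> [f /iso_inj]; apply: occurs_sub. Qed.

Section Equivalence.
Variables (k : fieldType) (H1 H2 : galgebra k) (d1 d2 : Order.disp_t)
  (Pi1 : finPOrderType d1) (Pi2 : finPOrderType d2)
  (D1 : gmod_data H1 Pi1) (D2 : gmod_data H2 Pi2).
Hypothesis (aqh1 : affine_quasi_hereditary D1) (aqh2 : affine_quasi_hereditary D2)
  (spade1 : property_spade H1) (spade2 : property_spade H2).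
Variables (nabla1 : Pi1 -> fgmod H1) (nabla2 : Pi2 -> fgmod H2).
Hypothesis (nabla1P : forall p, proper_costandard D1 p (nabla1 p))
  (nabla2P : forall p, proper_costandard D2 p (nabla2 p)).
Variable Phi : gfunctor H1 H2.
Hypothesis (Phi_graded : graded_functor Phi) (Phi_exact : exact_functor Phi).
Variable phi : Pi1 -> Pi2.
Hypothesis (phi_bij : bijective phi)
  (phi_homo : forall p s, (p <= s)%O -> (phi p <= phi s)%O)
  (Phi_Delta : forall p, iso (Phi (Delta D1 p)) (Delta D2 (phi p)))
  (Phi_nabla : forall p, iso (Phi (nabla1 p)) (nabla2 (phi p))).

Let Hn1 : left_noetherian H1 := aqh_noetherian aqh1.
Let Hn2 : left_noetherian H2 := aqh_noetherian aqh2.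
Let Hl1 : laurentian H1 := aqh_laurentian aqh1.
Let Hl2 : laurentian H2 := aqh_laurentian aqh2.

Local Notation L1 p := (simple_mod D1 p).
Local Notation L2 p := (simple_mod D2 p).
Local Notation P1 p := (proj_mod D1 p).
Local Notation P2 p := (proj_mod D2 p).
Local Notation N1 p := (nabla1 p).
Local Notation N2 p := (nabla2 p).
Local Notation De1 p := (Delta D1 p).
Local Notation De2 p := (Delta D2 p).
Local Notation pr1 p := (proj_map D1 p).
Local Notation pr2 p := (proj_map D2 p).

(* [Phi L1(s)] embeds in [N2(phi s)], so for [s < p] it has no factor
   [L2(phi p)], while [N2(phi p)] has one. *)
Lemma simple_image_nonzero p : exists x : Phi (L1 p), x <> 0.
Proof.
apply: contrapT => /forallNP L0.
have [l [li _ lt _]] := costandard_socle aqh1 nabla1P p.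
have gI := gsub_im l; pose C := fgquot gI; pose c : ghom (N1 p) C := quot_map gI.
have cs : surj c by apply: quot_map_surj.
have lc : exact_at l c by move=> v; apply: quot_map0.
(* If [Phi (L1 p)] were zero, [Phi] of [N1 p] would embed in [Phi C], so [L2 (phi p)] would occur
   there. *)
have Ci : injective (fmap Phi c).
  apply: ghom_inj => y /(fmap_exact Phi_exact li lc cs)[x <-].
  by rewrite (contrapT (L0 x)) ghom0.
have oC : occurs D2 (phi p) (Phi C).
  apply: (occurs_sub Ci); apply: (iso_occurs (iso_sym (Phi_nabla p))).
  have [l2 [l2i _ _ _]] := costandard_socle aqh2 nabla2P (phi p).
  exact: occurs_sub l2i (occurs_self D2 (phi p)).
have [M hM] := costandard_above aqh1 spade1 nabla1P.
have [b hb] := bounded_fin Hl1 (fg_fg C) (quotient_bounded_above cs (hM p)).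
move: oC; apply: (@devissage _ _ _ _ D1 Hn1
  (fun V => ~ occurs D2 (phi p) (Phi V)) _ _ C b hb).
- by move=> V V0 [n [t [x tx]]]; apply: tx; apply: fobj0.
- move=> U V W f g [fi fg gs] hU hW.
  by move/(occurs_ext (fmap_inj Phi_exact fi) (fmap_exact Phi_exact fi fg gs)) => [].
(* A nonzero map from [P1 s] to [C] lifts to [N1 p], and the lift cannot land in the socle, which
   dies in [C]. *)
- move=> s n oCs; have sp : (s < p)%O.
    have [m [t [x tx]]] := oCs.
    have [t' t'P] := @projective_shift _ _ (P1 s) m (@proj_projective _ _ _ _ D1 s)
      (N1 p) C c t cs.
    have [h|//] := lt s m t'; case: tx; rewrite -t'P.
    exact/quot_map0/h.
  move/(iso_occurs (fobj_shift Phi_graded n (L1 s)))/occurs_shift.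
  have [l' [l'i _ _ _]] := costandard_socle aqh1 nabla1P s.
  move/(occurs_sub (fmap_inj Phi_exact l'i))/(iso_occurs (Phi_nabla s)).
  move/(occurs_costandard aqh2 nabla2P) => ps.
  have e : phi s = phi p by apply: le_anti; rewrite ps phi_homo // ltW.
  by move: sp; rewrite (bij_inj phi_bij e) ltxx.
Qed.

(** The composite of [Phi Delta -> Phi L -> Phi N] is nonzero, so it lands in the socle
    [L2 (phi p)]. Thus [Phi L] embeds in a simple module, with nonzero image. *)
Lemma simple_image p : iso (Phi (L1 p)) (L2 (phi p)).
Proof.
have [h hP] := Delta_head D1 p.
have hs : surj h.
  by move=> v; have [x <-] := @pr_surj _ _ _ _ D1 p v; exists (Delta_map D1 p x).
have [l [li _ _ _]] := costandard_socle aqh1 nabla1P p.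
have [l2 [l2i ess2 lt2 _]] := costandard_socle aqh2 nabla2P (phi p).
have [a [a' [aa' a'a]]] := iso_trans (Phi_Delta p) (iso_sym (iso_shift0 (De2 (phi p)))).
have [b bi] := Phi_nabla p; have bii := iso_inj bi.
pose f := ghom_comp b (ghom_comp (fmap Phi l) (ghom_comp (fmap Phi h) a')).
have lsurj v : exists y, f y = b (fmap Phi l v).
  have [w <-] := fmap_surj Hn1 Phi_exact hs v.
  by exists (a w); rewrite /= aa'.
have [x0 x0n] := simple_image_nonzero p.
have nf : exists y, f y <> 0.
  have [y yE] := lsurj x0; exists y; rewrite yE => /(inj0 bii)/(inj0 (fmap_inj
    Phi_exact li)).
  exact: x0n.
have [_ fl] := hom_Delta_costandard aqh2 l2i ess2 lt2 nf.
have [v|g gP] := factor_inj (f := ghom_comp b (fmap Phi l)) l2i.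
  by have [y yE] := lsurj v; have [z zE] := fl y; exists z; rewrite zE yE.
exists g; apply: bij_iso.
  apply: ghom_inj => v gv; apply: (inj0 (fmap_inj Phi_exact li)); apply: (inj0 bii).
  by have := gP v; rewrite gv ghom0 => /esym.
apply: simple_im; first exact: simple_modP.
exists x0 => gx; have := gP x0; rewrite gx ghom0 => /esym /(inj0 bii).
by move/(inj0 (fmap_inj Phi_exact li)).
Qed.

Lemma simple_image_shift p n : iso (Phi (fgshift n (L1 p))) (shift n (L2 (phi p))).
Proof.
exact: iso_trans (fobj_shift Phi_graded n (L1 p)) (iso_shift n (simple_image p)).
Qed.

Lemma conservative (V : fgmod H1) : (forall x : Phi V, x = 0) -> forall v : V, v = 0.
Proof.
move=> V0; apply: contrapT => /existsNP nV.
have [p [n [f [fs _]]]] := simple_quotient D1 Hn1 (gsub_zero V) nV.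
have [x xn] := simple_nz D2 (phi p).
have [a [a' [aa' a'a]]] := simple_image_shift p n.
apply: xn; rewrite -(a'a x).
have [y <-] := fmap_surj Hn1 Phi_exact (fs : surj (f : ghom V (fgshift n (L1 p))))
  (a' x).
by rewrite (V0 y) !ghom0.
Qed.

(** In the target, nonzero maps exist only for equal indices and shifts, and then they form a line.
    The image of a nonzero map of the source spans it. *)
Lemma full_Delta_costandard p s n m :
  full_on Phi (fgshift n (De1 p)) (fgshift m (N1 s)).
Proof.
have red : full_on Phi (fgshift (n - m) (De1 p)) (N1 s) ->
    full_on Phi (fgshift n (De1 p)) (fgshift m (N1 s)).
  move=> /(@full_on_shift _ _ _ _ Phi_graded m).
  apply: full_on_iso; last exact: iso_refl.
  by apply: iso_shift_shift; rewrite addrC subrK.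
apply: red; move: (n - m) => {m}n g.
have [a [a' [aa' a'a]]] := iso_trans (fobj_shift Phi_graded n (De1 p)) (iso_shift n
  (Phi_Delta p)).
have [b [b' [bb' b'b]]] := Phi_nabla s.
pose g' := ghom_comp b (ghom_comp g a').
have gE x : g x = b' (g' (a x)) by rewrite /= bb' aa'.
have [ng|/forallNP ng] := pselect (exists x, g' x <> 0); last first.
  exists (ghom_zero _ _) => x; rewrite gE (contrapT (ng (a x))) ghom0.
  by rewrite (fmap0 (f := ghom_zero _ _)).
have [l2 [l2i ess2 lt2 _]] := costandard_socle aqh2 nabla2P (phi s).
have [/(bij_inj phi_bij) ps _] := hom_Delta_costandard aqh2 l2i ess2 lt2 ng.
subst s; have [n0 _] := hom_Delta_costandard_scal aqh2 nabla2P g' ng.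
subst n; have [u [v uv]] := exists_Delta_costandard aqh1 nabla1P p.
pose u0 : ghom (fgshift 0 (De1 p)) (N1 p) :=
  ghom_ofl (is_deg_ghom u).
pose g1 := ghom_comp b (ghom_comp (fmap Phi u0) a').
(* By faithfulness the nonzero [u0] has nonzero image, so [g'] is a multiple of [g1]. *)
have ng1 : exists x, g1 x <> 0.
  apply: contrapT => /forallNP h; apply: uv.
  apply: (fmap_faithful Hn1 Phi_exact conservative (f := u0)) => x.
  by have := contrapT (h (a x)); rewrite /= aa' => /(inj0 (can_inj bb')).
have [_ [c cP]] := hom_Delta_costandard_scal aqh2 nabla2P g' ng1.
exists (ghom_lin c u0 (ghom_zero _ _)) => x; rewrite gE cP ghomZ fmap_lin.
by rewrite (fmap0 (f := ghom_zero _ _)) // addr0 /= bb' aa'.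
Qed.

(** The restriction of [u] to [Phi U] comes from some [f'], which extends to [V] because Ext^1
    vanishes in the source. What remains of [u] factors through the standard quotient. *)
Lemma full_Delta_filtered (V : fgmod H1) s m : Delta_filtered D1 V ->
  full_on Phi V (fgshift m (N1 s)).
Proof.
elim=> {V} [V V0 g|U V n p f g fi fg gs _ IH u].
  exists (ghom_zero _ _) => x; rewrite (fmap0 (f := ghom_zero _ _)) //.
  by rewrite (fobj0 V0 x) ghom0.
have [f' f'P] := IH (ghom_comp u (fmap Phi f)).
have [h hP] := ext_Delta_costandard aqh1 spade1 nabla1P (s := s) (m := m) fi fg gs f'.
pose W := fgshift n (De1 p); pose h' : ghom V (fgshift m (N1 s)) := h.
pose gW : ghom V W := g; have gsW : surj gW := gs.
have [|v vP] := factor_surj (f := ghom_lin (-1) (fmap Phi h') u)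
  (fmap_surj Hn1 Phi_exact gsW).
  move=> x /(fmap_exact Phi_exact fi (fg : exact_at f gW) gsW)[y <-].
  rewrite /= rmorphN1 scaleN1r -fmap_compE.
  have -> : u (fmap Phi f y) = fmap Phi f' y := f'P y.
  by rewrite (fmap_ext (g := f')) ?addNr.
have [v' v'P] := full_Delta_costandard v.
exists (ghom_lin 1 (ghom_comp v' gW) h') => x.
rewrite fmap_lin fmap_compE -v'P vP /= rmorph1 rmorphN1 scale1r scaleN1r.
by rewrite addrAC addNr add0r.
Qed.

(** Seen as a map into [Phi N], [g] comes from some [f]. The composite of [f] with [N -> N / L] is
    killed by [Phi], so it is zero by faithfulness, and [f] lands in [L]. *)
Lemma full_proj_simple p s m : full_on Phi (P1 p) (fgshift m (L1 s)).
Proof.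
move=> g; have [l [li _ _ _]] := costandard_socle aqh1 nabla1P s.
have gI := gsub_im (ghom_shift m l).
pose C := @fgquot _ _ (fgshift m (N1 s)) _ gI.
pose c : ghom (fgshift m (N1 s)) C := quot_map gI.
pose lm : ghom (fgshift m (L1 s)) (fgshift m (N1 s)) := ghom_shift m l.
have cs : surj c by apply: quot_map_surj.
have lc : exact_at lm c by move=> v; apply: quot_map0.
have [f fP] := full_Delta_filtered (s := s) (m := m)
  (Delta_filtered_proj aqh1 spade1 nabla1P p) (ghom_comp (fmap Phi lm) g).
have [v|f' f'P] := factor_inj (i := lm) (f := f) li.
  apply/lc.
  apply: (fmap_faithful Hn1 Phi_exact conservative (f := ghom_comp c f)) => x.
  rewrite fmap_compE -fP; apply/(fmap_exact Phi_exact (li : injective lm) lc cs).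
  by exists (g x).
exists f' => x; apply: (fmap_inj Phi_exact (li : injective lm)).
have -> : fmap Phi lm (g x) = fmap Phi f x := fP x.
by rewrite -fmap_compE; apply: fmap_ext => v; exact: esym (f'P v).
Qed.

Lemma full_proj_bounded p (V : fgmod H1) M :
  bounded_above V M -> full_on Phi (P1 p) V.
Proof.
move=> hM; have [b hb] := bounded_fin Hl1 (fg_fg V) hM.
apply: (@devissage _ _ _ _ D1 Hn1 (full_on Phi (P1 p)) _ _ V b hb).
- by move=> W W0; apply: full_on_zero.
- move=> U W X f g [fi fg gs]; apply: full_on_ext fi fg gs => //.
  exact: proj_projective.
- by move=> s n _; apply: full_proj_simple.
Qed.

(* The submodule generated in degrees [>= m] has bounded quotient, and its
   image lies in degrees too large for maps from [Phi P1(p)] to see it. *)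
Lemma full_proj p (V : fgmod H1) : full_on Phi (P1 p) V.
Proof.
move=> g; have [c hc'] := fobj_bounded_below Hn1 Hl2 Phi_exact Phi_graded.
have [l0 hl0] := fg_span (fg_fg (Phi (P1 p))).
have [l [lh lP]] := homogeneous_gens (coeffs_all H2) (l := l0) (gsub_full _)
  (fun _ _ => Logic.I).
have [b0 hb0] : exists b0 : int, forall b, b \in l -> exists2 n, n < b0 & mdeg n b.
  have : forall b, b \in l -> exists n, mdeg n b by move=> b /lh[].
  elim: l {lh lP} => [|b l IH] lh; first by exists 0.
  have [|b0 hb0] := IH; first by move=> x xl; apply: lh; rewrite inE xl orbT.
  have [n hb] := lh b (mem_head _ _); exists (Num.max b0 (n + 1)) => x.
  rewrite inE => /predU1P[->|/hb0[i ib hx]].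
    by exists n => //; rewrite lt_max ltrDl ltr01 orbT.
  by exists i => //; rewrite lt_max ib.
(* With this [m], the submodule [W] vanishes below [m + NH] and [Phi W] below [m + NH + c = b0], a
   bound that exceeds the degrees of the generators of [Phi (P1 p)]. *)
have [NH hNH] := Hl1.2; pose m := b0 - c - NH.
pose S (v : V) := exists s : seq V,
  (forall b, b \in s -> exists2 n, m <= n & mdeg n b) /\ hspan s v.
have gS : gsub S.
  apply: gsub_intro; first by exists [::].
    move=> a x y [s [h1 h2]] [t [h1' h2']]; exists (s ++ t); split.
      by move=> b; rewrite mem_cat => /orP[/h1|/h1'].
    apply: span_lin => //; [move: h2|move: h2']; apply: span_sub => // b bs;
    by rewrite mem_cat bs ?orbT.
  move=> n v [s [h1 h2]]; exists s; split=> //; move: h2; apply: gsub_hc.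
  by apply: gsub_hspan => b /h1[i _ hi]; exists i.
pose W := fgsub Hn1 gS; pose j : ghom W V := sub_incl gS.
pose C := fgquot gS; pose q : ghom V C := quot_map gS.
have ji : injective j by apply: sub_incl_inj.
have qs : surj q by apply: quot_map_surj.
have jq : exact_at j q by move=> v; rewrite quot_map0; apply: sub_inclP.
have Cb : bounded_above C m.
  move=> n y mn hy; have [v hv <-] := surj_mdeg qs hy; apply/quot_map0.
  exists [:: v]; split=> [b|]; first by rewrite inE => /eqP->; exists n.
  by apply: span_mem => //; rewrite mem_head.
have Wb : bounded_below W (m + NH).
  move=> n w nm hw; apply: ji; rewrite ghom0.
  have [s [h1 h2]] := sub_typeP w.
  suff e v : hspan s v -> hc V n v = 0.
    by rewrite -(comp_id (mdeg_grading W) hw) -hc_ghom; apply: e.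
  elim: s h1 {h2} v => [|b s IH] h1 v /=.
    by move=> ->; rewrite raddf0.
  move=> [a _ hv]; rewrite -[v](subrK (a *: b)) raddfD /= IH // ?add0r; last first.
    by move=> x xs; apply: h1; rewrite inE xs orbT.
  have [i mi hb] := h1 b (mem_head _ _).
  rewrite (hc_scale _ _ hb) (hNH (n - i) _ _ (comp_deg _ _ _)) ?scale0r //.
  by lia.
have [f'' f''P] := full_proj_bounded (p := p) Cb (ghom_comp (fmap Phi q) g).
have [f fP] := @proj_projective _ _ _ _ D1 p V C q f'' qs.
exists f => x; apply/eqP; rewrite -subr_eq0 addrC; apply/eqP.
pose e := ghom_lin (-1) (fmap Phi f) g.
suff ex : e x = 0 by move: ex; rewrite /= rmorphN1 scaleN1r.
apply: (span_gsub (gsub_ker e) _ (lP _ (hl0 x))) => b bl.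
have [n nb hb] := hb0 b bl.
(* The error [e] dies in [Phi C], so its value on a generator comes from [Phi W] in a degree
   [n < b0], where there is nothing. *)
have /(fmap_exact Phi_exact ji jq qs)[w wE] : fmap Phi q (e b) = 0.
  rewrite /= rmorphN1 scaleN1r ghomD raddfN /= -fmap_compE.
  have -> : fmap Phi q (g b) = fmap Phi f'' b := f''P b.
  by rewrite (fmap_ext (g := f'')) ?addNr.
have hw : mdeg n w.
  by apply: (inj_mdeg (fmap_inj Phi_exact ji)); rewrite wE; apply: ghom_deg.
rewrite -wE (hc' W _ Wb n w _ hw) ?ghom0 //.
by rewrite /m; lia.
Qed.

Lemma full_cover (V : fgmod H1) : exists (Q : fgmod H1) (f : ghom Q V),
  (forall M, full_on Phi Q M) /\ surj f.
Proof.
apply: (@cover_simple _ _ V (fun Q _ => forall M, full_on Phi Q M) _ _ _ _ D1 Hn1).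
- exists (fgsub Hn1 (gsub_zero V)), (ghom_zero _ _) => M g.
  have Z0 : forall z : fgsub Hn1 (gsub_zero V), z = 0.
    by move=> z; apply: sub_incl_inj; rewrite ghom0; exact: (sub_typeP z).
  exists (ghom_zero _ _) => x; rewrite (fobj0 Z0 x) ghom0.
  by rewrite (fmap0 (f := ghom_zero _ _)).
- move=> X X' f f' hX hX'; exists (fgprod X X'), (prod_case f f'); split.
    by move=> M; apply: full_on_prod.
  by move=> x x'; exists (x, x'); rewrite prod_caseE.
- move=> p n f fs; have [t tP] := lift_cover fs.
  exists (fgshift n (P1 p)), t; split.
    by move=> M; apply: full_on_shiftl => //; apply: full_proj.
  by have [x xP] := pr_nz D1 p; exists x; rewrite tP.
Qed.

Lemma functor_faithful (U V : fgmod H1) (f g : ghom U V) :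
  (forall x, fmap Phi f x = fmap Phi g x) -> forall v, f v = g v.
Proof. exact: (fmap_faithful2 Hn1 Phi_exact conservative). Qed.

(** The map is realised on a cover [Q] of [U]. The realisation kills the kernel of the cover, since
    its restriction there has zero image under the faithful [Phi]. *)
Lemma functor_full (U V : fgmod H1) : full_on Phi U V.
Proof.
move=> g; have [Q [p [Qf ps]]] := full_cover U.
have [h hP] := Qf V (ghom_comp g (fmap Phi p)).
have gK := gsub_ker p; pose j : ghom (fgsub Hn1 gK) Q := sub_incl gK.
have [x px|f fP] := factor_surj (f := h) ps.
  have hj : forall v, ghom_comp h j v = 0.
    apply: (fmap_faithful Hn1 Phi_exact conservative) => y.
    rewrite fmap_compE -hP /= -fmap_compE fmap0 ?ghom0 // => v.
    exact: (sub_typeP v).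
  exact: (hj (sub_elt gK px)).
exists f => y; have [x <-] := fmap_surj Hn1 Phi_exact ps y.
by rewrite -fmap_compE [LHS]hP; apply: fmap_ext => v; rewrite /= fP.
Qed.

Lemma phi_surj r : exists s, phi s = r.
Proof. by have [psi _ h] := phi_bij; exists (psi r). Qed.

Lemma image_Delta_filtered (V : fgmod H1) :
  Delta_filtered D1 V -> Delta_filtered D2 (Phi V).
Proof.
elim=> {V} [V V0|U V n p f g fi fg gs _ IH].
  by apply: Delta_filtered0; apply: fobj0.
pose W := fgshift n (De1 p); pose gW : ghom V W := g; have gsW : surj gW := gs.
have [a ai] := iso_trans (fobj_shift Phi_graded n (De1 p)) (iso_shift n (Phi_Delta p)).
apply: (@Delta_filteredS _ _ _ _ D2 _ _ n (phi p) (fmap Phi f) (ghom_comp a (fmap Phi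
  gW))) => //.
- exact: fmap_inj.
- move=> v; rewrite -(fmap_exact Phi_exact fi (fg : exact_at f gW) gsW).
  by split=> /= [/(inj0 (iso_inj ai))//|->]; rewrite ghom0.
- move=> w; have [v <-] := iso_surj ai w.
  by have [u <-] := fmap_surj Hn1 Phi_exact gsW v; exists u.
Qed.

(* [Hom(Phi P1(p), -)] is exact on [0 -> L2 -> N2 -> N2 / L2 -> 0], because this
   sequence is the image of one in the source; hence Ext^1(Phi P1(p), L2)
   embeds in Ext^1(Phi P1(p), N2) = 0. *)
Lemma image_proj_ext p s n : ext_split (Phi (P1 p)) (Phi (fgshift n (L1 s))).
Proof.
have [l [li _ _ _]] := costandard_socle aqh1 nabla1P s.
have gI := gsub_im (ghom_shift n l).
pose C := @fgquot _ _ (fgshift n (N1 s)) _ gI.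
pose c : ghom (fgshift n (N1 s)) C := quot_map gI.
pose lm : ghom (fgshift n (L1 s)) (fgshift n (N1 s)) := ghom_shift n l.
have lmi : injective lm := li.
have cs : surj c by apply: quot_map_surj.
have lc : exact_at lm c by move=> v; apply: quot_map0.
have ec := fmap_exact Phi_exact lmi lc cs.
have eN : ext_split (Phi (P1 p)) (Phi (fgshift n (N1 s))).
  have iN := iso_trans (fobj_shift Phi_graded n (N1 s)) (iso_shift n (Phi_nabla s)).
  apply: (ext_split_isor (iso_sym iN)).
  apply: (ext_Delta_filtered aqh2 spade2 nabla2P).
  exact: image_Delta_filtered (Delta_filtered_proj aqh1 spade1 nabla1P p).
move=> A B i q ii iq qs f.
have [h hP] := eN A B i q ii iq qs (ghom_comp (fmap Phi lm) f).
have [b qb|v vP] := factor_surj (f := ghom_comp (fmap Phi c) h) qs.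
  have [a <-] := (iq b).1 qb; rewrite /= hP; apply/ec.
  by exists (f a).
(* [v] is the obstruction to landing in [Phi L]. By fullness it comes from the source, where it
   lifts along [c], and the lift [t'] corrects [h]. *)
have [t tP] := full_proj v.
have [t' t'P] := @proj_projective _ _ _ _ D1 p _ C c t cs.
pose e := ghom_lin (-1) (ghom_comp (fmap Phi t') q) h.
have eE b : e b = h b - fmap Phi t' (q b).
  by rewrite /= rmorphN1 scaleN1r addrC.
have [b|e' e'P] := factor_inj (f := e) (fmap_inj Phi_exact lmi).
  apply/ec; rewrite eE ghomB -fmap_compE (fmap_ext (g := t)) //.
  by rewrite -tP vP subrr.
exists e' => a; apply: (fmap_inj Phi_exact lmi).
rewrite e'P eE hP (_ : q (i a) = 0) ?ghom0 ?subr0 //.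
by apply/iq; exists a.
Qed.

(** [pr2 (phi p)] lifts along [psi] to a map [s]. It is onto because [Phi (P1 p)] has a simple head,
    and injective because maps from its kernel to simples extend to [P2 (phi p)]. *)
Lemma image_proj p : iso (P2 (phi p)) (Phi (P1 p)).
Proof.
have [a ai] := simple_image p.
pose psi := ghom_comp a (fmap Phi (pr1 p)).
have prs := @pr_surj _ _ _ _ D1 p.
have psis : surj psi.
  move=> w; have [v <-] := iso_surj ai w.
  by have [u <-] := fmap_surj Hn1 Phi_exact prs v; exists u.
have [x0 x0n] := pr_nz D2 (phi p).
(* By fullness a nonzero [u] is, up to isomorphism, the image of a nonzero [v] on [P1 p], and
   [pr1 p] factors through [v]. *)
have pr_ker n r (u : ghom (Phi (P1 p)) (shift n (L2 r))) x :
    (exists y, u y <> 0) -> u x = 0 -> psi x = 0.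
  have [s sr] := phi_surj r; subst r => [[y uy] ux].
  have [b [b' [bb' b'b]]] := simple_image_shift s n.
  have [v vP] := full_proj (ghom_comp b' u).
  have nv : exists z, v z <> 0.
    apply: contrapT => /forallNP v0; apply: uy.
    rewrite -(b'b (u y)) (_ : b' (u y) = fmap Phi v y); last exact: vP.
    by rewrite fmap0 ?ghom0 // => z; apply: contrapT (v0 z).
  have vs := simple_im (simple_shift n (simple_modP D1 s)) nv.
  have vr : forall z, v z = 0 -> pr1 p z = 0.
    apply: (@pr_radical _ _ _ _ D1 p (fun z => v z = 0)) => //; exact: gsub_ker.
  have [h hP] := @factor_surj _ _ _ (fgshift n (L1 s)) _ v (pr1 p) vs vr.
  have -> : psi x = a (fmap Phi h (fmap Phi v x)).
    by rewrite -fmap_compE /=; congr (a _); apply: fmap_ext => z; rewrite /= hP.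
  have <- : b' (u x) = fmap Phi v x := vP x.
  by rewrite ux !ghom0.
have [s sP] := @proj_projective _ _ _ _ D2 (phi p) (Phi (P1 p)) (L2 (phi p)) psi
  (pr2 (phi p)) psis.
(* Otherwise a nonzero map to a simple kills the image of [s]; then so does [psi], although [psi]
   composed with [s] is [pr2 (phi p)]. *)
have ss : surj s.
  move=> x; apply: contrapT => nx.
  have [|r [n [u [us uk]]]] := simple_quotient D2 Hn2 (gsub_im s); first by exists x.
  have nu : exists y, u y <> 0.
    have [v vn] := simple_nz D2 r; have [y yv] := us v; by exists y; rewrite yv.
  by apply: x0n; rewrite -sP; apply: (pr_ker n r u) => //; apply: uk; exists x0.
have gK := gsub_ker s; pose K := fgsub Hn2 gK.
pose j : ghom K (P2 (phi p)) := sub_incl gK.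
exists s; apply: bij_iso => //; apply: ghom_inj => y sy; apply: contrapT => y0.
have [|r [n [w [ws _]]]] := simple_quotient D2 Hn2 (gsub_zero K).
  by exists (sub_elt gK sy) => /(congr1 j); rewrite ghom0.
have [r' rE] := phi_surj r; subst r.
have [b [b' [bb' b'b]]] := simple_image_shift r' n.
have ji : injective j by apply: sub_incl_inj.
have js : exact_at j s by move=> v; apply: (sub_inclP gK).
(* The extension to [P2 (phi p)] of a simple quotient of the kernel of [s] has the same kernel as
   [pr2 (phi p)], so it kills the kernel of [s], a contradiction. *)
have [h hP] := image_proj_ext ji js ss (ghom_comp b' w).
have [v vn] := simple_nz D2 (phi r'); have [z zv] := ws v.
pose t := ghom_ofl (@is_deg_shiftr _ _ (P2 (phi p)) (L2 (phi r')) n (ghom_comp b h)).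
have tz : t (j z) <> 0.
  have -> : t (j z) = b (h (j z)) by [].
  by rewrite hP /= b'b zv.
have [|g [gi gP]] := @simple_factor _ _ _ _ D2 _ _ _ t; first by exists (j z).
apply: tz; apply: (inj0 gi); rewrite gP -sP /=.
by rewrite (_ : s (j z) = 0) ?ghom0 //; apply: (sub_typeP z).
Qed.

Lemma image_cover (V : fgmod H2) : exists (Q : fgmod H1) (f : ghom (Phi Q) V), surj f.
Proof.
suff [X [f [[Q [a [a' [_ aa']]]] fs]]] : exists (X : fgmod H2) (f : ghom X V),
    (exists Q, iso (Phi Q) X) /\ surj f.
  exists Q, (ghom_comp f a) => v; have [x <-] := fs v.
  by exists (a' x); rewrite /= aa'.
apply: (@cover_simple _ _ V (fun X _ => exists Q, iso (Phi Q) X) _ _ _ _ D2 Hn2).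
- pose Z := fgsub Hn1 (gsub_zero (fgreg H1)).
  by exists (Phi Z), (ghom_zero _ _), Z; apply: iso_refl.
- move=> X X' f f' [Q [a [b [_ ba]]]] [Q' [a' [b' [_ ba']]]].
  pose fst_ : ghom (fgprod Q Q') Q := prod_fst Q Q'.
  pose snd_ : ghom (fgprod Q Q') Q' := prod_snd Q Q'.
  pose inl_ : ghom Q (fgprod Q Q') := prod_inl Q Q'.
  pose inr_ : ghom Q' (fgprod Q Q') := prod_inr Q Q'.
  exists (Phi (fgprod Q Q')), (ghom_lin 1
    (ghom_comp f (ghom_comp a (fmap Phi fst_)))
    (ghom_comp f' (ghom_comp a' (fmap Phi snd_)))); split.
    by exists (fgprod Q Q'); apply: iso_refl.
  move=> x x'; exists (fmap Phi inl_ (b x) + fmap Phi inr_ (b' x')).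
  rewrite /= rmorph1 scale1r !ghomD -!fmap_compE.
  rewrite (fmap_ext (f := ghom_comp fst_ inl_) (g := ghom_id Q)) // fmap_idE.
  rewrite (fmap_ext (f := ghom_comp snd_ inr_) (g := ghom_id Q')) // fmap_idE.
  rewrite (fmap0 (f := ghom_comp fst_ inr_)) // (fmap0 (f := ghom_comp snd_ inl_)) //.
  by rewrite !ghom0 addr0 add0r ba ba'.
- move=> r n; have [s <-] := phi_surj r => f fs; have [t tP] := lift_cover fs.
  exists (fgshift n (P2 (phi s))), t; split.
    exists (fgshift n (P1 s)).
    exact: iso_trans (fobj_shift Phi_graded n (P1 s)) (iso_shift n (iso_sym
      (image_proj s))).
  by have [x xP] := pr_nz D2 (phi s); exists x; rewrite tP.
Qed.

(** [W] has a presentation by modules [Phi Q1] and [Phi Q0]. By fullness its arrow is the image of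
    some [g], and by exactness [W] is the image of the cokernel of [g]. *)
Lemma functor_ess_surj (W : fgmod H2) : exists V, iso (Phi V) W.
Proof.
have [Q0 [f fs]] := image_cover W.
have gK := gsub_ker f; pose j : ghom (fgsub Hn2 gK) (Phi Q0) := sub_incl gK.
have [Q1 [f1 f1s]] := image_cover (fgsub Hn2 gK).
have [g gP] := functor_full (ghom_comp j f1).
have gI := gsub_im g; pose I := fgsub Hn1 gI; pose i : ghom I Q0 := sub_incl gI.
pose C := fgquot gI; pose c : ghom Q0 C := quot_map gI.
have ii : injective i by apply: sub_incl_inj.
have cs : surj c by apply: quot_map_surj.
have ic : exact_at i c by move=> v; rewrite quot_map0; apply: (sub_inclP gI).
have [v|e eP] := factor_inj (f := g) ii; first by apply/(sub_inclP gI); exists v.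
have es : surj (e : ghom Q1 I).
  move=> u; have [v vu] := sub_typeP u; exists v.
  by apply: ii; rewrite eP.
have kerE y : fmap Phi c y = 0 <-> f y = 0.
  rewrite (fmap_exact Phi_exact ii ic cs); split=> [[u <-]|fy].
    have [v <-] := fmap_surj Hn1 Phi_exact es u.
    rewrite -fmap_compE (fmap_ext (g := g)) // -gP.
    exact: (sub_typeP (f1 v)).
  have [v vP] := f1s (sub_elt gK fy); exists (fmap Phi (e : ghom Q1 I) v).
  by rewrite -fmap_compE (fmap_ext (g := g)) // -gP /= vP.
have [y /kerE//|h hP] := factor_surj (f := f) (fmap_surj Hn1 Phi_exact cs).
exists C, h; apply: bij_iso.
  apply: ghom_inj => x; have [y <-] := fmap_surj Hn1 Phi_exact cs x.
  by rewrite hP => /kerE.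
by move=> w; have [y <-] := fs w; exists (fmap Phi c y).
Qed.

End Equivalence.

(** * Quasi-inverse of a fully faithful, essentially surjective graded functor *)

Section QuasiInverse.
Variables (k : fieldType) (H1 H2 : galgebra k) (Phi : gfunctor H1 H2).
Hypothesis Phi_graded : graded_functor Phi.
Hypothesis Phi_full : forall U V, full_on Phi U V.
Hypothesis Phi_faithful : forall (U V : fgmod H1) (f g : ghom U V),
  (forall x, fmap Phi f x = fmap Phi g x) -> forall v, f v = g v.
Hypothesis Phi_ess_surj : forall W : fgmod H2, exists V, iso (Phi V) W.

Implicit Types (U V : fgmod H1) (W : fgmod H2).

Definition qi_obj W : fgmod H1 := projT1 (cid (Phi_ess_surj W)).

Lemma qi_iso W : iso (Phi (qi_obj W)) W.
Proof. by rewrite /qi_obj; case: cid. Qed.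

Definition qi_eps W : ghom (Phi (qi_obj W)) W := projT1 (cid (qi_iso W)).

Lemma qi_eps_iso W : is_iso (qi_eps W).
Proof. by rewrite /qi_eps; case: cid. Qed.

Definition qi_inv W : ghom W (Phi (qi_obj W)) := projT1 (cid (qi_eps_iso W)).

Lemma qi_epsK W : cancel (qi_eps W) (qi_inv W).
Proof. by rewrite /qi_inv; case: cid => g []. Qed.
Lemma qi_invK W : cancel (qi_inv W) (qi_eps W).
Proof. by rewrite /qi_inv; case: cid => g []. Qed.

Definition qi_lift U V (g : ghom (Phi U) (Phi V)) : ghom U V :=
  projT1 (cid (Phi_full g)).

Lemma qi_liftE U V (g : ghom (Phi U) (Phi V)) x : fmap Phi (qi_lift g) x = g x.
Proof. by rewrite /qi_lift; case: cid => f /= ->. Qed.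

Lemma qi_lift_iso U V (g : ghom (Phi U) (Phi V)) : is_iso g -> is_iso (qi_lift g).
Proof.
move=> [h [gh hg]]; exists (qi_lift h).
split=> x; [apply: (Phi_faithful (f := ghom_comp (qi_lift h) (qi_lift g)) (g :=
  ghom_id U)) => y
  |apply: (Phi_faithful (f := ghom_comp (qi_lift g) (qi_lift h)) (g := ghom_id V)) =>
    y];
by rewrite fmap_compE fmap_idE !qi_liftE ?gh ?hg.
Qed.

Definition qi_map W W' (f : ghom W W') : ghom (qi_obj W) (qi_obj W') :=
  qi_lift (ghom_comp (qi_inv W') (ghom_comp f (qi_eps W))).

Lemma qi_mapE W W' (f : ghom W W') x :
  fmap Phi (qi_map f) x = qi_inv W' (f (qi_eps W x)).
Proof. exact: qi_liftE. Qed.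

Definition quasi_inverse : gfunctor H2 H1.
Proof.
refine (@GFunctor k H2 H1 qi_obj qi_map _ _ _).
- move=> W v; apply: (Phi_faithful (f := qi_map (ghom_id W)) (g := ghom_id _)) => x.
  by rewrite qi_mapE fmap_idE /= qi_epsK.
- move=> U V W g f u.
  apply: (Phi_faithful (f := qi_map (ghom_comp g f))
    (g := ghom_comp (qi_map g) (qi_map f))) => x.
  by rewrite fmap_compE !qi_mapE /= qi_invK.
- move=> V W c f g h hE v.
  apply: (Phi_faithful (f := qi_map h) (g := ghom_lin c (qi_map f) (qi_map g))) => x.
  by rewrite fmap_lin !qi_mapE hE ghomD ghomZ.
Defined.

Lemma quasi_inverse_equivalence : graded_equivalence Phi.
Proof.
exists quasi_inverse; split=> //.
- have [theta thetai nat] := Phi_graded.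
  have [inv invP] : exists inv : forall V, ghom (fgshift 1 (Phi V)) (Phi (fgshift 1 V)),
      forall V, cancel (theta V) (inv V) /\ cancel (inv V) (theta V).
    by exists (fun V => projT1 (cid (thetai V))) => V; case: cid => g [].
  (* With [G] the quasi-inverse this is [Phi G q W -> q W -> q Phi G W -> Phi q G W], the last arrow
     being inverse to the given isomorphism. Its naturality is checked after applying [Phi]. *)
  pose m W : ghom (Phi (qi_obj (fgshift 1 W))) (Phi (fgshift 1 (qi_obj W))) :=
    ghom_comp (inv (qi_obj W)) (ghom_comp (ghom_shift 1 (qi_inv W)) (qi_eps (fgshift
      1 W))).
  exists (fun W => qi_lift (m W)) => [W|W W' f v].
    apply: qi_lift_iso.
    exists (ghom_comp (qi_inv (fgshift 1 W)) (ghom_comp (ghom_shift 1 (qi_eps W))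
      (theta (qi_obj W)))).
    split=> x /=; first by rewrite (invP _).2 qi_invK qi_epsK.
    by rewrite qi_invK qi_epsK (invP _).1.
  pose g1 : ghom (fgshift 1 W) (fgshift 1 W') := ghom_shift 1 f.
  pose g2 : ghom (fgshift 1 (qi_obj W)) (fgshift 1 (qi_obj W')) :=
    ghom_shift 1 (qi_map f).
  refine (@Phi_faithful _ _ (ghom_comp (qi_lift (m W')) (qi_map g1))
    (ghom_comp g2 (qi_lift (m W))) _ v) => x.
  rewrite !fmap_compE !qi_liftE; apply: (can_inj (invP _).1).
  have := nat _ _ (qi_map f) (m W x); rewrite /= => ->.
  by rewrite !(invP _).2 qi_mapE /= !qi_invK.
- exists (fun V => qi_lift (qi_eps (Phi V))) => [V|V V' f v].
    exact/qi_lift_iso/qi_eps_iso.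
  apply: (Phi_faithful (f := ghom_comp (qi_lift (qi_eps (Phi V'))) (qi_map (fmap Phi
    f)))
    (g := ghom_comp f (qi_lift (qi_eps (Phi V))))) => x.
  by rewrite !fmap_compE !qi_liftE /= qi_invK.
- exists qi_eps => [W|W W' f v]; first exact: qi_eps_iso.
  by rewrite /= qi_mapE qi_invK.
Qed.

End QuasiInverse.

Theorem theorem1p2 (k : fieldType) (H1 H2 : galgebra k)
    (d1 d2 : Order.disp_t)
    (Pi1 : finPOrderType d1) (Pi2 : finPOrderType d2)
    (D1 : gmod_data H1 Pi1) (D2 : gmod_data H2 Pi2)
    (aqh1 : affine_quasi_hereditary D1) (aqh2 : affine_quasi_hereditary D2)
    (spade1 : property_spade H1) (spade2 : property_spade H2)
    (nabla1 : Pi1 -> fgmod H1) (nabla2 : Pi2 -> fgmod H2)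
    (nabla1P : forall p, proper_costandard D1 p (nabla1 p))
    (nabla2P : forall p, proper_costandard D2 p (nabla2 p))
    (Phi : gfunctor H1 H2)
    (Phi_graded : graded_functor Phi) (Phi_exact : exact_functor Phi)
    (phi : Pi1 -> Pi2) (phi_bij : bijective phi)
    (phi_homo : forall p s, (p <= s)%O -> (phi p <= phi s)%O)
    (Phi_Delta : forall p, iso (Phi (Delta D1 p)) (Delta D2 (phi p)))
    (Phi_nabla : forall p, iso (Phi (nabla1 p)) (nabla2 (phi p))) :
  graded_equivalence Phi.
Proof.
apply: quasi_inverse_equivalence => //.
- exact: (functor_full aqh1 aqh2 spade1 nabla1P nabla2P Phi_graded Phi_exact
    phi_bij phi_homo Phi_Delta Phi_nabla).
- exact: (functor_faithful aqh1 aqh2 spade1 nabla1P nabla2P Phi_graded Phi_exact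
    phi_bij phi_homo Phi_Delta Phi_nabla).
- exact: (functor_ess_surj aqh1 aqh2 spade1 spade2 nabla1P nabla2P Phi_graded
    Phi_exact phi_bij phi_homo Phi_Delta Phi_nabla).
Qed.
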